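(* Let $\mathbf{\Phi}$, $Q$, $\boldsymbol{\pi}$, $\boldsymbol{g}$ and the fixed state $j\in E$ be as in the context, and for each $n$ let ${}_{(n)}\mathbf{\Phi}$ be the censored Markov chain of $\mathbf{\Phi}$ on ${}_{(n)}E=\{0,1,\dots,n\}$, with generator $${}_{(n)}\widetilde Q={}_{(n)}Q+Q_{{}_{(n)}E,{}_{(n)}E^C}\left(-Q_{{}_{(n)}E^C,{}_{(n)}E^C}\right)^{-1}Q_{{}_{(n)}E^C,{}_{(n)}E}.$$ Then: (i) for any initial state $i\in E$ with $i\ne j$ and $n\ge\max\{i,j\}$, the sequences $\{{}_{(n)}\delta_j\}$ and $\{{}_{(n)}\xi_j(|{}_{(n)}\boldsymbol{g}|)\}$ both increase (in $n$) and converge, with probability one, to $\delta_j$ and $\xi_j(|\boldsymbol{g}|)$, respectively; (ii) for any state $i\in E$, $$\lim_{n\to+\infty}{}_{(n)}f_j(i)=f_j(i).$$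
   Context: $\mathbf{\Phi}=\{\Phi_t:t\in\mathbb{R}_+\}$ is an irreducible time-homogeneous continuous-time Markov chain on $E=\mathbb{Z}_+$ with $q$-matrix $Q=(q_{ik})$, which is totally stable ($q_i:=-q_{ii}<\infty$) and regular (conservative, with non-explosive minimal process). $\mathbf{\Phi}$ is positive recurrent with unique invariant probability vector $\boldsymbol{\pi}$. $\boldsymbol{g}$ is a finite-valued (real) function on $E$ with $\boldsymbol{\pi}^T|\boldsymbol{g}|<\infty$, and $\overline{\boldsymbol{g}}=\boldsymbol{g}-(\boldsymbol{\pi}^T\boldsymbol{g})\boldsymbol{e}$, with $\boldsymbol{e}$ the vector of ones. Censored chain: the local clock of ${}_{(n)}E$ increases at unit rate with the global time while $\Phi_t\in{}_{(n)}E$ and stays constant while $\Phi_t\notin{}_{(n)}E$; ${}_{(n)}\Phi_t=\Phi_{t'}$ where $t'$ is the global time corresponding to local time $t$. Here ${}_{(n)}E^C=E\setminus{}_{(n)}E$, $Q_{E_1,E_2}=(q_{ik})_{i\in E_1,k\in E_2}$, ${}_{(n)}Q=Q_{{}_{(n)}E,{}_{(n)}E}$, and $(-Q_{{}_{(n)}E^C,{}_{(n)}E^C})^{-1}$ is the minimal nonnegative inverse (expected sojourn times in ${}_{(n)}E^C$ before hitting ${}_{(n)}E$). The censored chain is irreducible and positive recurrent, with unique invariant probability vector ${}_{(n)}\boldsymbol{\pi}$. $\mathbb{P}_i,\mathbb{E}_i$ refer to initial state $i$. $\delta_j=\inf\{t\ge J_1:\Phi_t=j\}$ is the first return time to $j$,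 where $J_1$ is the first jump time of $\mathbf{\Phi}$; ${}_{(n)}\delta_j$ is defined in the same way for ${}_{(n)}\mathbf{\Phi}$ with its first jump time ${}_{(n)}J_1$. For a function $\boldsymbol{h}$: $\xi_j(\boldsymbol{h})=\int_0^{\delta_j}h(\Phi_t)\,dt$ and ${}_{(n)}\xi_j(\boldsymbol{h})=\int_0^{{}_{(n)}\delta_j}h({}_{(n)}\Phi_t)\,dt$. ${}_{(n)}\boldsymbol{g}$ is the restriction of $\boldsymbol{g}$ to ${}_{(n)}E$, ${}_{(n)}\overline{\boldsymbol{g}}={}_{(n)}\boldsymbol{g}-({}_{(n)}\boldsymbol{\pi}^T{}_{(n)}\boldsymbol{g})\,{}_{(n)}\boldsymbol{e}$, with ${}_{(n)}\boldsymbol{e}$ the $(n+1)$-vector of ones. $f_j(i)=\mathbb{E}_i[\xi_j(\overline{\boldsymbol{g}})]$ for $i\in E$ (a solution of Poisson's equation $Q\boldsymbol{f}=-\overline{\boldsymbol{g}}$), and ${}_{(n)}f_j(i)=\mathbb{E}_i[{}_{(n)}\xi_j({}_{(n)}\overline{\boldsymbol{g}})]$ for $i\in{}_{(n)}E$. *)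

(* Defs.v *)
From mathcomp Require Import all_boot all_order all_algebra.
From mathcomp Require Import all_classical all_reals all_analysis.
Import Order.TTheory GRing.Theory Num.Theory.
Import numFieldNormedType.Exports.

Set Implicit Arguments.
Unset Strict Implicit.
Unset Printing Implicit Defensive.

Local Open Scope classical_set_scope.
Local Open Scope ring_scope.

(* The state space is nat. A path is a function R -> nat of which only the
   values at times t >= 0 matter. *)

(* [next_jump X s] is +oo when the path X is constant on [s, +oo[ or when
   s = +oo; hence the m-th jump time is +oo if X has fewer than m jumps. *)
Definition next_jump {R : realType} (X : R -> nat) (s : \bar R) : \bar R :=
  match s with
  | r%:E => ereal_inf [set t%:E | t in [set t | r <= t /\ X t <> X r]]
  | _ => +oo%E
  end.

Definition jump_time {R : realType} (X : R -> nat) (m : nat) : \bar R :=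
  iter m (next_jump X) 0%E.

Definition return_time {R : realType} (X : R -> nat) (j : nat) : \bar R :=
  ereal_inf [set t%:E | t in [set t | (jump_time X 1 <= t%:E)%E /\ X t = j]].

Definition return_integral {R : realType} (h : nat -> R) (X : R -> nat)
    (j : nat) : \bar R :=
  (\int[lebesgue_measure]_(t in [set t : R | (0 <= t)%R /\ t%:E < return_time X j])
     (h (X t))%:E)%E.

Definition local_clock {R : realType} (n : nat) (X : R -> nat) (t : R) : \bar R :=
  lebesgue_measure [set s : R | 0 <= s <= t /\ (X s <= n)%N].

(* The local clock is constant during an excursion outside {0, ..., n}; the
   global time attached to a local time t is the end of the excursion, i.e. the
   right-continuous inverse of the clock, so that the path is in {0, ..., n} at
   that time. *)
Definition global_time {R : realType} (n : nat) (X : R -> nat) (t : R) : \bar R :=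
  ereal_inf [set s%:E | s in [set s | 0 <= s /\ (t%:E < local_clock n X s)%E]].

(* The value is irrelevant on paths whose total time in {0, ..., n} is finite
   (there global_time may be +oo, whose [fine] is 0). *)
Definition censored {R : realType} (n : nat) (X : R -> nat) : R -> nat :=
  fun t => X (fine (global_time n X t)).

(* Elementary Markov property with respect to the natural filtration,
   [P k [set w | Phi t w = l]] being the transition function p_t(k, l); Q is the
   right derivative at 0 of the transition function. *)
Record markov_chain {R : realType} {d : measure_display} {T : measurableType d}
    (P : nat -> probability T R) (Phi : R -> T -> nat) (Q : nat -> nat -> R)
    : Prop := MarkovChain {
  mc_measurable : forall (t : R) k, 0 <= t -> measurable [set w | Phi t w = k] ;
  mc_right_continuous : forall w (t : R), 0 <= t ->
    \forall s \near t^'+, Phi s w = Phi t w ;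
  mc_initial : forall i, P i [set w | Phi 0 w = i] = 1%E ;
  mc_markov : forall (i k l : nat) (past : seq (R * nat)) (s t : R),
    0 <= s -> 0 <= t -> (forall x : R * nat, x \in past -> 0 <= x.1 <= s) ->
    P i [set w | (forall x : R * nat, x \in past -> Phi x.1 w = x.2) /\
                 Phi s w = k /\ Phi (s + t) w = l] =
    (P i [set w | (forall x : R * nat, x \in past -> Phi x.1 w = x.2) /\ Phi s w = k] *
     P k [set w | Phi t w = l])%E ;
  mc_qmatrix : forall i k,
    (fine (P i [set w | Phi t w = k]) - (i == k)%:R) / t @[t --> 0^'+] --> Q i k
}.

Definition conservative {R : realType} (Q : nat -> nat -> R) : Prop :=
  forall i, (\sum_(0 <= k <oo) (Q i k)%:E = 0)%E.

(* Before its explosion time sup_m J_m, a chain with a stable and conservative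
   q-matrix is the minimal process. *)
Definition non_explosive {R : realType} {d : measure_display}
    {T : measurableType d} (P : nat -> probability T R) (Phi : R -> T -> nat)
    : Prop :=
  forall i, {ae P i, forall w,
    jump_time (fun t => Phi t w) m @[m --> \oo] --> +oo%E}.

Definition irreducible {R : realType} {d : measure_display}
    {T : measurableType d} (P : nat -> probability T R) (Phi : R -> T -> nat)
    : Prop :=
  forall i k, exists2 t : R, 0 < t & (0 < P i [set w | Phi t w = k])%E.

Definition positive_recurrent {R : realType} {d : measure_display}
    {T : measurableType d} (P : nat -> probability T R) (Phi : R -> T -> nat)
    : Prop :=
  forall i, (\int[P i]_w return_time (fun t => Phi t w) i < +oo)%E.

Definition invariant_probability {R : realType} {d : measure_display}
    {T : measurableType d} (P : nat -> probability T R) (Phi : R -> T -> nat)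
    (pi : nat -> R) : Prop :=
  [/\ forall k, 0 <= pi k,
      (\sum_(0 <= k <oo) (pi k)%:E = 1)%E &
      forall (t : R) k, 0 <= t ->
        (\sum_(0 <= i <oo) (pi i)%:E * P i [set w | Phi t w = k] =
         (pi k)%:E)%E].

(* The matrix X restricted to indices > n is a nonnegative two-sided inverse of
   -Q restricted to indices > n. In each of the series at most one term is
   positive, so that all the limits exist in the extended reals. *)
Definition nonneg_inverse {R : realType} (n : nat) (Q X : nat -> nat -> R)
    : Prop :=
  forall k l, (n < k)%N -> (n < l)%N ->
    [/\ 0 <= X k l,
        (\sum_(n.+1 <= m <oo) (- Q k m * X m l)%:E = ((k == l)%:R)%:E)%E &
        (\sum_(n.+1 <= m <oo) (X k m * - Q m l)%:E = ((k == l)%:R)%:E)%E].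

Definition minimal_nonneg_inverse {R : realType} (n : nat)
    (Q X : nat -> nat -> R) : Prop :=
  nonneg_inverse n Q X /\
  forall Y, nonneg_inverse n Q Y ->
    forall k l, (n < k)%N -> (n < l)%N -> X k l <= Y k l.

(* The series has nonnegative terms when Q is a q-matrix and G >= 0. *)
Definition censored_generator {R : realType} (n : nat) (Q G : nat -> nat -> R)
    : 'M[R]_n.+1 :=
  \matrix_(i < n.+1, k < n.+1)
    (Q i k + fine (\sum_(n.+1 <= l <oo) \sum_(n.+1 <= m <oo)
                     (Q i l * G l m * Q m k)%:E)%E).

Definition generator_invariant {R : realType} (n : nat) (A : 'M[R]_n)
    (v : 'rV[R]_n) : Prop :=
  [/\ forall k, 0 <= v 0 k, \sum_k v 0 k = 1 & v *m A = 0].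

Definition centered {R : realType} (pi g : nat -> R) : nat -> R :=
  fun k => g k - limn (series (fun l => pi l * g l)).

Definition censored_centered {R : realType} (n : nat) (v : 'rV[R]_n.+1)
    (g : nat -> R) : nat -> R :=
  fun k => g k - \sum_(l < n.+1) v 0 l * g l.

(* Main.v *)
Require Import Defs.
From mathcomp Require Import all_boot all_order all_algebra.
From mathcomp Require Import all_classical all_reals all_analysis.
From mathcomp Require Import measurable_realfun ring lra.
Import Order.TTheory GRing.Theory Num.Theory.
Import numFieldNormedType.Exports.
Local Open Scope classical_set_scope.
Local Open Scope ring_scope.

Set Implicit Arguments.
Unset Strict Implicit.
Unset Printing Implicit Defensive.

(** Everything about the censored chain is read off the path of the chain
    itself.  The local clock of [{0, ..., n}] is continuous, grows exactly while
    the path is in [{0, ..., n}], and transports Lebesgue measure on those times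
    to Lebesgue measure.  Hence, if [rho] is the first visit to [j] preceded by a
    visit to [{0, ..., n} \ {j}], the return time of the censored path is the
    value of the clock at [rho] ([return_time_censored]), and its return integral
    is the integral of [h (X s)] over the times [s < rho] with [X s <= n]
    ([return_integral_censored]).  When the path starts in a state other than [j]
    and [n] is large, [rho] is the first visit to [j], whatever [n] is: on each
    path that reaches [j], (i) is monotone convergence ([censored_limits]).

    For (ii), [rho] equals the return time as soon as [n] is large, depending on
    the path; so dominated convergence on the product of the path space and the
    time axis ([return_integral_cvg]) reduces the claim to two facts.

    The first is an integrable bound.  Instead of the strong Markov property, it
    uses the chain at integer times: [rho] is at most the first integer time at
    which [j] is visited after an integer time spent in [j.+1].  The Markov
    property at integer times expands the expected integral of [|g| + 1] up to
    that time into products of taboo kernels.  Their sum, the potential of [j], is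
    at most [pi h / pi j] when it starts from [j], by stationarity
    ([potential_le_mean]), and finiteness propagates along the transitions
    ([potential_fin]).  The same bound shows that almost every path reaches [j]
    ([good_ae]).

    The second is that the mean of [g] under the invariant vector of the censored
    generator [A] tends to [pi g]; indeed this vector is [pi] conditioned on
    [{0, ..., n}] ([censored_invariant_eq]).  The minimal inverse is the Neumann
    series of the jump matrix killed on [{0, ..., n}] ([inverse_neumann]), so that
    [W = G Q] is substochastic and every vector [psi] on [{0, ..., n}] extends to a
    bounded function [phi] with [Q phi = A psi] on [{0, ..., n}] and [Q phi = 0]
    beyond ([harmonic_extension]).  For [phi >= 0], the inequality
    [E_i phi (Phi_t) <= phi i + E_i int_0^t Q phi (Phi_s) ds] ([dynkin_le]) is
    proved on a time grid and for the states at most [M], where it only involves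
    finite matrices and the derivative at [0] of the transition function;
    non-explosion lets [M] tend to infinity.  Integrated against [pi], it gives
    [pi A >= 0], and [pi A = 0] follows because the row sums of [A] are at most
    [0].  Applied at a maximum of [psi] with [A psi = 0], it shows that [psi] is
    constant.  A generator with one-dimensional kernel has one invariant
    vector. *)


(** * Paths and their return times *)

Section min_lemmas.
Context {R : realType}.

Lemma ereal_inf_min (S : set R) c :
  S c -> (forall t, S t -> c <= t) ->
  ereal_inf [set t%:E | t in S] = c%:E.
Proof.
move=> Sc cS; apply/eqP; rewrite eq_le; apply/andP; split.
  by apply: ereal_inf_lbound; exists c.
by apply: le_ereal_inf_tmp => _ [t St <-]; rewrite lee_fin; exact: cS.
Qed.

(** The last hypothesis is closedness from the right, which is what sets of
    visits of right-continuous paths satisfy. *)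
Lemma min_exists (S : set R) : S !=set0 -> (forall t, S t -> 0 <= t) ->
  (forall c, 0 <= c ->
    (forall e, 0 < e -> exists t, [/\ S t, c <= t & t < c + e]) -> S c) ->
  exists2 c, S c & forall t, S t -> c <= t.
Proof.
move=> S0 Sge0 Scl.
have hlb : has_lbound S by exists 0.
have infS t : S t -> inf S <= t by move=> St; exact: ge_inf.
exists (inf S) => //; apply: Scl.
  by apply: lb_le_inf.
move=> e e0; have [t St tlt] := inf_adherent e0 (conj S0 hlb).
by exists t; split => //; exact: infS.
Qed.

End min_lemmas.

Section paths.
Context {R : realType}.
Implicit Types (X : R -> nat) (t s c : R).

(** Right-continuity for the discrete topology of the state space. *)
Definition right_constant X := forall t, 0 <= t ->
  exists2 e, 0 < e & forall s, t <= s -> s < t + e -> X s = X t.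

(** The visits to [j] that follow a visit to another state in [A].  With [A] the
    whole state space these are the times at or after a return to [j]; with [A]
    the states at most [n] they play the same part for the censored path. *)
Definition returns (A : pred nat) X j := [set t | [/\ 0 <= t, X t = j &
  exists s, [/\ 0 <= s, s <= t, A (X s) & X s <> j]]].

Lemma returns_min A X j : right_constant X -> returns A X j !=set0 ->
  exists2 c, returns A X j c & forall t, returns A X j t -> c <= t.
Proof.
move=> hX ne; apply: min_exists => // [t []//|c c0 hc].
have [e e0 he] := hX _ c0.
have [t [[t0 Xt [s [s0 st As Xs]]] ct tce]] := hc _ e0.
have Xc : X c = j by rewrite -(he t).
split=> //; exists s; split=> //; rewrite leNgt; apply/negP => cs.
by apply: Xs; rewrite he ?(ltW cs)// (le_lt_trans st).
Qed.

Lemma jump_time1_ge0 X : (0 <= jump_time X 1)%E.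
Proof.
by apply: le_ereal_inf_tmp => _ [t /= [t0 _] <-]; rewrite lee_fin.
Qed.

(** A visit to [j] occurs after the first jump exactly when another state has been
    visited: if the path were in [j] up to time [t], it would stay there a little
    longer by right-continuity, and the first jump would come after [t].  This
    form does not mention the initial state. *)
Lemma return_timeE X j : right_constant X ->
  return_time X j = ereal_inf [set t%:E | t in returns predT X j].
Proof.
move=> hX; congr (ereal_inf [set _ | _ in _]); apply/seteqP; split=> t /=.
  move=> [Jt Xt].
  have t0 : 0 <= t by rewrite -lee_fin (le_trans (jump_time1_ge0 X)).
  split=> //; apply: contrapT => hs.
  have hj s : 0 <= s -> s <= t -> X s = j.
    by move=> s0 st; apply: contrapT => Xs; apply: hs; exists s.
  have [e e0 he] := hX _ t0.
  have : (((t + e)%:E : \bar R) <= jump_time X 1)%E.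
    apply: le_ereal_inf_tmp => _ [u /= [u0 Xu] <-]; rewrite lee_fin leNgt.
    apply/negP => ute; apply: Xu; rewrite (hj 0)//.
    by case: (leP t u) => tu; [rewrite he|rewrite hj// ltW].
  move=> /le_trans /(_ Jt); rewrite lee_fin; lra.
move=> [t0 Xt [s [s0 st _ Xs]]]; split=> //.
have [X0j|X0j] := eqVneq (X 0) j.
  apply: (@le_trans _ _ s%:E); last by rewrite lee_fin.
  by apply: ereal_inf_lbound; exists s => //=; rewrite X0j.
apply: ereal_inf_lbound; exists t => //=; split => //.
by rewrite Xt => /esym/eqP; rewrite (negPf X0j).
Qed.

End paths.

(** * Joint measurability *)
Section joint.
Context {R : realType} d (T : measurableType d) (Phi : R -> T -> nat).
Hypothesis mPhi : forall (t : R) k, 0 <= t -> measurable [set w | Phi t w = k].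
Hypothesis rcPhi : forall w, right_constant (fun t => Phi t w).

(** By right-continuity, the state at time [t] is the eventual value of the states
    at the grid points [(r + 1) / (m + 1)] that follow [t] immediately; on each
    cell of the grid these do not depend on [t]. *)
Lemma joint_measurable k :
  measurable [set z : T * measurableTypeR R | 0 <= z.2 /\ Phi z.2 z.1 = k].
Proof.
pose a (m r : nat) : R := r%:R / m.+1%:R.
have -> : [set z : T * measurableTypeR R | 0 <= z.2 /\ Phi z.2 z.1 = k] =
    \bigcup_M \bigcap_(m in [set m | (M <= m)%N]) \bigcup_r
      ([set w | Phi (a m r.+1) w = k] `*`
       (`[a m r, a m r.+1[%classic : set (measurableTypeR R))).
  have key (t : R) (m : nat) : 0 <= t -> exists2 r, a m r <= t < a m r.+1 &
      a m r.+1 <= t + m.+1%:R^-1.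
    move=> t0; exists (Num.truncn (t * m.+1%:R)).
      rewrite /a ler_pdivrMr ?ltr0n// ltr_pdivlMr ?ltr0n//.
      by rewrite truncn_itv// mulr_ge0.
    rewrite /a ler_pdivrMr ?ltr0n// mulrDl mulVf ?pnatr_eq0//.
    by rewrite -natr1 lerD2r truncn_le// mulr_ge0.
  have small (e : R) : 0 < e -> \forall m \near \oo, m.+1%:R^-1 < e.
    by move=> e0; exact: near_infty_natSinv_lt (PosNum e0).
  have loc w (t : R) : 0 <= t -> exists M, forall m, (M <= m)%N ->
      forall s, t < s -> s <= t + m.+1%:R^-1 -> Phi s w = Phi t w.
    move=> t0; have [e e0 he] := rcPhi w t0.
    have [M _ hM] := small _ e0; exists M => m Mm s ts sm.
    by apply: he; [exact: ltW|rewrite (le_lt_trans sm)// ltrD2l; exact: hM].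
  apply/seteqP; split=> [[w t]/= [t0 Pt]|[w t]/= [M _ hM]].
    have [M hM] := loc w t t0; exists M => // m /= Mm.
    have [r /andP[r1 r2] r3] := key t m t0.
    by exists r => //=; split; [rewrite (hM m)|rewrite in_itv/= r1].
  have [r _ /= [_]] := hM M (leqnn _); rewrite in_itv/= => /andP[rt _].
  have t0 : 0 <= t by rewrite (le_trans _ rt)// divr_ge0.
  split=> //; have [M' hM'] := loc w t t0.
  have [r' _ /= [<-]] := hM (maxn M M') (leq_maxl _ _).
  rewrite in_itv/= => /andP[rt' rt2]; apply/esym; apply: (hM' (maxn M M')) => //.
    exact: leq_maxr.
  rewrite /a -natr1 mulrDl mul1r; exact: lerD.
apply: bigcup_measurable => M _; apply: bigcap_measurable => [|m _].
  by exists M => /=.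
apply: bigcup_measurable => r _; apply: measurableX => //.
by apply: mPhi; rewrite divr_ge0.
Qed.

End joint.

Section path_measurable.
Context {R : realType}.
Implicit Types (X : R -> nat) (t s c : R).

Lemma path_measurable X (A : pred nat) : right_constant X ->
  measurable [set s : measurableTypeR R | 0 <= s /\ A (X s)].
Proof.
move=> hX; have -> : [set s : measurableTypeR R | 0 <= s /\ A (X s)] =
    \bigcup_(k in [set k | A k]) [set s : measurableTypeR R | 0 <= s /\ X s = k].
  apply/seteqP; split=> [s /= [s0 As]|s [k /= Ak [s0 Xs]]].
    by exists (X s).
  by rewrite Xs.
apply: bigcup_measurable => k _.
(* a single path is a process on a one-point space *)
have mX t l : 0 <= t -> measurable [set w : unit | X t = l] by [].
have := measurable_xsection tt (joint_measurable mX (fun=> hX) k).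
congr measurable; apply/seteqP; split=> s; rewrite /xsection/= inE//.
Qed.

End path_measurable.

(** * The local clock *)

Section clock.
Context {R : realType}.
Implicit Types (X : R -> nat) (t s c : R).
Local Notation mu := (@lebesgue_measure R).

Definition clock n X t : R := fine (local_clock n X t).

Lemma measurable_below X n : right_constant X ->
  measurable [set s : measurableTypeR R | 0 <= s /\ (X s <= n)%N].
Proof. exact: (@path_measurable R X (fun k => (k <= n)%N)). Qed.

Lemma measurable_below_oc X n a b : right_constant X -> 0 <= a ->
  measurable [set u : measurableTypeR R | a < u <= b /\ (X u <= n)%N].
Proof.
move=> hX a0; have -> : [set u : measurableTypeR R | a < u <= b /\ (X u <= n)%N] =
    `]a, b]%classic `&` [set s : measurableTypeR R | 0 <= s /\ (X s <= n)%N].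
  apply/seteqP; split=> u /=; rewrite in_itv/=.
    by move=> [/andP[au ->] ->]; rewrite au (le_trans a0 (ltW au)).
  by move=> [-> [_ ->]].
exact: measurableI (measurable_below _ hX).
Qed.

Lemma measurable_below_cc X n b : right_constant X ->
  measurable [set u : measurableTypeR R | 0 <= u <= b /\ (X u <= n)%N].
Proof.
move=> hX; have -> : [set u : measurableTypeR R | 0 <= u <= b /\ (X u <= n)%N] =
    `[0, b]%classic `&` [set s : measurableTypeR R | 0 <= s /\ (X s <= n)%N].
  apply/seteqP; split=> u /=; rewrite in_itv/=.
    by move=> [/andP[-> ->] ->].
  by move=> [-> [_ ->]].
exact: measurableI (measurable_below _ hX).
Qed.

Lemma local_clock_fin X n t : right_constant X -> 0 <= t ->
  local_clock n X t = (clock n X t)%:E.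
Proof.
move=> hX t0; rewrite /clock fineK//; apply/fin_numPlt/andP; split.
  by rewrite (lt_le_trans ltNy0)//; exact: measure_ge0.
apply: (@le_lt_trans _ _ (mu `[0, t]%classic)); last first.
  by rewrite lebesgue_measure_itv/=; case: ifP; rewrite ?ltry.
apply: le_measure; rewrite ?inE//; first exact: measurable_below_cc.
by move=> s /= [st _]; rewrite in_itv.
Qed.

Lemma clock0 X n : right_constant X -> clock n X 0 = 0.
Proof.
move=> hX; rewrite /clock /local_clock.
suff -> : mu [set s : R | 0 <= s <= 0 /\ (X s <= n)%N] = 0%E by [].
apply/eqP; rewrite eq_le measure_ge0 andbT.
apply: (@le_trans _ _ (mu [set 0])); last by rewrite lebesgue_measure_set1.
apply: le_measure; rewrite ?inE//; first exact: measurable_below_cc.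
move=> s /= [/andP[s0 s1] _].
by apply/eqP; rewrite eq_le s0 s1.
Qed.

Lemma clock_increment X n s t : right_constant X -> 0 <= s -> s <= t ->
  mu [set u | s < u <= t /\ (X u <= n)%N] = (clock n X t - clock n X s)%:E.
Proof.
move=> hX s0 st; have t0 := le_trans s0 st.
suff : (clock n X t)%:E =
    ((clock n X s)%:E + mu [set u | s < u <= t /\ (X u <= n)%N]%R)%E.
  case: (mu _) => //= r [->]; congr EFin; lra.
rewrite -!local_clock_fin// /local_clock.
rewrite -measureU//; [|exact: measurable_below_cc|exact: measurable_below_oc|].
  congr (mu _); apply/seteqP; split=> u /=.
    move=> [/andP[u0 ut] Xu]; case: (leP u s) => us; [left|right];
      by rewrite ?u0 ?us ?ut.
  move=> [[/andP[u0 us] Xu]|[/andP[su ut] Xu]]; split => //.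
    by rewrite u0 (le_trans us).
  by rewrite (le_trans s0 (ltW su)) ut.
rewrite -subset0 => u /= [[/andP[_ us] _] [/andP[su _] _]].
by have := le_lt_trans us su; rewrite ltxx.
Qed.

Lemma clock_le X n s t : right_constant X -> 0 <= s -> s <= t ->
  clock n X s <= clock n X t.
Proof.
by move=> hX s0 st; rewrite -subr_ge0 -lee_fin -clock_increment//; exact: measure_ge0.
Qed.

Lemma clock_ge0 X n t : right_constant X -> 0 <= t -> 0 <= clock n X t.
Proof. by move=> hX t0; rewrite -(clock0 n hX); exact: clock_le. Qed.

Lemma clock_lipschitz X n s t : right_constant X -> 0 <= s -> s <= t ->
  clock n X t - clock n X s <= t - s.
Proof.
move=> hX s0 st; rewrite -lee_fin -clock_increment//.
apply: (@le_trans _ _ (mu `]s, t]%classic)).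
  apply: le_measure; rewrite ?inE//; first exact: measurable_below_oc.
  by move=> u /= []; rewrite in_itv.
by rewrite lebesgue_measure_itv/= lte_fin; case: ltgtP st => // -> _; rewrite subrr.
Qed.

Lemma clock_in X n s t : right_constant X -> 0 <= s -> s <= t ->
  (forall u, s <= u -> u < t -> (X u <= n)%N) ->
  clock n X t - clock n X s = t - s.
Proof.
move=> hX s0 st hn; apply/eqP; rewrite eq_le clock_lipschitz//=.
rewrite -lee_fin -clock_increment//.
apply: (@le_trans _ _ (mu `]s, t[%classic)).
  by rewrite lebesgue_measure_itv/= lte_fin; case: ltgtP st => // -> _; rewrite subrr.
apply: le_measure; rewrite ?inE//; first exact: measurable_below_oc.
move=> u /=; rewrite in_itv/= => /andP[su ut].
by rewrite su (ltW ut) hn// ltW.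
Qed.

Lemma clock_out X n s t : right_constant X -> 0 <= s -> s <= t ->
  (forall u, s <= u -> u < t -> (n < X u)%N) ->
  clock n X t = clock n X s.
Proof.
move=> hX s0 st hn; apply/eqP; rewrite eq_le (clock_le n hX s0 st) andbT -subr_le0.
rewrite -lee_fin -clock_increment//.
apply: (@le_trans _ _ (mu [set t])); last by rewrite lebesgue_measure_set1.
apply: le_measure; rewrite ?inE//; first exact: measurable_below_oc.
move=> u /= [/andP[su ut] Xu].
apply/eqP; rewrite eq_le ut/= leNgt; apply/negP => utt.
by move: Xu; rewrite leqNgt hn// ltW.
Qed.

(** The clock advances as soon as the path is in [{0, ..., n}], since it stays
    there for a while. *)
Lemma clock_lt X n s t : right_constant X -> 0 <= s -> s < t -> (X s <= n)%N ->
  clock n X s < clock n X t.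
Proof.
move=> hX s0 st Xs; have [e e0 he] := hX _ s0.
pose v := Num.min (s + e) t.
have sv : s < v by rewrite lt_min st ltrDl e0.
rewrite (@lt_le_trans _ _ (clock n X v))//; last first.
  by apply: clock_le => //; [exact/ltW/(le_lt_trans s0)|rewrite ge_min lexx orbT].
rewrite -subr_gt0 clock_in// ?subr_gt0 ?ltW// => u su; rewrite lt_min => /andP[us _].
by rewrite he.
Qed.

(** Together with [global_time_spec], this characterizes the global time attached
    to [t] as the only time in [{0, ..., n}] at which the clock shows [t]. *)
Lemma global_timeE X n c : right_constant X -> 0 <= c -> (X c <= n)%N ->
  global_time n X (clock n X c) = c%:E.
Proof.
move=> hX c0 Xc; apply/eqP; rewrite eq_le; apply/andP; split.
  apply/lee_addgt0Pr => e e0; apply: ereal_inf_lbound; exists (c + e) => //=.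
  have ce0 : 0 <= c + e by rewrite addr_ge0// ltW.
  by split=> //; rewrite local_clock_fin// lte_fin clock_lt// ltrDl.
apply: le_ereal_inf_tmp => _ [s /= [s0 + <-]].
rewrite local_clock_fin// lte_fin lee_fin; apply: contraTT.
by rewrite -!leNgt; rewrite -ltNge => /ltW sc; exact: clock_le.
Qed.

(** The infimum [c] of the times at which the clock has passed [t] satisfies
    [clock c = t] because the clock is Lipschitz, and the path is in [{0, ..., n}]
    at [c] because the clock would otherwise stand still after [c]. *)
Lemma global_time_spec X n t s : right_constant X -> 0 <= t -> 0 <= s ->
  t < clock n X s ->
  exists c, [/\ 0 <= c, c <= s, clock n X c = t, (X c <= n)%N &
    global_time n X t = c%:E].
Proof.
move=> hX t0 s0 ts; pose S := [set u : R | 0 <= u /\ t < clock n X u].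
have Sne : S !=set0 by exists s.
have Slb : has_lbound S by exists 0 => u [].
have infS u : S u -> inf S <= u by move=> Su; exact: ge_inf.
have c0 : 0 <= inf S by apply: lb_le_inf => // u [].
set c := inf S in infS c0.
have above u : c < u -> t < clock n X u.
  move=> cu; have [|v [v0 tv] vu] := @inf_adherent _ S (u - c) _ (conj Sne Slb).
    by rewrite subr_gt0.
  rewrite (lt_le_trans tv)// clock_le//; rewrite ltW//.
  by move: vu; rewrite -/c; lra.
have ct : clock n X c = t.
  apply/eqP; rewrite eq_le; apply/andP; split; rewrite leNgt; apply/negP => h.
    have c_gt0 : 0 < c.
      rewrite lt_neqAle c0 andbT; apply/eqP => c00.
      by move: h; rewrite -c00 clock0//; move: t0; case: ltgtP.
    pose e := Num.min (c / 2) ((clock n X c - t) / 2).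
    have e0 : 0 < e by rewrite lt_min !divr_gt0// subr_gt0.
    have ec : e <= c / 2 by rewrite ge_min lexx.
    have ek : e <= (clock n X c - t) / 2 by rewrite ge_min lexx orbT.
    have ce0 : 0 <= c - e by lra.
    have : c <= c - e.
      apply: infS; split=> //.
      have : clock n X c - clock n X (c - e) <= c - (c - e).
        by apply: clock_lipschitz => //; lra.
      by lra.
    lra.
  pose e := (t - clock n X c) / 2.
  have e0 : 0 < e by rewrite divr_gt0// subr_gt0.
  have := above (c + e); rewrite ltrDl => /(_ e0).
  have : clock n X (c + e) - clock n X c <= c + e - c.
    by apply: clock_lipschitz => //; lra.
  by rewrite /e; lra.
have Xc : (X c <= n)%N.
  rewrite leqNgt; apply/negP => nX; have [e e0 he] := hX _ c0.
  have := above (c + e / 2); rewrite ltrDl divr_gt0// => /(_ isT).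
  rewrite (@clock_out _ n c)//; first by rewrite ct ltxx.
    by rewrite lerDl divr_ge0// ltW.
  by move=> u cu uce; rewrite he//; lra.
exists c; split=> //; first exact: infS.
by rewrite -ct global_timeE.
Qed.

Lemma censored_clock X n c : right_constant X -> 0 <= c -> (X c <= n)%N ->
  censored n X (clock n X c) = X c.
Proof. by move=> hX c0 Xc; rewrite /censored global_timeE. Qed.

Lemma censored_right_constant X n : right_constant X ->
  right_constant (censored n X).
Proof.
move=> hX t t0.
have [[s [s0 ts]]|hs] := pselect (exists s, 0 <= s /\ t < clock n X s).
  have [c [c0 cs ct Xc gt]] := global_time_spec hX t0 s0 ts.
  have [e e0 he] := hX _ c0.
  have ce2 : c < c + e / 2 by rewrite ltrDl divr_gt0.
  have h := clock_lt hX c0 ce2 Xc.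
  exists (clock n X (c + e / 2) - t); first by rewrite subr_gt0 -ct.
  move=> u tu; rewrite addrC subrK => hu.
  have [||c' [c'0 c's ct' Xc' gt']] := global_time_spec hX _ _ hu.
  - exact: le_trans tu.
  - exact/ltW/(le_lt_trans c0).
  rewrite /censored gt gt'/= he//.
    rewrite leNgt; apply/negP => cc'.
    by have := clock_lt hX c'0 cc' Xc'; rewrite ct ct'; move: tu; case: ltgtP.
  by rewrite (le_lt_trans c's)// ltrD2l; lra.
(* past the total local time, [global_time] is infinite and the censored path
   is frozen in the state [X 0] *)
have inf u : t <= u -> global_time n X u = +oo%E.
  move=> tu; rewrite /global_time (_ : [set _ | _ in _] = set0) ?ereal_inf0//.
  rewrite -subset0 => _ [s /= [s0 us] _]; apply: hs; exists s; split => //.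
  by rewrite (le_lt_trans tu)// -lte_fin -local_clock_fin.
by exists 1 => // s ts _; rewrite /censored !inf.
Qed.

(** The censored path is in [j] at the local time [clock rho], and in another
    state at an earlier local time.  Conversely the global time of a local time
    before [clock rho] precedes [rho], so that a return of the censored path
    before [clock rho] would be a return of the path before [rho]. *)
Lemma return_time_censored X n j rho : right_constant X -> (j <= n)%N ->
  returns (fun k => k <= n)%N X j rho ->
  (forall t, returns (fun k => k <= n)%N X j t -> rho <= t) ->
  return_time (censored n X) j = (clock n X rho)%:E.
Proof.
move=> hX jn [rho0 Xrho [s [s0 srho sn Xs]]] rho_min.
rewrite return_timeE; last exact: censored_right_constant.
apply: ereal_inf_min.
  split.
  - exact: clock_ge0.
  - by rewrite censored_clock ?Xrho.
  - exists (clock n X s); split=> //.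
    + exact: clock_ge0.
    + exact: clock_le.
    + by rewrite censored_clock.
move=> t [t0 Yt [u [u0 ut _ Yu]]]; rewrite leNgt; apply/negP => trho.
have [c [c0 crho ct Xc gc]] := global_time_spec hX t0 rho0 trho.
have [v [v0 vrho vu Xv gv]] := global_time_spec hX u0 rho0 (le_lt_trans ut trho).
have vc : v <= c.
  rewrite leNgt; apply/negP => cv.
  by have := clock_lt hX c0 cv Xc; rewrite ct vu; move: ut; case: ltgtP.
have : rho <= c.
  apply: rho_min; split=> //; first by move: Yt; rewrite /censored gc.
  by exists v; split=> //; move: Yu; rewrite /censored gv.
move=> /(clock_le n hX rho0); rewrite ct; by move: trho; case: ltgtP.
Qed.

End clock.

(** * Integration in local time *)

Section integral_mrestr.
Local Open Scope ereal_scope.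
Context d (T : measurableType d) (R : realType).
Variable mu : {measure set T -> \bar R}.

Lemma ge0_integral_mrestr (S E : set T) (mS : measurable S) (f : T -> \bar R) :
  measurable E -> measurable_fun E f -> (forall x, E x -> 0 <= f x) ->
  \int[mrestr mu mS]_(x in E) f x = \int[mu]_(x in E `&` S) f x.
Proof.
move=> mE mf f0; have mES := measurableI _ _ mE mS.
have mED := measurableD mE mS.
rewrite -[in LHS](setUIDK E S) ge0_integral_setU//; first last.
- apply/disj_setPS => x [[_ Sx] [_ nSx]]; exact: nSx.
- by move=> x; rewrite setUIDK; exact: f0.
- by rewrite setUIDK.
rewrite (@eq_measure_integral _ _ _ _ mu); last first.
  by move=> A mA AES; rewrite /= /mrestr; congr (mu _); apply: setIidl => x /AES[].
rewrite [X in _ + X]null_set_integral ?adde0//.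
- by apply: (measurable_funS mE _ mf) => x [].
- by rewrite /= /mrestr classical_sets.setDE -classical_sets.setIA setICl classical_sets.setI0 measure0.
Qed.

End integral_mrestr.

Section time_change.
Context {R : realType}.
Implicit Types (X : R -> nat) (t s c : R).
Local Notation mu := (@lebesgue_measure R).

(** Negative times are added so that the clock, extended by the identity, maps
    [below] onto the whole line and uniqueness of Lebesgue measure applies. *)
Let below X n := [set s : measurableTypeR R | s < 0 \/ 0 <= s /\ (X s <= n)%N].

Let measurable_belowN X n : right_constant X -> measurable (below X n).
Proof.
move=> hX; have -> : below X n = `]-oo, 0[%classic `|`
    [set s : measurableTypeR R | 0 <= s /\ (X s <= n)%N].
  by apply/seteqP; split=> s /=; rewrite in_itv.
exact: measurableU (measurable_below _ hX).
Qed.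

Let kap X n s : R := if s < 0 then s else clock n X s.

Let kap_le X n : right_constant X -> {homo kap X n : s t / s <= t}.
Proof.
move=> hX s t st; rewrite /kap; case: (ltP s 0) => s0; case: (ltP t 0) => // t0.
- by rewrite (le_trans (ltW s0))// clock_ge0.
- by have := lt_le_trans t0 s0; rewrite ltNge st.
- exact: clock_le.
Qed.

Let kap_lt X n s t : right_constant X -> below X n s -> s < t ->
  kap X n s < kap X n t.
Proof.
move=> hX [s0|[s0 Xs]] st; rewrite /kap.
  by rewrite s0; case: (ltP t 0) => // t0; rewrite (lt_le_trans s0)// clock_ge0.
by rewrite (ltNge s) s0 (ltNge t) (le_trans s0 (ltW st))/=; exact: clock_lt.
Qed.

Let kap_surj X n : right_constant X ->
  (forall t, exists2 s, 0 <= s & t < clock n X s) ->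
  forall t, exists2 v, below X n v & kap X n v = t.
Proof.
move=> hX hunb t; have [t0|t0] := ltP t 0; first by exists t; [left|rewrite /kap t0].
have [s s0 ts] := hunb t.
have [c [c0 cs ct Xc gt]] := global_time_spec hX t0 s0 ts.
by exists c; [right|rewrite /kap (ltNge c) c0].
Qed.

Let measurable_kap X n : right_constant X ->
  measurable_fun setT (kap X n : measurableTypeR R -> measurableTypeR R).
Proof.
move=> hX; apply: nondecreasing_measurable => // s t st.
exact: kap_le.
Qed.

(** An interval of local time [a, b] corresponds to the times in [{0, ..., n}]
    between the global times of [a] and [b], and the clock increment [b - a] is
    the measure of these times. *)
Let clock_preserves X n : right_constant X ->
  (forall t, exists2 s, 0 <= s & t < clock n X s) ->
  forall A, measurable A -> mu A = mu (kap X n @^-1` A `&` below X n).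
Proof.
move=> hX hunb; have mS := measurable_belowN n hX.
have mk := measurable_kap n hX.
suff : forall Y, ocitv Y -> mu Y = (pushforward (mrestr mu mS)
    (kap X n : measurableTypeR R -> measurableTypeR R)) Y.
  by move=> /lebesgue_measure_unique h A mA; rewrite h.
move=> _ [[a b] _ <-]; rewrite /pushforward /mrestr /=.
have [ba|ab] := leP b a.
  have -> : `]a, b]%classic = set0 :> set R.
    rewrite -subset0 => x /=; rewrite in_itv/= => /andP[ax xb].
    by have := lt_le_trans ax (le_trans xb ba); rewrite ltxx.
  by rewrite preimage_set0 set0I !measure0.
have [va Sva ka] := kap_surj hX hunb a.
have [vb Svb kb] := kap_surj hX hunb b.
have kle v s : below X n v -> below X n s -> (kap X n s <= kap X n v) = (s <= v).
  move=> Sv Ss; apply/idP/idP; last exact: kap_le.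
  by apply: contraTT; rewrite -!ltNge; exact: kap_lt.
have -> : kap X n @^-1` `]a, b]%classic `&` below X n =
    [set s | va < s <= vb] `&` below X n.
  apply/seteqP; split=> s /= [+ Ss]; rewrite in_itv/= -{1}ka -{1}kb;
    by rewrite [kap _ _ _ < _]ltNge !kle// -ltNge => ->.
have vab : va < vb by rewrite ltNge -kle// -ltNge ka kb.
rewrite lebesgue_measure_itv/= lte_fin ab -EFinD.
move: ka kb; rewrite /kap; have [vb0|vb0] := ltP vb 0.
  rewrite (lt_trans vab vb0) => <- <-.
  have -> : [set s | va < s <= vb] `&` below X n = `]va, vb]%classic.
    apply/seteqP; split=> s /=; rewrite in_itv/=; first by case.
    by move=> vs; split=> //; left; case/andP: vs => _ /le_lt_trans; exact.
  by rewrite lebesgue_measure_itv/= lte_fin vab.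
have [va0|va0] := ltP va 0 => <- <-; last first.
  rewrite -clock_increment//; last exact: ltW.
  congr (mu _); apply/seteqP; split=> s /= [/andP[as_ sb]].
    by rewrite as_ sb => Xs; split => //; right; rewrite (le_trans va0 (ltW as_)).
  rewrite as_ sb => -[s0|[_ ->]]//.
  by have := lt_trans s0 (le_lt_trans va0 as_); rewrite ltxx.
have -> : [set s | va < s <= vb] `&` below X n =
    (`]va, 0[%classic : set (measurableTypeR R)) `|` [set s | 0 <= s <= vb /\ (X s <= n)%N].
  apply/seteqP; split=> s /=; rewrite in_itv/=.
    by move=> [/andP[-> sb] [s0|[-> Xs]]]; [left|right; rewrite sb].
  move=> [/andP[as_ s0]|[/andP[s0 sb] Xs]]; split.
  - by rewrite as_ (le_trans (ltW s0)).
  - by left.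
  - by rewrite (lt_le_trans va0).
  - by right.
rewrite measureU//; first last.
- rewrite -subset0 => s /=; rewrite in_itv/= => -[/andP[_ s0] [/andP[s0' _] _]].
  by have := lt_le_trans s0 s0'; rewrite ltxx.
- exact: measurable_below_cc.
rewrite [X in (X + _)%E]lebesgue_measure_itv/= lte_fin va0.
have := local_clock_fin n hX vb0; rewrite /local_clock => ->.
by rewrite -!EFinD; congr EFin; lra.
Qed.

Let time_change_unbounded X n c (f : R -> \bar R) : right_constant X -> 0 <= c ->
  (forall t, exists2 s, 0 <= s & t < clock n X s) ->
  measurable_fun setT (f : measurableTypeR R -> \bar R) -> (forall t, (0 <= f t)%E) ->
  (\int[mu]_(t in [set t | 0 <= t < clock n X c]%R) f t =
   \int[mu]_(s in [set s | 0 <= s < c /\ (X s <= n)%N]%R) f (clock n X s))%E.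
Proof.
move=> hX c0 hunb mf f0; have mS := measurable_belowN n hX.
have mk := measurable_kap n hX.
have -> : [set t | 0 <= t < clock n X c] = `[0, clock n X c[%classic.
  by apply/seteqP; split=> s /=; rewrite in_itv.
rewrite (@eq_measure_integral _ _ _ _ (pushforward (mrestr mu mS)
    (kap X n : measurableTypeR R -> measurableTypeR R))); last first.
  by move=> A mA _; exact: clock_preserves.
rewrite ge0_integral_pushforward//; last exact: (measurable_funS measurableT (@subsetT _ _) mf).
rewrite ge0_integral_mrestr//; first last.
- by move=> x _; exact: f0.
- apply: (measurable_funS measurableT (@subsetT _ _)); exact: (measurableT_comp mf).
- by rewrite -[_ @^-1` _]setTI; exact: mk.
have -> : kap X n @^-1` `[0, clock n X c[%classic `&` below X n =
   [set s | 0 <= s < c /\ (X s <= n)%N].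
  apply/seteqP; split=> s /=; rewrite in_itv/= /kap.
    move=> [+ [s0|[s0 Xs]]]; first by rewrite s0 leNgt s0.
    rewrite (ltNge s) s0/= => /andP[_ sc]; split=> //; rewrite ltNge.
    by apply: contraTN sc => cs; rewrite -leNgt; exact: clock_le.
  move=> [/andP[s0 sc] Xs]; rewrite (ltNge s) s0/= clock_ge0//= clock_lt//.
  by split=> //; right.
apply: eq_integral => s; rewrite inE /= /kap => -[/andP[s0 _] _].
by rewrite ltNge s0.
Qed.

(** Substitution of the local clock.  An unbounded clock is needed to transport
    the whole Lebesgue measure; modifying the path after [c] changes neither
    side, so a path staying below [n] from some later time on can be used. *)
Lemma time_change X n c (f : R -> \bar R) : right_constant X -> 0 <= c ->
  measurable_fun setT (f : measurableTypeR R -> \bar R) -> (forall t, (0 <= f t)%E) ->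
  (\int[mu]_(t in [set t | 0 <= t < clock n X c]%R) f t =
   \int[mu]_(s in [set s | 0 <= s < c /\ (X s <= n)%N]%R) f (clock n X s))%E.
Proof.
move=> hX c0 mf f0.
(* entering state 0 at time c + 1 makes the clock unbounded *)
pose X' s := if s < c + 1 then X s else 0%N.
have X'E s : s < c + 1 -> X' s = X s by rewrite /X' => ->.
have hX' : right_constant X'.
  move=> t t0; have [tc|ct] := ltP t (c + 1); last first.
    exists 1 => // s ts _; rewrite /X' !ltNge ct (le_trans ct ts)//.
  have [e e0 he] := hX _ t0; exists (Num.min e (c + 1 - t)).
    by rewrite lt_min e0 subr_gt0.
  move=> s ts; rewrite -ltrBlDl lt_min => /andP[se sc].
  rewrite !X'E// ?he//; lra.
have clockE s : s <= c -> clock n X' s = clock n X s.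
  move=> sc; congr (fine (mu _)); apply/seteqP; split=> u /= [/andP[u0 us]];
    rewrite X'E ?u0 ?us//; lra.
have hunb t : exists2 s, 0 <= s & t < clock n X' s.
  have c10 : 0 <= c + 1 by lra.
  have h := clock_ge0 n hX' c10.
  exists (c + 1 + `|t| + 1); first by rewrite !addr_ge0.
  have := @clock_in _ X' n (c + 1) (c + 1 + `|t| + 1) hX' c10.
  have t0 := normr_ge0 t; have tt := ler_norm t.
  have -> : c + 1 <= c + 1 + `|t| + 1 by lra.
  move=> /(_ isT) h2; have := h2; rewrite /X'; move: h2 => _ h2.
  suff : clock n X' (c + 1 + `|t| + 1) - clock n X' (c + 1) = `|t| + 1 by lra.
  rewrite h2; first by lra.
  by move=> u cu _; rewrite ltNge cu.
have := time_change_unbounded hX' c0 hunb mf f0.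
rewrite clockE// => ->.
have -> : [set s | 0 <= s < c /\ (X' s <= n)%N] = [set s | 0 <= s < c /\ (X s <= n)%N].
  by apply/seteqP; split=> u /= [/andP[u0 us]]; rewrite X'E ?u0 ?us//; lra.
apply: eq_integral => s; rewrite inE/= => -[/andP[s0 sc] _].
by rewrite clockE// ltW.
Qed.

End time_change.

Section path_integrals.
Context {R : realType}.
Implicit Types (X : R -> nat) (t s c : R).
Local Notation mu := (@lebesgue_measure R).

Lemma measurable_nneg_times :
  measurable ([set t | 0 <= t] : set (measurableTypeR R)).
Proof.
rewrite (_ : [set t | 0 <= t] = `[0, +oo[%classic)//.
by apply/seteqP; split=> t /=; rewrite in_itv/= andbT.
Qed.

Lemma measurable_fun_path X (k : nat -> \bar R) : right_constant X ->
  measurable_fun ([set t | 0 <= t] : set (measurableTypeR R)) (k \o X).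
Proof.
move=> hX _ B mB; rewrite (_ : _ `&` _ =
    [set s : measurableTypeR R | 0 <= s /\ [pred m | `[< B (k m) >]] (X s)]).
  exact: path_measurable.
by apply/seteqP; split=> t /= [t0 /asboolP].
Qed.

Lemma measurable_below_co X n c : right_constant X ->
  measurable [set s : measurableTypeR R | 0 <= s < c /\ (X s <= n)%N].
Proof.
move=> hX; rewrite (_ : [set s : measurableTypeR R | _] = `]-oo, c[%classic `&`
    [set s : measurableTypeR R | 0 <= s /\ (X s <= n)%N]).
  exact: measurableI (measurable_below _ hX).
apply/seteqP; split=> s /=; rewrite in_itv/=.
  by move=> [/andP[-> ->] ->].
by move=> [-> [-> ->]].
Qed.

Let time_change_nneg X n c (k : nat -> \bar R) : right_constant X -> 0 <= c ->
  (forall m, (0 <= k m)%E) ->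
  (\int[mu]_(t in [set t | 0 <= t < clock n X c]%R) k (censored n X t) =
   \int[mu]_(s in [set s | 0 <= s < c /\ (X s <= n)%N]%R) k (X s))%E.
Proof.
move=> hX c0 k0; have hY := censored_right_constant n hX.
pose D := [set t : R | 0 <= t].
pose f := (k \o censored n X) \_ D.
have fE t : 0 <= t -> f t = k (censored n X t).
  by move=> t0; rewrite /f patchE mem_set.
have mf : measurable_fun setT (f : measurableTypeR R -> \bar R).
  have [h _] := measurable_restrictT (k \o censored n X) measurable_nneg_times.
  exact: h (measurable_fun_path k hY).
transitivity (\int[mu]_(t in [set t | 0 <= t < clock n X c]%R) f t)%E.
  by apply: eq_integral => t; rewrite inE/= => /andP[t0 _]; rewrite fE.
rewrite time_change//; last first.
  by move=> t; rewrite /f patchE; case: ifP => // _; exact: k0.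
apply: eq_integral => s; rewrite inE/= => -[/andP[s0 sc] Xs].
by rewrite fE ?clock_ge0// censored_clock.
Qed.

Lemma return_integralE X j rho (h : nat -> R) : right_constant X ->
  returns predT X j rho -> (forall t, returns predT X j t -> rho <= t) ->
  return_integral h X j =
  (\int[mu]_(s in [set s | 0 <= s < rho]%R) (h (X s))%:E)%E.
Proof.
move=> hX Rrho rho_min; rewrite /return_integral return_timeE//.
rewrite (ereal_inf_min Rrho)//; congr (integral _ _ _).
  by apply/seteqP; split=> s /=; rewrite ?lte_fin => /andP.
Qed.

(** The integral of the censored path over the local times before
    [clock rho], in global time.  Functions of any sign are treated through their
    positive and negative parts, whether or not they are integrable. *)
Lemma return_integral_censored X n j rho (h : nat -> R) :
  right_constant X -> (j <= n)%N ->
  returns (fun k => k <= n)%N X j rho ->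
  (forall t, returns (fun k => k <= n)%N X j t -> rho <= t) ->
  return_integral h (censored n X) j =
  (\int[mu]_(s in [set s | 0 <= s < rho /\ (X s <= n)%N]%R) (h (X s))%:E)%E.
Proof.
move=> hX jn Rrho rho_min; rewrite /return_integral (return_time_censored hX jn Rrho)//.
transitivity (\int[mu]_(t in [set t | 0 <= t < clock n X rho]%R)
    (h (censored n X t))%:E)%E.
  congr (integral _ _ _).
  by apply/seteqP; split=> s /=; rewrite ?lte_fin => /andP.
have rho0 : 0 <= rho by case: Rrho.
pose kp := ((EFin \o h)^\+)%E; pose kn := ((EFin \o h)^\-)%E.
have kpE (Z : R -> nat) : ((fun t => (h (Z t))%:E)^\+ = kp \o Z)%E.
  by apply/funext => t; rewrite /kp /= !funeposE.
have knE (Z : R -> nat) : ((fun t => (h (Z t))%:E)^\- = kn \o Z)%E.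
  by apply/funext => t; rewrite /kn /= !funenegE.
rewrite integralE [RHS]integralE !kpE !knE; congr (_ - _)%E.
  by apply: time_change_nneg => // m; exact: funepos_ge0.
by apply: time_change_nneg => // m; exact: funeneg_ge0.
Qed.

(** The initial state is itself a visit to a state other than [j]. *)
Lemma returnsT_below X i j n : X 0 = i -> i <> j -> (i <= n)%N ->
  returns (fun k => k <= n)%N X j = returns predT X j.
Proof.
move=> X0 ij ni; apply/seteqP; split=> t [t0 Xt [s [s0 st ? Xs]]]; split=> //.
  by exists s.
by exists 0; rewrite X0.
Qed.

Lemma integral_below_cvg X c (h : nat -> R) : right_constant X ->
  (forall m, 0 <= h m) ->
  (\int[mu]_(s in [set s | 0 <= s < c /\ (X s <= n)%N]%R) (h (X s))%:E)%E
     @[n --> \oo] -->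
  (\int[mu]_(s in [set s | 0 <= s < c]%R) (h (X s))%:E)%E.
Proof.
move=> hX h0; pose D : set (measurableTypeR R) := [set s | 0 <= s < c].
pose f n (s : R) := (if (X s <= n)%N then h (X s) else 0)%:E.
have -> : (fun n => \int[mu]_(s in [set s | 0 <= s < c /\ (X s <= n)%N]%R)
    (h (X s))%:E)%E = (fun n => \int[mu]_(s in D) f n s)%E.
  apply/funext => n.
  have -> : [set s | 0 <= s < c /\ (X s <= n)%N] = D `&` [set s | (X s <= n)%N].
    by [].
  rewrite integral_mkcondr; apply: eq_integral => s _.
  rewrite patchE /f; case: (leqP (X s) n) => Xn.
    by rewrite mem_set.
  by rewrite memNset//=; apply/negP; rewrite -ltnNge.
have mD : measurable D.
  have -> : D = `[0, c[%classic by apply/seteqP; split=> s /=; rewrite in_itv.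
  exact: measurable_itv.
have -> : (\int[mu]_(s in D) (h (X s))%:E)%E = (\int[mu]_(s in D) limn (f ^~ s))%E.
  apply: eq_integral => s _; apply/esym/cvg_lim => //.
  apply: cvg_near_cst; exists (X s) => // n /= Xn; by rewrite /f Xn.
apply: cvg_monotone_convergence => //.
- move=> n; apply: (measurable_funS measurable_nneg_times); last first.
    exact: (@measurable_fun_path X (fun m => (if (m <= n)%N then h m else 0)%:E)).
  by move=> s /= /andP[].
- by move=> n s _; rewrite lee_fin; case: ifP.
- move=> s _ m n mn; rewrite lee_fin; case: (leqP (X s) m) => Xm; last by case: ifP.
  by rewrite (leq_trans Xm mn).
Qed.

End path_integrals.

(** * The Markov property *)

Section nneseries_lemmas.
Local Open Scope ereal_scope.
Context {R : realType}.

Lemma nneseriesZl_ge0 (f : nat -> \bar R) x : 0 <= x -> (forall i, 0 <= f i) ->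
  \sum_(i <oo) x * f i = x * \sum_(i <oo) f i.
Proof.
case: x => [r||//] r0 f0; first by rewrite nneseriesZl.
have [[k fk0]|hk] := pselect (exists k, f k != 0); last first.
  have f00 i : f i = 0 by apply/eqP; apply: contra_notT hk => fi; exists i.
  by rewrite (eseries0 (f := f))// eseries0 ?mule0// => i _ _; rewrite f00 mule0.
have fk : 0 < f k by rewrite lt0e fk0 f0.
rewrite [LHS](@nneseries_pinfty _ _ xpredT k)//; first last.
- by rewrite gt0_mulye.
- by move=> n _; exact: mule_ge0.
rewrite gt0_mulye// (lt_le_trans fk)// (@nneseriesD1 _ _ k xpredT)//.
by rewrite leeDl// nneseries_ge0.
Qed.

Lemma nneseries_ge_term (f : nat -> \bar R) k : (forall i, 0 <= f i) ->
  f k <= \sum_(i <oo) f i.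
Proof. by move=> f0; rewrite (@nneseriesD1 _ _ k xpredT)// leeDl// nneseries_ge0. Qed.

End nneseries_lemmas.

Section markov.
Context {R : realType} d (T : measurableType d).
Variables (P : nat -> probability T R) (Phi : R -> T -> nat) (Q : nat -> nat -> R).
Hypothesis hPhi : markov_chain P Phi Q.
Local Open Scope ereal_scope.

Definition at_state (t : R) k := [set w | Phi t w = k].

Lemma measurable_at_state t k : (0 <= t)%R -> measurable (at_state t k).
Proof. exact: mc_measurable hPhi t k. Qed.

Lemma measurable_at_pred t (A : pred nat) : (0 <= t)%R ->
  measurable [set w | A (Phi t w)].
Proof.
move=> t0; have -> : [set w | A (Phi t w)] = \bigcup_(k in [set k | A k]) at_state t k.
  apply/seteqP; split=> [w Aw|w [k /= Ak wk]]; first by exists (Phi t w).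
  by rewrite /= wk.
by apply: bigcup_measurable => k _; exact: measurable_at_state.
Qed.

Lemma paths_right_constant w : right_constant (Phi ^~ w).
Proof.
move=> t t0; have [e /= e0 he] := mc_right_continuous hPhi w t0.
exists e => // s; rewrite le_eqVlt => /predU1P[->//|ts] se.
by apply: he => //=; rewrite distrC ger0_norm ?subr_ge0 ?ltW// ltrBlDl.
Qed.

Lemma trivIset_at_state S t : trivIset setT (fun k => S `&` at_state t k).
Proof.
apply/trivIsetP => k l _ _ + ; rewrite -subset0 => + w [[_ wk] [_ wl]].
by rewrite -wk -wl eqxx.
Qed.

Lemma bigcup_at_state S t : \bigcup_k (S `&` at_state t k) = S.
Proof. by apply/seteqP; split=> [w [k _ []]//|w Sw]; exists (Phi t w). Qed.

Lemma measure_at_state i S t : (0 <= t)%R -> measurable S ->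
  P i S = \sum_(k <oo) P i (S `&` at_state t k).
Proof.
move=> t0 mS; rewrite -{1}(bigcup_at_state S t) measure_bigcup//.
- by apply: eq_eseriesl => k; rewrite in_setT.
- by move=> k _; apply: measurableI => //; exact: measurable_at_state.
- exact: trivIset_at_state.
Qed.

Definition cylinder (c : seq (R * pred nat)) :=
  [set w | all (fun x : R * pred nat => x.2 (Phi x.1 w)) c].

Definition times_in (s : R) (c : seq (R * pred nat)) :=
  all (fun x : R * pred nat => (0 <= x.1 <= s)%R) c.

Lemma measurable_cylinder s c : times_in s c -> measurable (cylinder c).
Proof.
elim: c => [_|x c IH /= /andP[/andP[x0 _] hc]].
  by rewrite (_ : cylinder [::] = setT)//; apply/seteqP; split.
rewrite (_ : cylinder (x :: c) = [set w | x.2 (Phi x.1 w)] `&` cylinder c).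
  by apply: measurableI; [exact: measurable_at_pred|exact: IH].
by apply/seteqP; split=> w /= => [/andP[]|[xw cw]]//; rewrite /cylinder /= xw.
Qed.

(** The events for which the Markov property at time [s] holds. *)
Definition past_event (s : R) D := measurable D /\
  forall i k l t, (0 <= t)%R ->
    P i (D `&` at_state s k `&` at_state (s + t) l) =
    P i (D `&` at_state s k) * P k (at_state t l).

Let fixed (past : seq (R * nat)) := [set w | forall x, x \in past -> Phi x.1 w = x.2].

Let measurable_fixed s past : (forall x, x \in past -> 0 <= x.1 <= s)%R ->
  measurable (fixed past).
Proof.
elim: past => [_|x p IH hp].
  by rewrite (_ : fixed [::] = setT)//; apply/seteqP; split.
rewrite (_ : fixed (x :: p) = at_state x.1 x.2 `&` fixed p).
  apply: measurableI.
    by apply: measurable_at_state; have /andP[] := hp x (mem_head _ _).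
  by apply: IH => y yp; apply: hp; rewrite inE yp orbT.
apply/seteqP; split=> w /=.
  move=> h; split; first by apply: h; exact: mem_head.
  by move=> y yp; apply: h; rewrite inE yp orbT.
by move=> [hx h] y; rewrite inE => /predU1P[->//|]; exact: h.
Qed.

(** Each constraint is split according to the state at its time, which adds this
    state to the finite past of the elementary Markov property. *)
Let past_cylinder_fixed (s : R) c past : (0 <= s)%R -> times_in s c ->
  (forall x, x \in past -> 0 <= x.1 <= s)%R ->
  past_event s (fixed past `&` cylinder c).
Proof.
move=> s0; elim: c past => [|[u A] c IH] past hc hp.
  rewrite (_ : _ `&` _ = fixed past); last by apply/seteqP; split=> w // [].
  split; first exact: measurable_fixed hp.
  move=> i k l t t0; have := mc_markov hPhi i k l s0 t0 hp.
  rewrite /fixed /at_state => <-; congr (P i _).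
  apply/seteqP; split=> w.
    by move=> [[fw sk] tl].
  by move=> [fw [sk tl]].
move: hc => /= /andP[/andP[u0 us] hc].
set D := _ `&` _; have mD : measurable D.
  apply: measurableI; first exact: measurable_fixed hp.
  by apply: (@measurable_cylinder s); rewrite /= u0 us.
split=> // i k l t t0.
have mk : measurable (at_state s k) by exact: measurable_at_state.
have ml : measurable (at_state (s + t) l).
  by apply: measurable_at_state; exact: addr_ge0.
have hm m E : D `&` E `&` at_state u m =
    if A m then fixed ((u, m) :: past) `&` cylinder c `&` E else set0.
  case: ifP => Am; last first.
    rewrite -subset0 => w [[[_ /=]] + _] wm.
    by rewrite /cylinder /= wm Am.
  apply/seteqP; split=> w.
    move=> [[[fw]]]; rewrite /cylinder /= => /andP[_ cw] Ew wm; split=> //; split => //.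
    by move=> x; rewrite inE => /predU1P[->//|]; exact: fw.
  move=> [[fw cw] Ew]; have wm : Phi u w = m := fw (u, m) (mem_head _ _).
  split => //; split=> //; split; last by rewrite /cylinder /= wm Am.
  by move=> x xp; apply: fw; rewrite inE xp orbT.
rewrite (measure_at_state i u0 (measurableI _ _ (measurableI _ _ mD mk) ml)).
rewrite (measure_at_state i u0 (measurableI _ _ mD mk)).
have fink : P k (at_state t l) \is a fin_num.
  by rewrite fin_num_measure//; exact: measurable_at_state.
rewrite muleC -(fineK fink) -nneseriesZl//.
apply: eq_eseriesr => m _; rewrite -classical_sets.setIA !hm.
case: ifP => Am; last by rewrite !measure0 mule0.
have hp' : (forall x, x \in (u, m) :: past -> 0 <= x.1 <= s)%R.
  by move=> x; rewrite inE => /predU1P[->/=|]; [rewrite u0 us|exact: hp].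
have [_ h] := IH _ hc hp'.
by rewrite fineK// muleC -(h i k l t t0) classical_sets.setIA.
Qed.

Lemma past_cylinder (s : R) c : (0 <= s)%R -> times_in s c ->
  past_event s (cylinder c).
Proof.
move=> s0 hc; have := @past_cylinder_fixed s c [::] s0 hc.
by rewrite (_ : fixed [::] = setT) ?setTI; [exact|apply/seteqP; split].
Qed.

Definition transition (t : R) (f : nat -> \bar R) i :=
  \sum_(l <oo) f l * P i (at_state t l).

Lemma transition_ge0 t f i : (forall l, 0 <= f l) -> 0 <= transition t f i.
Proof. by move=> f0; apply: nneseries_ge0 => l _ _; exact: mule_ge0. Qed.

Lemma integral_at_state i S t f : (0 <= t)%R -> measurable S ->
  (forall l, 0 <= f l) ->
  \int[P i]_(w in S) f (Phi t w) = \sum_(l <oo) f l * P i (S `&` at_state t l).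
Proof.
move=> t0 mS f0; rewrite -{1}(bigcup_at_state S t).
have mk k : measurable (S `&` at_state t k).
  by apply: measurableI => //; exact: measurable_at_state.
rewrite ge0_integral_bigcup//; first last.
- exact: trivIset_at_state.
- move=> _ B mB; rewrite bigcup_at_state.
  rewrite (_ : _ `&` _ = S `&` [set w | [pred k | `[< B (f k) >]] (Phi t w)]).
    by apply: measurableI => //; exact: measurable_at_pred.
  by apply/seteqP; split=> w [Sw /asboolP].
apply: eq_eseriesr => l _.
transitivity (\int[P i]_(w in S `&` at_state t l) f l).
  by apply: eq_integral => w; rewrite inE => -[_ <-].
by rewrite integral_cst.
Qed.

Lemma transitionE t f i : (0 <= t)%R -> (forall l, 0 <= f l) ->
  transition t f i = \int[P i]_w f (Phi t w).
Proof.
move=> t0 f0; rewrite integral_at_state//.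
by apply: eq_eseriesr => l _; rewrite setTI.
Qed.

Lemma markov_integral i s t D f : (0 <= s)%R -> (0 <= t)%R ->
  past_event s D -> (forall l, 0 <= f l) ->
  \int[P i]_(w in D) f (Phi (s + t)%R w) =
  \int[P i]_(w in D) transition t f (Phi s w).
Proof.
move=> s0 t0 [mD hD] f0; have st0 : (0 <= s + t)%R by exact: addr_ge0.
rewrite integral_at_state// (@integral_at_state _ _ s (transition t f))//; last first.
  by move=> l; exact: transition_ge0.
have fin k S : measurable S -> P k S \is a fin_num by move=> mS; exact: fin_num_measure.
have mDs k : measurable (D `&` at_state s k).
  by apply: measurableI => //; exact: measurable_at_state.
transitivity (\sum_(l <oo) \sum_(k <oo)
    f l * (P i (D `&` at_state s k) * P k (at_state t l))).
  apply: eq_eseriesr => l _.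
  rewrite (measure_at_state i s0); last first.
    by apply: measurableI => //; exact: measurable_at_state.
  rewrite nneseriesZl_ge0//; last by move=> k; exact: mule_ge0.
  congr (_ * _); apply: eq_eseriesr => k _.
  by rewrite -hD// -!classical_sets.setIA [X in D `&` X]classical_sets.setIC.
rewrite nneseries_interchange; last by move=> l k; rewrite !mule_ge0.
apply: eq_eseriesr => k _; rewrite muleC -nneseriesZl_ge0//; last first.
  by move=> l; exact: mule_ge0.
by apply: eq_eseriesr => l _; rewrite muleCA.
Qed.
End markov.

(** * The chain at integer times *)

Section skeleton.
Context {R : realType} d (T : measurableType d).
Variables (P : nat -> probability T R) (Phi : R -> T -> nat) (Q : nat -> nat -> R).
Hypothesis hPhi : markov_chain P Phi Q.
Local Open Scope ereal_scope.
Local Notation at_state := (at_state Phi).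
Local Notation transition := (transition P Phi).

Lemma past_eventT s : (0 <= s)%R -> past_event P Phi s setT.
Proof.
move=> s0; have := @past_cylinder _ _ _ _ _ _ hPhi s [::] s0 isT.
by rewrite (_ : cylinder _ _ = setT)//; apply/seteqP; split.
Qed.

Lemma markov_le i k l (s t : R) : (0 <= s)%R -> (0 <= t)%R ->
  P i (at_state s k) * P k (at_state t l) <= P i (at_state (s + t)%R l).
Proof.
move=> s0 t0; have [_ h] := past_eventT s0.
have := h i k l t t0; rewrite !setTI => <-.
have mS := measurable_at_state hPhi k s0.
have mST := measurable_at_state hPhi l (addr_ge0 s0 t0).
by apply: le_measure; rewrite ?inE//; exact: measurableI.
Qed.

Lemma at_state0 i k : P i (at_state 0%R k) = (k == i)%:R%:E.
Proof.
have [->|ki] := eqVneq k i; first exact: mc_initial hPhi i.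
apply/eqP; rewrite eq_le measure_ge0 andbT.
have m0 := measurable_at_state hPhi i (lexx 0%R).
have : P i (~` at_state 0%R i) <= 0.
  by rewrite probability_setC// (mc_initial hPhi i) subee.
apply: le_trans; apply: le_measure; rewrite ?inE//.
- exact: (measurable_at_state hPhi).
- exact: measurableC.
- by move=> w wk wi; move: ki; rewrite -wk -wi eqxx.
Qed.

Lemma transition0 f i : (forall l, 0 <= f l) -> transition 0%R f i = f i.
Proof.
move=> f0; rewrite /transition (@nneseriesD1 _ _ i xpredT)//; last first.
  by move=> l _; exact: mule_ge0.
rewrite at_state0 eqxx mule1 eseries0 ?adde0// => l _ /= li.
by rewrite at_state0 (negPf li) mule0.
Qed.

Lemma le_transition t f f' i : (forall l, 0 <= f l) -> (forall l, f l <= f' l) ->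
  transition t f i <= transition t f' i.
Proof.
move=> f0 ff'; apply: lee_nneseries => [l _ _|l _]; first exact: mule_ge0.
exact: lee_pmul.
Qed.

Lemma transition_series t (f : nat -> nat -> \bar R) i : (forall m l, 0 <= f m l) ->
  transition t (fun l => \sum_(m <oo) f m l) i = \sum_(m <oo) transition t (f m) i.
Proof.
move=> f0; rewrite /transition nneseries_interchange; last first.
  by move=> m l; exact: mule_ge0.
apply: eq_eseriesr => l _; rewrite muleC -nneseriesZl_ge0//.
by apply: eq_eseriesr => m _; rewrite muleC.
Qed.

Lemma transitionZ t c f i : 0 <= c -> (forall l, 0 <= f l) ->
  transition t (fun l => c * f l) i = c * transition t f i.
Proof.
move=> c0 f0; rewrite -nneseriesZl_ge0//; last by move=> l; exact: mule_ge0.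
by apply: eq_eseriesr => l _; rewrite muleA.
Qed.

(** The transition probability from [k] to itself is [1 + Q k k t + o(t)]. *)
Lemma at_state_pos0 k : exists2 e : R, (0 < e)%R &
  forall t, (0 <= t)%R -> (t < e)%R -> 0 < P k (at_state t k).
Proof.
have /cvgrPdist_lt /(_ 1%R ltr01) [e /= e0 he] := @mc_qmatrix _ _ _ _ _ _ hPhi k k.
pose a := (`|Q k k| + 1)%R; have a0 : (0 < a)%R by rewrite ltr_wpDl.
exists (Num.min e a^-1)%R; first by rewrite lt_min e0 invr_gt0.
move=> t; rewrite le_eqVlt => /predU1P[<- _|t0].
  by rewrite at_state0 eqxx.
rewrite lt_min => /andP[te ta].
have := he t; rewrite /= sub0r normrN gtr0_norm// => /(_ te t0).
rewrite eqxx => hd.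
have fp : P k (at_state t k) \is a fin_num.
  by apply: fin_num_measure; exact/(measurable_at_state hPhi)/ltW.
rewrite -(fineK fp) lte_fin.
have ta1 : (t * a < 1)%R by rewrite -ltr_pdivlMr// div1r.
have : ((Q k k - 1) * t < fine (P k (at_state t k)) - 1)%R.
  rewrite -ltr_pdivlMr//; move: hd; set x := (_ / t)%R.
  by rewrite ltr_norml => /andP[_]; lra.
have hq : (- `|Q k k| <= Q k k)%R by rewrite lerNnormlW// normrN.
have : (- (t * a) <= (Q k k - 1) * t)%R.
  by rewrite -mulrN mulrC ler_pM2r// /a; lra.
lra.
Qed.

Lemma at_state_pos k s : (0 <= s)%R -> 0 < P k (at_state s k).
Proof.
move=> s0; have [e e0 he] := at_state_pos0 k.
pose N := Num.truncn (s / e); pose r := (s / N.+1%:R)%R.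
have r0 : (0 <= r)%R by rewrite divr_ge0.
have re : (r < e)%R.
  by rewrite /r ltr_pdivrMr// mulrC -ltr_pdivrMr//; exact: truncnS_gt.
suff h n : 0 < P k (at_state (n%:R * r)%R k).
  by have := h N.+1; rewrite mulrC divfK.
elim: n => [|n IH]; first by rewrite mul0r at_state0 eqxx.
rewrite -natr1 mulrDl mul1r; apply: lt_le_trans (@markov_le k k k (n%:R * r)%R r _ r0); last by rewrite mulr_ge0.
by apply: mule_gt0 => //; exact: he.
Qed.

(** One step of the integer-time chain, killed on leaving [A]. *)
Definition taboo (A : pred nat) (f : nat -> \bar R) :=
  transition 1%R (fun l => if A l then f l else 0).

Fixpoint taboos (A : nat -> pred nat) (M : nat) f :=
  if M is M'.+1 then taboos A M' (taboo (A M) f) else f.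

Definition allowed (A : nat -> pred nat) (M : nat) :=
  [set w | forall r, (0 < r <= M)%N -> A r (Phi r%:R w)].

Lemma taboo_ge0 A f i : (forall l, 0 <= f l) -> 0 <= taboo A f i.
Proof. by move=> f0; apply: transition_ge0 => l; case: ifP. Qed.

Lemma allowedS A M :
  allowed A M.+1 = allowed A M `&` [set w | A M.+1 (Phi M.+1%:R w)].
Proof.
apply/seteqP; split=> w /=.
  move=> h; split; last by apply: h; rewrite /= leqnn.
  by move=> r /andP[r0 rM]; apply: h; rewrite r0 leqW.
move=> [h1 h2] r /andP[r0]; rewrite leq_eqVlt => /predU1P[->//|].
by rewrite ltnS => rM; apply: h1; rewrite r0.
Qed.

Lemma past_allowed A M : past_event P Phi M%:R (allowed A M).
Proof.
pose c := [seq (r%:R : R, A r) | r <- iota 1 M].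
have -> : allowed A M = cylinder Phi c.
  apply/seteqP; split=> w /=.
    move=> h; rewrite /cylinder /c /= all_map; apply/allP => r.
    by rewrite mem_iota add1n ltnS /= => hr; exact: h.
  rewrite /cylinder /c /= all_map => /allP h r hr; apply: h.
  by rewrite mem_iota add1n ltnS.
apply: (past_cylinder hPhi) => //; rewrite /times_in all_map; apply/allP => r.
by rewrite mem_iota add1n ltnS => /andP[_ rM] /=; rewrite ler0n ler_nat.
Qed.

Lemma measurable_allowed A M : measurable (allowed A M).
Proof. by have [] := past_allowed A M. Qed.

(** The last constraint is absorbed into the function, and the Markov property at
    the last but one integer time replaces it by a taboo kernel. *)
Lemma integral_allowed A M f i : (forall l, 0 <= f l) ->
  \int[P i]_(w in allowed A M) f (Phi M%:R w) = taboos A M f i.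
Proof.
elim: M f => [|M IH] f f0.
  rewrite (_ : allowed A 0 = setT); last first.
    by apply/seteqP; split=> // w _ r /andP[r0]; rewrite leqNgt r0.
  by rewrite -(transitionE hPhi)// transition0.
rewrite allowedS integral_mkcondr.
pose f' l := if A M.+1 l then f l else 0.
rewrite (eq_integral (fun w => f' (Phi (M%:R + 1)%R w))); last first.
  move=> w _; rewrite patchE natr1 /f'.
  case: (boolP (A M.+1 (Phi M.+1%:R w))) => Aw; first by rewrite mem_set.
  by rewrite memNset//=; exact/negP.
have f'0 l : 0 <= f' l by rewrite /f'; case: ifP.
rewrite (markov_integral hPhi)//; last exact: past_allowed.
by rewrite IH// => l; exact: transition_ge0.
Qed.

Lemma iter_taboo_ge0 A m f i : (forall l, 0 <= f l) -> 0 <= iter m (taboo A) f i.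
Proof. by move=> f0; elim: m i => [|m IH] i //=; exact: taboo_ge0. Qed.

Lemma le_taboo A f f' i : (forall l, 0 <= f l) -> (forall l, f l <= f' l) ->
  taboo A f i <= taboo A f' i.
Proof. by move=> f0 ff'; apply: le_transition => l; case: ifP. Qed.

Lemma le_iter_taboo A m f f' i : (forall l, 0 <= f l) -> (forall l, f l <= f' l) ->
  iter m (taboo A) f i <= iter m (taboo A) f' i.
Proof.
move=> f0 ff'; elim: m i => [|m IH] i //=; apply: le_taboo => // l.
exact: iter_taboo_ge0.
Qed.

Lemma taboo_series A (f : nat -> nat -> \bar R) i : (forall m l, 0 <= f m l) ->
  taboo A (fun l => \sum_(m <oo) f m l) i = \sum_(m <oo) taboo A (f m) i.
Proof.
move=> f0; rewrite /taboo -transition_series; last by move=> m l; case: ifP.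
congr (transition _ _ _); apply/funext => l; case: ifP => // _.
by rewrite eseries0.
Qed.

Lemma iter_taboo_series A n (f : nat -> nat -> \bar R) i : (forall m l, 0 <= f m l) ->
  iter n (taboo A) (fun l => \sum_(m <oo) f m l) i =
  \sum_(m <oo) iter n (taboo A) (f m) i.
Proof.
move=> f0; elim: n i => [//|n IH] i /=.
rewrite -taboo_series; last by move=> m l; exact: iter_taboo_ge0.
by congr (taboo _ _ _); apply/funext => l; exact: IH.
Qed.

Lemma tabooZ A c f i : 0 <= c -> (forall l, 0 <= f l) ->
  taboo A (fun l => c * f l) i = c * taboo A f i.
Proof.
move=> c0 f0; rewrite /taboo -transitionZ//; last by move=> l; case: ifP.
by congr (transition _ _ _); apply/funext => l; case: ifP; rewrite ?mule0.
Qed.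

Lemma iter_tabooZ A n c f i : 0 <= c -> (forall l, 0 <= f l) ->
  iter n (taboo A) (fun l => c * f l) i = c * iter n (taboo A) f i.
Proof.
move=> c0 f0; elim: n i => [//|n IH] i /=.
rewrite -tabooZ//; last by move=> l; exact: iter_taboo_ge0.
by congr (taboo _ _ _); apply/funext => l; exact: IH.
Qed.

(** [potential j H] is the expected sum of [H] over the integer times before the
    first positive integer time at which the path is in [j]. *)
Definition potential j (H : nat -> \bar R) i :=
  \sum_(m <oo) iter m (taboo (predC1 j)) H i.

Lemma potential_ge0 j H i : (forall l, 0 <= H l) -> 0 <= potential j H i.
Proof. by move=> H0; apply: nneseries_ge0 => m _ _; exact: iter_taboo_ge0. Qed.

(** Potentials are finite at all states reached from a state where they are. *)
Lemma potential_step j H i k : (forall l, 0 <= H l) -> k != j ->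
  P i (at_state 1%R k) * potential j H k <= potential j H i.
Proof.
move=> H0 kj; rewrite -nneseriesZl_ge0//; last by move=> m; exact: iter_taboo_ge0.
rewrite /potential [leRHS]nneseries_recl//; last by move=> m _; exact: iter_taboo_ge0.
apply: le_trans (leeDr _ _); last exact: H0.
rewrite -nneseries_addn; last by move=> m; exact: iter_taboo_ge0.
apply: lee_nneseries => [m _ _|m _]; first by rewrite mule_ge0// iter_taboo_ge0.
rewrite addn1 iterS {2}/taboo /transition.
apply: le_trans (nneseries_ge_term k _); last first.
  by move=> l; rewrite mule_ge0//; case: ifP => // _; exact: iter_taboo_ge0.
by rewrite /= kj muleC.
Qed.

End skeleton.

(** * Stationarity *)

Section stationary.
Context {R : realType} d (T : measurableType d).
Variables (P : nat -> probability T R) (Phi : R -> T -> nat) (Q : nat -> nat -> R).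
Variable pi : nat -> R.
Hypothesis hPhi : markov_chain P Phi Q.
Hypothesis hirr : irreducible P Phi.
Hypothesis hpi : invariant_probability P Phi pi.
Local Open Scope ereal_scope.
Local Notation at_state := (at_state Phi).
Local Notation transition := (transition P Phi).
Local Notation taboo := (taboo P Phi).
Local Notation potential := (potential P Phi).

Lemma pi_ge0 k : 0 <= (pi k)%:E.
Proof. by rewrite lee_fin; case: hpi. Qed.

Definition mean (f : nat -> \bar R) := \sum_(i <oo) (pi i)%:E * f i.

Lemma mean_ge0 f : (forall l, 0 <= f l) -> 0 <= mean f.
Proof. by move=> f0; apply: nneseries_ge0 => i _ _; rewrite mule_ge0// pi_ge0. Qed.

Lemma mean_transition t f : (0 <= t)%R -> (forall l, 0 <= f l) ->
  mean (transition t f) = mean f.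
Proof.
move=> t0 f0; have [_ _ hinv] := hpi.
transitivity (\sum_(i <oo) \sum_(l <oo) (pi i)%:E * (f l * P i (at_state t l))).
  apply: eq_eseriesr => i _; rewrite nneseriesZl_ge0 ?pi_ge0// => l.
  exact: mule_ge0.
rewrite nneseries_interchange; last by move=> i l; rewrite !mule_ge0// pi_ge0.
apply: eq_eseriesr => l _; rewrite -(hinv t l t0) muleC -nneseriesZl_ge0//; last first.
  by move=> i; rewrite mule_ge0// pi_ge0.
by apply: eq_eseriesr => i _; rewrite muleCA.
Qed.

Lemma pi_gt0 k : (0 < pi k)%R.
Proof.
have [pi0 pi1 hinv] := hpi.
have [i pii] : exists i, (0 < pi i)%R.
  apply: contrapT => h; have := pi1; rewrite eseries0; first by move/esym/eqP; rewrite onee_eq0.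
  move=> i _ _; congr EFin; apply/eqP; rewrite eq_le pi0 andbT leNgt.
  by apply/negP => p0; apply: h; exists i.
have [t t0 pt] := hirr i k.
rewrite -lte_fin -(hinv t k (ltW t0)).
apply: lt_le_trans (nneseries_ge_term i _); first by rewrite mule_gt0// lte_fin.
by move=> l; rewrite mule_ge0// pi_ge0.
Qed.

Let away j (f : nat -> \bar R) l := if l != j then f l else 0.

(** Splitting off the state [j] and using the invariance of [pi] alternately
    gives [pi H >= pi j (H j + K H j + K^2 H j + ...)], where [K] is the kernel
    with taboo [j]. *)
Let mean_split j f : (forall l, 0 <= f l) ->
  mean f = (pi j)%:E * f j + mean (away j f).
Proof.
move=> f0; rewrite /mean (@nneseriesD1 _ _ j xpredT)//; last first.
  by move=> l _; rewrite mule_ge0// pi_ge0.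
congr (_ + _); rewrite eseries_mkcond; apply: eq_eseriesr => l _ /=.
by rewrite /away; case: ifP; rewrite ?mule0.
Qed.

Let mean_away j f : (forall l, 0 <= f l) -> mean (away j f) = mean (taboo (predC1 j) f).
Proof.
by move=> f0; rewrite /taboo mean_transition// => l; case: ifP.
Qed.

(** One half of the formula of Kac for excursions from [j]. *)
Lemma potential_le_mean j H : (forall l, 0 <= H l) ->
  (pi j)%:E * potential j H j <= mean H.
Proof.
move=> H0; rewrite -nneseriesZl_ge0 ?pi_ge0//; last by move=> m; exact: iter_taboo_ge0.
have h n f : (forall l, 0 <= f l) ->
    \sum_(0 <= m < n) (pi j)%:E * iter m (taboo (predC1 j)) f j <= mean f.
  elim: n f => [|n IH] f f0; first by rewrite big_geq// mean_ge0.
  rewrite big_nat_recl// (mean_split j)//= leeD2l// mean_away//.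
  under eq_bigr do rewrite -iterS iterSr.
  by apply: IH => l; exact: taboo_ge0.
apply: lime_le; last by apply: nearW => n; exact: h.
apply: is_cvg_nneseries => m _ _; rewrite mule_ge0 ?pi_ge0//; exact: iter_taboo_ge0.
Qed.

(** A positive transition probability at a real time remains positive at the next
    integer, since the chain may stay in its state. *)
Lemma reach_integer j i : exists m, 0 < P j (at_state m%:R i).
Proof.
have [t t0 pt] := hirr j i.
exists (Num.truncn t).+1; have tt : (0 <= (Num.truncn t).+1%:R - t)%R.
  by rewrite subr_ge0 ltW// truncnS_gt.
rewrite (_ : (Num.truncn t).+1%:R = t + ((Num.truncn t).+1%:R - t))%R; last first.
  by rewrite addrC subrK.
apply: lt_le_trans (markov_le hPhi j i i (ltW t0) tt) => //.
by rewrite mule_gt0// (at_state_pos hPhi).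
Qed.

Lemma potential_fin j H i : (forall l, 0 <= H l) -> mean H < +oo ->
  potential j H i < +oo.
Proof.
move=> H0 Hoo; have jj : potential j H j < +oo.
  have := le_lt_trans (potential_le_mean j H0) Hoo.
  by apply: contraTT; rewrite -!leNgt !leye_eq => /eqP ->; rewrite gt0_muley// lte_fin pi_gt0.
have [m] := reach_integer j i; elim: m i => [|m IH] i.
  rewrite (at_state0 hPhi); case: eqVneq => [->//|]; by rewrite ltxx.
rewrite -natr1 => hm.
have [k hk1 hk2] : exists2 k, 0 < P j (at_state m%:R k) & 0 < P k (at_state 1%R i).
  apply: contrapT => hk; move: hm; rewrite ltNge => /negP; apply.
  have m0 : (0 <= m%:R :> R)%R by [].
  have mS := measurable_at_state hPhi i (addr_ge0 m0 (@ler01 R)).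
  rewrite (measure_at_state hPhi j m0 mS) eseries0// => k _ _.
  have [_ hD] := past_eventT hPhi m0.
  have := hD j k i 1%R ler01; rewrite !setTI classical_sets.setIC => ->.
  have := measure_ge0 (P j) (at_state m%:R k); rewrite le_eqVlt => /predU1P[<-|p1].
    by rewrite mul0e.
  have := measure_ge0 (P k) (at_state 1%R i); rewrite le_eqVlt => /predU1P[<-|p2].
    by rewrite mule0.
  by exfalso; apply: hk; exists k.
have [->//|ij] := eqVneq i j.
have := le_lt_trans (@potential_step _ _ _ P Phi j H k i H0 ij) (IH k hk1).
apply: contraTT; rewrite -!leNgt !leye_eq => /eqP ->.
by rewrite gt0_muley.
Qed.

End stationary.

(** * Between integer times *)

Section translation.
Context {R : realType}.
Local Notation mu := (@lebesgue_measure R).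

Lemma lebesgue_measure_translation c (A : set (measurableTypeR R)) :
  measurable A -> mu A = mu ((fun t => t - c) @^-1` A).
Proof.
have mc : measurable_fun setT ((fun t => t - c) : measurableTypeR R -> measurableTypeR R).
  by apply: nondecreasing_measurable => // s t st; rewrite lerD2r.
pose nu := pushforward mu ((fun t => t - c) : measurableTypeR R -> measurableTypeR R).
suff : forall Y, ocitv Y -> mu Y = nu Y by move=> /lebesgue_measure_unique h /h ->.
move=> _ [[a b] _ <-]; rewrite /nu /pushforward /=.
rewrite (_ : _ @^-1` _ = `]a + c, b + c]%classic); last first.
  by apply/seteqP; split=> s /=; rewrite !in_itv/= ltrBrDr lerBlDr.
rewrite !lebesgue_measure_itv/= !lte_fin ltrD2r; case: ifP => // _.
by rewrite -!EFinD; congr EFin; ring.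
Qed.

Lemma ge0_integral_translation c (f : R -> \bar R) :
  measurable_fun setT (f : measurableTypeR R -> \bar R) -> (forall t, (0 <= f t)%E) ->
  (\int[mu]_(t in `[c, (c + 1)%R[) f (t - c)%R = \int[mu]_(t in `[0%R, 1%R[) f t)%E.
Proof.
move=> mf f0.
have mc : measurable_fun setT ((fun t => t - c) : measurableTypeR R -> measurableTypeR R).
  by apply: nondecreasing_measurable => // s t st; rewrite lerD2r.
rewrite [RHS](@eq_measure_integral _ _ _ _
  (pushforward mu ((fun t => t - c) : measurableTypeR R -> measurableTypeR R))); last first.
  by move=> A mA _; exact: lebesgue_measure_translation.
rewrite ge0_integral_pushforward//; last exact: (measurable_funS measurableT (@subsetT _ _) mf).
by congr (integral _ _ _); apply/seteqP; split=> s /=; rewrite !in_itv/= subr_ge0 ltrBlDl.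
Qed.

End translation.

Section continuous_time.
Context {R : realType} d (T : measurableType d).
Variables (P : nat -> probability T R) (Phi : R -> T -> nat) (Q : nat -> nat -> R).
Variable pi : nat -> R.
Hypothesis hPhi : markov_chain P Phi Q.
Hypothesis hirr : irreducible P Phi.
Hypothesis hpi : invariant_probability P Phi pi.
Local Open Scope ereal_scope.
Local Notation at_state := (at_state Phi).
Local Notation transition := (transition P Phi).
Local Notation taboo := (taboo P Phi).
Local Notation taboos := (taboos P Phi).
Local Notation allowed := (allowed Phi).
Local Notation potential := (potential P Phi).
Local Notation mean := (mean pi).
Local Notation mu := (@lebesgue_measure R).

Let in_state k : set (T * measurableTypeR R) := [set z | (0 <= z.2)%R /\ Phi z.2 z.1 = k].

Let measurable_in_state k : measurable (in_state k).
Proof.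
by apply: joint_measurable => [t l t0|w];
  [exact: (measurable_at_state hPhi)|exact: (paths_right_constant hPhi)].
Qed.

Lemma measurable_nneg_products :
  measurable [set z : T * measurableTypeR R | (0 <= z.2)%R].
Proof.
rewrite (_ : [set _ | _] = setT `*` ([set t | (0 <= t)%R] : set (measurableTypeR R))).
  by apply: measurableX => //; exact: measurable_nneg_times.
by apply/seteqP; split=> z //= [].
Qed.

Lemma measurable_fun_joint (k : nat -> \bar R) :
  measurable_fun [set z : T * measurableTypeR R | (0 <= z.2)%R]
    (fun z => k (Phi z.2 z.1)).
Proof.
move=> _ B mB; rewrite (_ : _ `&` _ = \bigcup_(l in [set l | B (k l)]) in_state l).
  by apply: bigcup_measurable => l _; exact: measurable_in_state.
apply/seteqP; split=> [[w t] /= [t0 Bk]|[w t] /= [l /= Bl [t0 wl]]].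
  by exists (Phi t w).
by split=> //=; move: wl => /= ->.
Qed.

Variable h : nat -> \bar R.
Hypothesis h0 : forall l, 0 <= h l.

Let trans k (s : R) := \sum_(l <oo) h l * P k (ysection (in_state l) s).

Let transE k s : (0 <= s)%R -> trans k s = transition s h k.
Proof.
move=> s0; apply: eq_eseriesr => l _; congr (_ * P k _).
apply/seteqP; split=> w; rewrite /ysection /= inE /=; first by case.
by move=> ws; split.
Qed.

Let trans_ge0 k s : 0 <= trans k s.
Proof. by apply: nneseries_ge0 => l _ _; exact: mule_ge0. Qed.

Let measurable_trans k : measurable_fun setT (trans k : measurableTypeR R -> \bar R).
Proof.
apply: ge0_emeasurable_sum => [l s _ _|l _]; first exact: mule_ge0.
apply: emeasurable_funM => //.
exact: (measurable_fun_ysection (P k) (measurable_in_state l)).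
Qed.

Definition unit_cost k := \int[mu]_(s in `[0%R, 1%R[) transition s h k.

Let unit_costE k : unit_cost k = \int[mu]_(s in `[0%R, 1%R[) trans k s.
Proof. by apply: eq_integral => s; rewrite inE/= in_itv/= => /andP[s0 _]; rewrite transE. Qed.

Lemma unit_cost_ge0 k : 0 <= unit_cost k.
Proof. by apply: integral_ge0 => s _; exact: transition_ge0. Qed.

Let measurable_transD k (D : set R) : measurable_fun (D : set (measurableTypeR R)) (trans k).
Proof. exact: (measurable_funS measurableT (@subsetT _ _) (measurable_trans k)). Qed.

(** Stationarity at each time of the unit interval. *)
Lemma mean_unit_cost : mean unit_cost = mean h.
Proof.
transitivity (\sum_(i <oo) \int[mu]_(s in `[0%R, 1%R[) ((pi i)%:E * trans i s)).
  apply: eq_eseriesr => i _.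
  by rewrite unit_costE ge0_integralZl// ?lee_fin; case: hpi.
rewrite -integral_nneseries//; first last.
- by move=> i s _; rewrite mule_ge0// (pi_ge0 hpi).
- move=> i; apply: emeasurable_funM => //; exact: measurable_transD.
rewrite (eq_integral (fun=> mean h)); last first.
  move=> s; rewrite inE/= in_itv/= => /andP[s0 _].
  rewrite -(mean_transition hpi s0)//.
  by apply: eq_eseriesr => i _; rewrite transE.
by rewrite integral_cst//= lebesgue_measure_itv/= lte_fin ltr01 sube0 mule1.
Qed.

Lemma unit_cost_ge1 k : (forall l, 1 <= h l) -> 1 <= unit_cost k.
Proof.
move=> h1.
have -> : 1 = \int[mu]_(s in (`[0%R, 1%R[%classic : set (measurableTypeR R))) cst (1 : \bar R) s.
  by rewrite integral_cst//= lebesgue_measure_itv/= lte_fin ltr01 sube0 mule1.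
rewrite unit_costE; apply: ge0_le_integral => // s /=; rewrite in_itv/= => /andP[s0 _].
rewrite transE// -(@probability_setT _ _ _ (P k)).
rewrite (measure_at_state hPhi k s0)//; apply: lee_nneseries => // l _.
by rewrite setTI -[leLHS]mul1e lee_pmul.
Qed.

(** The dominating function is a sum of such cells, one for each unit of time
    and each event that describes the integer times before it. *)
Definition cell (M : nat) (D : set T) (z : T * measurableTypeR R) :=
  ((fun z => h (Phi z.2 z.1)) \_ (D `*` `[M%:R, (M%:R + 1)%R[%classic)) z.

Lemma cell_ge0 M D z : 0 <= cell M D z.
Proof. by rewrite /cell patchE; case: ifP. Qed.

Lemma measurable_cell M D : measurable D -> measurable_fun setT (cell M D).
Proof.
move=> mD.
have mE : measurable (D `*` (`[M%:R, (M%:R + 1)%R[%classic : set (measurableTypeR R))).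
  exact: measurableX.
have [+ _] := measurable_restrictT (fun z : T * measurableTypeR R => h (Phi z.2 z.1)) mE.
apply; apply: (measurable_funS measurable_nneg_products) (measurable_fun_joint h).
by move=> [w t] /= [_]; rewrite in_itv/= => /andP[+ _]; exact: le_trans.
Qed.

(** The Markov property at time [M], once the order of integration is exchanged. *)
Lemma integral_cell i M D : past_event P Phi M%:R D ->
  \int[P i \x mu]_z cell M D z = \int[P i]_(w in D) unit_cost (Phi M%:R w).
Proof.
move=> pD; have mD : measurable D by case: pD.
have M0 : (0 <= M%:R :> R)%R by [].
rewrite fubini_tonelli2//; [|exact: measurable_cell|by move=> z; exact: cell_ge0].
rewrite (integral_at_state hPhi)//; last exact: unit_cost_ge0.
transitivity (\int[mu]_(t in `[M%:R, (M%:R + 1)%R[)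
    \sum_(l <oo) trans l (t - M%:R) * P i (D `&` at_state M%:R l)).
  rewrite integral_mkcond [RHS]integral_mkcond; apply: eq_integral => t _.
  rewrite patch_setT patchE /fubini_G; case: ifPn => ht; last first.
    rewrite (eq_integral (cst 0)) ?integral0// => w _.
    by rewrite /cell patchE memNset//= => -[_ tM]; move: ht; rewrite mem_set.
  move: (ht); rewrite inE/= in_itv/= => /andP[Mt _].
  have tM0 : (0 <= t - M%:R)%R by rewrite subr_ge0.
  transitivity (\int[P i]_(w in D) h (Phi t w)).
    rewrite [RHS]integral_mkcond; apply: eq_integral => w _.
    rewrite /cell !patchE; case: ifPn => [|wD].
      by rewrite inE => -[/= wD _]; rewrite mem_set.
    rewrite memNset// => wD'; move: wD; rewrite mem_set//; split => //=.
    by rewrite -inE.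
  rewrite -{1}(subrKC M%:R t) (markov_integral hPhi)//.
  rewrite (integral_at_state hPhi)//; last by move=> l; exact: transition_ge0.
  by apply: eq_eseriesr => l _; rewrite transE.
have mtr l : measurable_fun setT ((fun t => trans l (t - M%:R)%R) : measurableTypeR R -> \bar R).
  have mc : measurable_fun setT ((fun t => t - M%:R)%R : measurableTypeR R -> measurableTypeR R).
    by apply: nondecreasing_measurable => // s t st; rewrite lerD2r.
  exact: (measurableT_comp (measurable_trans l) mc).
rewrite integral_nneseries//; first last.
- by move=> l t _; exact: mule_ge0.
- move=> l; apply: emeasurable_funM => //.
  exact: (measurable_funS measurableT (@subsetT _ _) (mtr l)).
apply: eq_eseriesr => l _.
have fP : P i (D `&` at_state M%:R l) \is a fin_num.
  by apply: fin_num_measure; apply: measurableI => //; exact: (measurable_at_state hPhi).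
rewrite -(fineK fP) ge0_integralZr//; last 2 first.
- exact: (measurable_funS measurableT (@subsetT _ _) (mtr l)).
- by rewrite lee_fin fine_ge0.
by rewrite ge0_integral_translation// unit_costE.
Qed.

End continuous_time.

(** * The dominating function *)

Section domination.
Context {R : realType} d (T : measurableType d).
Variables (P : nat -> probability T R) (Phi : R -> T -> nat) (Q : nat -> nat -> R).
Variable pi : nat -> R.
Hypothesis hPhi : markov_chain P Phi Q.
Hypothesis hirr : irreducible P Phi.
Hypothesis hpi : invariant_probability P Phi pi.
Local Open Scope ereal_scope.
Local Notation at_state := (at_state Phi).
Local Notation transition := (transition P Phi).
Local Notation taboo := (taboo P Phi).
Local Notation taboos := (taboos P Phi).
Local Notation allowed := (allowed Phi).
Local Notation potential := (potential P Phi).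
Local Notation mean := (mean pi).
Local Notation mu := (@lebesgue_measure R).

Lemma taboos_addn A B M k f :
  (forall r, (M < r <= M + k)%N -> A r = B) ->
  taboos A (M + k) f = taboos A M (iter k (taboo B) f).
Proof.
elim: k f => [|k IH] f AB; first by rewrite addn0.
rewrite addnS /= IH; last by move=> r /andP[Mr rk]; apply: AB; rewrite Mr addnS leqW.
rewrite AB; first by rewrite -iterSr.
by rewrite addnS leqnn ltnS leq_addr.
Qed.

Lemma taboos_cst B M f : taboos (fun=> B) M f = iter M (taboo B) f.
Proof. by rewrite -[M in LHS]add0n (@taboos_addn _ B). Qed.

Variables (a j : nat).

(** The constraints on the integer-time chain that express a first visit to [a] at
    time [m] after which [j] is avoided. *)
Definition first_visit (m r : nat) : pred nat :=
  if (r < m)%N then predC1 a else if r == m then pred1 a else predC1 j.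

Lemma taboos_first_visit m r f :
  taboos (first_visit m.+1) (m.+1 + r) f =
  iter m (taboo (predC1 a)) (taboo (pred1 a) (iter r (taboo (predC1 j)) f)).
Proof.
rewrite (@taboos_addn _ (predC1 j)); last first.
  by move=> k /andP[mk _]; rewrite /first_visit ltnNge (ltnW mk) gtn_eqF.
rewrite /= {2}/first_visit ltnn eqxx -[m in taboos _ m]add0n.
by rewrite (@taboos_addn _ (predC1 a))// => k /andP[_ km]; rewrite /first_visit ltnS km.
Qed.

Lemma taboo_pred1 f i : (forall l, 0 <= f l) -> taboo (pred1 a) f i <= f a.
Proof.
move=> f0; rewrite /taboo /transition (@nneseriesD1 _ _ a xpredT)//; last first.
  by move=> l _; rewrite mule_ge0//; case: ifP.
rewrite /= eqxx eseries0 ?adde0; last by move=> l _ /= /negPf ->; rewrite mul0e.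
rewrite -[leRHS]mule1 lee_wpmul2l// probability_le1//.
exact: (measurable_at_state hPhi).
Qed.

Definition completes (M : nat) (X : R -> nat) := exists r q : nat,
  [/\ (0 < r)%N, (r <= q)%N, (q <= M)%N, X r%:R = a & X q%:R = j].

Variable h : nat -> \bar R.
Hypothesis h1 : forall l, 1 <= h l.
Hypothesis hoo : mean h < +oo.

Let h0 l : 0 <= h l. Proof. exact: le_trans (h1 l). Qed.

Local Notation cell := (cell Phi h).

(** The first series covers the paths that have not visited [a] yet; the second one
    those that visited [a] first at time [m.+1], and have avoided [j] during the
    [r] following integer times. *)
Definition dominating (z : T * measurableTypeR R) :=
  \sum_(M <oo) cell M (allowed (fun=> predC1 a) M) z +
  \sum_(m <oo) \sum_(r <oo) cell (m.+1 + r) (allowed (first_visit m.+1) (m.+1 + r)) z.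

Lemma dominating_ge0 z : 0 <= dominating z.
Proof.
rewrite adde_ge0// nneseries_ge0// => m _ _; first exact: cell_ge0.
by apply: nneseries_ge0 => r _ _; exact: cell_ge0.
Qed.

Let mcell M A : measurable_fun setT (cell M (allowed A M)).
Proof. by apply: (measurable_cell hPhi) => //; exact: (measurable_allowed hPhi). Qed.

Lemma measurable_dominating : measurable_fun setT dominating.
Proof.
apply: emeasurable_funD.
  by apply: ge0_emeasurable_sum => [M z _ _|M _]; [exact: cell_ge0|exact: mcell].
apply: ge0_emeasurable_sum => [m z _ _|m _].
  by apply: nneseries_ge0 => r _ _; exact: cell_ge0.
by apply: ge0_emeasurable_sum => [r z _ _|r _]; [exact: cell_ge0|exact: mcell].
Qed.

Let H := unit_cost P Phi h.
Let H0 l : 0 <= H l. Proof. exact: unit_cost_ge0. Qed.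
Let H1 l : 1 <= H l. Proof. exact: (unit_cost_ge1 hPhi). Qed.

Let integral_cell_allowed i A M :
  \int[P i \x mu]_z cell M (allowed A M) z = taboos A M H i.
Proof.
rewrite (integral_cell hPhi)//; last exact: (past_allowed hPhi).
by rewrite (integral_allowed hPhi).
Qed.

(** The second series sums to at most [potential j H a * potential a H i]: from
    the visit to [a] on, the chain pays the potential of [j], and the probabilities
    of the first visits to [a] are bounded by [H >= 1]. *)
Lemma integral_dominating i : \int[P i \x mu]_z dominating z < +oo.
Proof.
have meanH : mean H < +oo by rewrite (mean_unit_cost hPhi hpi).
rewrite ge0_integralD//; first last.
- apply: ge0_emeasurable_sum => [m z _ _|m _].
    by apply: nneseries_ge0 => r _ _; exact: cell_ge0.
  by apply: ge0_emeasurable_sum => [r z _ _|r _]; [exact: cell_ge0|exact: mcell].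
- move=> z _; apply: nneseries_ge0 => m _ _.
  by apply: nneseries_ge0 => r _ _; exact: cell_ge0.
- by apply: ge0_emeasurable_sum => [M z _ _|M _]; [exact: cell_ge0|exact: mcell].
- by move=> z _; apply: nneseries_ge0 => m _ _; exact: cell_ge0.
apply: lte_add_pinfty.
  rewrite integral_nneseries//; last by move=> M z _; exact: cell_ge0.
  under eq_eseriesr do rewrite integral_cell_allowed taboos_cst.
  exact: (potential_fin hPhi hirr hpi).
rewrite integral_nneseries//; first last.
- by move=> m z _; apply: nneseries_ge0 => r _ _; exact: cell_ge0.
- by move=> m; apply: ge0_emeasurable_sum => [r z _ _|r _]; [exact: cell_ge0|exact: mcell].
apply: (@le_lt_trans _ _ (potential j H a * potential a H i)); last first.
  rewrite lte_mul_pinfty//; first exact: potential_ge0.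
    rewrite ge0_fin_numE; last exact: potential_ge0.
    exact: (potential_fin hPhi hirr hpi).
  exact: (potential_fin hPhi hirr hpi).
rewrite /(potential a) -nneseriesZl_ge0; first last.
- by move=> m; exact: iter_taboo_ge0.
- exact: potential_ge0.
apply: lee_nneseries => m *; first by apply: integral_ge0 => z _;
  apply: nneseries_ge0 => r _ _; exact: cell_ge0.
rewrite integral_nneseries//; last by move=> r z _; exact: cell_ge0.
under eq_eseriesr do rewrite integral_cell_allowed taboos_first_visit.
rewrite -iter_taboo_series; last first.
  by move=> r l; apply: taboo_ge0 => l'; exact: iter_taboo_ge0.
rewrite -iter_tabooZ//; last exact: potential_ge0.
apply: le_iter_taboo => l.
  by apply: nneseries_ge0 => r _ _; apply: taboo_ge0 => l'; exact: iter_taboo_ge0.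
rewrite -taboo_series; last by move=> r l'; exact: iter_taboo_ge0.
apply: le_trans (taboo_pred1 _ _) _ => [l'|]; first exact: potential_ge0.
by rewrite -[leLHS]mule1 lee_wpmul2l//; exact: potential_ge0.
Qed.

Lemma dominating_ge w (t : R) : (0 <= t)%R ->
  ~ completes (Num.truncn t) (Phi ^~ w) -> h (Phi t w) <= dominating (w, t).
Proof.
move=> t0 hw; set M := Num.truncn t.
have cellE (A : nat -> pred nat) : (forall r, (0 < r <= M)%N -> A r (Phi r%:R w)) ->
    cell M (allowed A M) (w, t) = h (Phi t w).
  move=> hA; rewrite /cell patchE mem_set//; split=> //=.
  by rewrite in_itv/= natr1 truncn_itv.
have [hr|] := pselect (forall r, (0 < r <= M)%N -> Phi r%:R w != a).
  rewrite -(cellE (fun=> predC1 a) hr) /dominating; apply: le_trans (leeDl _ _).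
    apply: (@nneseries_ge_term _ (fun M => cell M (allowed (fun=> predC1 a) M) (w, t))).
    by move=> i; exact: cell_ge0.
  apply: nneseries_ge0 => m _ _.
  by apply: nneseries_ge0 => r _ _; exact: cell_ge0.
move=> /existsNP [r0 /not_implyP[r0M /negP]]; rewrite negbK => r0a.
have ex : exists r, (0 < r <= M)%N && (Phi r%:R w == a) by exists r0; rewrite r0M.
case: (ex_minnP ex) => -[|m]; first by rewrite ltnn.
move=> /andP[/andP[_ mM] /eqP ma] mmin.
have hA r : (0 < r <= M)%N -> first_visit m.+1 r (Phi r%:R w).
  move=> /andP[r1 rM]; rewrite /first_visit; case: ltngtP => [rm|mr|->] /=.
  - apply/negP => ra; have := mmin r; rewrite r1 rM ra => /(_ isT).
    by rewrite leqNgt rm.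
  - apply/negP => /eqP rj; apply: hw; exists m.+1, r; split=> //; exact: ltnW.
  - by rewrite ma.
rewrite -(cellE (first_visit m.+1) hA) /dominating; apply: le_trans (leeDr _ _); last first.
  by apply: nneseries_ge0 => i _ _; exact: cell_ge0.
pose F m r := cell (m.+1 + r) (allowed (first_visit m.+1) (m.+1 + r)) (w, t).
have F0 m' r : 0 <= F m' r by exact: cell_ge0.
apply: le_trans (@nneseries_ge_term _ (fun m => \sum_(r <oo) F m r) m _); last first.
  by move=> i; exact: nneseries_ge0.
rewrite -{1 2}(subnKC mM).
exact: (@nneseries_ge_term _ (F m) (M - m.+1)).
Qed.

(** The paths that visit [a] and then [j] at integer times. *)
Definition good := [set w | exists M, completes M (Phi ^~ w)].

Lemma measurable_good : measurable good.
Proof.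
rewrite (_ : good = \bigcup_r \bigcup_q (if (0 < r)%N && (r <= q)%N then
   at_state r%:R a `&` at_state q%:R j else set0)).
  apply: bigcup_measurable => r _; apply: bigcup_measurable => q _.
  by case: ifP => // _; apply: measurableI; exact: (measurable_at_state hPhi).
apply/seteqP; split=> w /=.
  move=> [M [r [q [r0 rq _ ra qj]]]]; exists r => //; exists q => //.
  by rewrite r0 rq; split.
move=> [r _ [q _]]; case: ifP => // /andP[r0 rq] [ra qj].
by exists q, r, q.
Qed.

(** On the other paths, the dominating function is at least [1] at all times, so
    that its integral over time is infinite. *)
Lemma good_ae i : P i (~` good) = 0.
Proof.
have mg : measurable (~` good) by apply: measurableC; exact: measurable_good.
apply/eqP; rewrite eq_le measure_ge0 andbT leNgt; apply/negP => Pg.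
have := integral_dominating i.
rewrite fubini_tonelli1//; [|exact: measurable_dominating|by move=> z; exact: dominating_ge0].
rewrite ltNge leye_eq => /negP; apply; rewrite -leye_eq.
have mF : measurable_fun setT (fubini_F mu dominating).
  apply: measurable_fun_fubini_tonelli_F => //; first exact: measurable_dominating.
  by move=> z; exact: dominating_ge0.
have F0 w : 0 <= fubini_F mu dominating w.
  by apply: integral_ge0 => t _; exact: dominating_ge0.
apply: (@le_trans _ _ (\int[P i]_(w in ~` good) cst +oo w)).
  by rewrite integral_cst// gt0_mulye.
apply: (@le_trans _ _ (\int[P i]_(w in ~` good) fubini_F mu dominating w)); last first.
  exact: ge0_subset_integral.
apply: ge0_le_integral => //.
- by move=> w _; rewrite leey.
- exact: (measurable_funS measurableT (@subsetT _ _) mF).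
move=> w /= wg.
apply: (@le_trans _ _ (\int[mu]_(t in (`[0%R, +oo[%classic : set (measurableTypeR R))) cst 1 t)).
  by rewrite integral_cst//= lebesgue_measure_itv/= ltry mul1e.
have msec : measurable_fun setT (fun t : measurableTypeR R => dominating (w, t)).
  exact: (measurableT_comp measurable_dominating (pair1_measurable w)).
apply: (@le_trans _ _ (\int[mu]_(t in `[0%R, +oo[) dominating (w, t))); last first.
  by apply: ge0_subset_integral => // t _; exact: dominating_ge0.
apply: ge0_le_integral => //; first
  exact: (measurable_funS measurableT (@subsetT _ _) msec).
move=> t /=; rewrite in_itv/= andbT => t0.
apply: le_trans (h1 (Phi t w)) _; apply: dominating_ge => // hc; apply: wg.
by exists (Num.truncn t).
Qed.

End domination.

(** * The q-matrix *)

Section signed_series.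
Local Open Scope ereal_scope.
Context {R : realType}.

(** Rows of the q-matrix and of its products have one term of the opposite sign;
    setting it apart leaves a series of nonnegative terms. *)
Lemma signed_series (f g : nat -> R) (s : R) N i : (N <= i)%N ->
  (forall k, 0 <= g k)%R -> (forall k, k != i -> f k = s * g k)%R ->
  \sum_(N <= k <oo) (f k)%:E =
  (f i)%:E + s%:E * \sum_(k <oo) (if (N <= k)%N && (k != i) then g k else 0%R)%:E.
Proof.
move=> Ni g0 fg; set g' := fun k => (if (N <= k)%N && (k != i) then g k else 0)%R.
have fin M : (i < M)%N ->
    (\sum_(N <= k < M) f k = f i + s * \sum_(0 <= k < M) g' k)%R.
  move=> iM; rewrite (big_nat_widenl N 0)// big_mkcond mulr_sumr/=.
  have -> : f i = (\sum_(0 <= k < M) (if k == i then f i else 0))%R.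
    by rewrite -big_mkcond/= big_nat1_eq/= iM.
  rewrite -big_split/=; apply: eq_bigr => k _; rewrite /g'.
  by have [->|ki] := eqVneq k i; rewrite ?Ni/= ?mulr0 ?addr0// andbT add0r;
    case: ifP => _; rewrite ?mulr0// fg.
apply/cvg_lim => //.
apply: (@cvg_trans _ ((fun M => (f i)%:E + s%:E * \sum_(0 <= k < M) (g' k)%:E) @ \oo)).
  apply: near_eq_cvg; near=> M.
  rewrite !sumEFin fin; last by near: M; exact: nbhs_infty_gt.
  by rewrite EFinD EFinM.
have g'0 k : 0 <= (g' k)%:E by rewrite lee_fin /g'; case: ifP.
apply: cvgeD; [by []|exact: cvg_cst|].
apply: cvgeZl => //; apply: is_cvg_nneseries => k _ _; exact: g'0.
Unshelve. all: by end_near. Qed.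

Lemma cvg_partial_sum (f : nat -> R) N c : (forall k, (N <= k)%N -> 0 <= f k)%R ->
  \sum_(N <= k <oo) (f k)%:E = c%:E ->
  (\sum_(N <= k < M) f k)%R @[M --> \oo] --> c.
Proof.
move=> f0 fc.
have := @is_cvg_nneseries R (EFin \o f) xpredT N (fun k Nk _ => f0 k Nk).
move=> /cvg_ex[l /[dup] hl]; rewrite /= in hl.
have lc : l = c%:E by rewrite -fc; apply/esym/cvg_lim.
rewrite lc => /fine_cvg; apply: cvg_trans; apply: near_eq_cvg; near=> M.
by rewrite /= sumEFin.
Unshelve. all: by end_near. Qed.

Lemma cvg_signed_sum (f : nat -> R) i c : (forall k, k != i -> 0 <= f k)%R ->
  \sum_(k <oo) (if k != i then f k else 0%R)%:E = c%:E ->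
  (\sum_(0 <= k < M) f k)%R @[M --> \oo] --> (f i + c)%R.
Proof.
move=> f0 fc; pose g k := if k != i then f k else 0%R.
have g0 k : (0 <= g k)%R by rewrite /g; case: eqVneq => // ki; exact: f0.
have gc : (\sum_(0 <= k < M) g k)%R @[M --> \oo] --> c.
  exact: (@cvg_partial_sum g 0%N c (fun k _ => g0 k) fc).
have fi : f i @[_ --> \oo] --> f i by exact: cvg_cst.
apply: cvg_trans (cvgD fi gc); apply: near_eq_cvg.
near=> M; have iM : (i < M)%N by near: M; exact: nbhs_infty_gt.
transitivity (f i + \sum_(0 <= k < M) g k)%R; first by [].
have {1}-> : f i = (\sum_(0 <= k < M) (if k == i then f i else 0))%R.
  by rewrite -big_mkcond/= big_nat1_eq/= iM.
rewrite -big_split/=; apply: eq_bigr => k _; rewrite /g.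
by have [->|ki] := eqVneq k i; rewrite /= ?addr0 ?add0r.
Unshelve. all: by end_near. Qed.

End signed_series.

Section q_matrix.
Context {R : realType} d (T : measurableType d).
Variables (P : nat -> probability T R) (Phi : R -> T -> nat) (Q : nat -> nat -> R).
Hypothesis hPhi : markov_chain P Phi Q.

Lemma qmatrix_ge0 i k : i != k -> 0 <= Q i k.
Proof.
move=> /negPf ik; have h := @mc_qmatrix _ _ _ _ _ _ hPhi i k.
rewrite -(cvg_lim _ h)//; apply: limr_ge; first by apply/cvg_ex; exists (Q i k).
near=> t; rewrite ik subr0 divr_ge0// fine_ge0//.
Unshelve. all: by end_near. Qed.

Lemma qmatrix_le0 i : Q i i <= 0.
Proof.
have h := @mc_qmatrix _ _ _ _ _ _ hPhi i i.
rewrite -(cvg_lim _ h)//; apply: limr_le; first by apply/cvg_ex; exists (Q i i).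
near=> t; have t0 : 0 < t by near: t; exact: nbhs_right_gt.
rewrite eqxx pmulr_lle0 ?invr_gt0// subr_le0 -lee_fin fineK.
  by apply: probability_le1; exact/(measurable_at_state hPhi)/ltW.
by apply: fin_num_measure; exact/(measurable_at_state hPhi)/ltW.
Unshelve. all: by end_near. Qed.

End q_matrix.

(** * The minimal inverse and harmonic extensions *)

Section minimal_inverse.
Local Open Scope ereal_scope.
Context {R : realType}.
Variables (Q X : nat -> nat -> R) (n : nat).
Hypothesis Q0 : forall i k, i != k -> (0 <= Q i k)%R.
Hypothesis Qd : forall i, (Q i i <= 0)%R.
Hypothesis Qcons : conservative Q.
Hypothesis hX : minimal_nonneg_inverse n Q X.

Let q i : R := (- Q i i)%R.

Let offd i k : R := if k != i then Q i k else 0%R.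

Let offd_ge0 i k : (0 <= offd i k)%R.
Proof. by rewrite /offd; case: eqVneq => //= ki; rewrite Q0// eq_sym. Qed.

Lemma sum_rates i : \sum_(k <oo) (if k != i then Q i k else 0%R)%:E = (- Q i i)%:E.
Proof.
have := Qcons i; rewrite (@signed_series _ _ (offd i) 1%R 0%N i)//; last first.
  by move=> k ki; rewrite /offd ki mul1r.
rewrite mul1e => h.
have e : \sum_(k <oo) (if (0 <= k)%N && (k != i) then offd i k else 0%R)%:E =
    \sum_(k <oo) (if k != i then Q i k else 0%R)%:E.
  by apply: eq_eseriesr => k _; rewrite /offd; case: eqVneq.
move: h; rewrite e; case: (\sum_(k <oo) _) => [r| |]//= [hr].
by congr EFin; lra.
Qed.

(** The transition matrix of the jump chain killed on entering [{0, ..., n}]. *)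
Let J k m : R := if [&& (n < k)%N, (n < m)%N & m != k] then (Q k m / q k)%R else 0%R.

Let q_ge0 k : (0 <= q k)%R. Proof. by rewrite oppr_ge0. Qed.

Let J_ge0 k m : (0 <= J k m)%R.
Proof.
by rewrite /J; case: ifP => // /and3P[_ _ mk]; rewrite divr_ge0// Q0// eq_sym.
Qed.

Let inverse_backward (Y : nat -> nat -> R) k l : (n < k)%N ->
  (forall m, (n < m)%N -> 0 <= Y m l)%R ->
  \sum_(n.+1 <= m <oo) (- Q k m * Y m l)%:E =
  (q k * Y k l)%:E - \sum_(m <oo) (if [&& (n < k)%N, (n < m)%N & m != k]
     then Q k m * Y m l else 0%R)%:E.
Proof.
move=> nk Y0; pose g m : R := if [&& (n < m)%N & m != k] then (Q k m * Y m l)%R else 0%R.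
have g0 m : (0 <= g m)%R.
  by rewrite /g; case: ifP => // /andP[nm mk]; rewrite mulr_ge0 ?Y0// Q0// eq_sym.
pose f m : R := if (n < m)%N then (- Q k m * Y m l)%R else 0%R.
transitivity (\sum_(n.+1 <= m <oo) (f m)%:E).
  by rewrite eseries_cond [RHS]eseries_cond; apply: eq_eseriesr => m /=; rewrite /f => ->.
rewrite (@signed_series _ f g (-1)%R _ k)//; last first.
  move=> m mk; rewrite /f /g mk andbT; case: ifP => _; rewrite ?mulr0//.
  by rewrite mulN1r mulNr.
rewrite /f nk EFinN mulN1e; congr (_ - _); apply: eq_eseriesr => m _.
by rewrite /g /=; case: ifP => //= /andP[-> ->].
Qed.

Let inverse_forward (Y : nat -> nat -> R) k l : (n < l)%N ->
  (forall m, (n < m)%N -> 0 <= Y k m)%R ->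
  \sum_(n.+1 <= m <oo) (Y k m * - Q m l)%:E =
  (Y k l * q l)%:E - \sum_(m <oo) (if [&& (n < m)%N, (n < l)%N & l != m]
     then Y k m * Q m l else 0%R)%:E.
Proof.
move=> nl Y0; pose g m : R := if [&& (n < m)%N & m != l] then (Y k m * Q m l)%R else 0%R.
have g0 m : (0 <= g m)%R.
  by rewrite /g; case: ifP => // /andP[nm mk]; rewrite mulr_ge0 ?Y0// Q0// eq_sym.
pose f m : R := if (n < m)%N then (Y k m * - Q m l)%R else 0%R.
transitivity (\sum_(n.+1 <= m <oo) (f m)%:E).
  by rewrite eseries_cond [RHS]eseries_cond; apply: eq_eseriesr => m /=; rewrite /f => ->.
rewrite (@signed_series _ f g (-1)%R _ l)//; last first.
  move=> m mk; rewrite /f /g mk andbT; case: ifP => _; rewrite ?mulr0//.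
  by rewrite mulN1r mulrN.
rewrite /f nl EFinN mulN1e; congr (_ - _); apply: eq_eseriesr => m _.
rewrite /g /= (eq_sym l m) andbC.
by case: (_ && _).
Qed.

Let X_ge0 k l : (n < k)%N -> (n < l)%N -> (0 <= X k l)%R.
Proof. by move=> nk nl; have [/(_ k l nk nl)[]] := hX. Qed.

(** A row of [Q] with zero diagonal is zero by conservativity, and then it has no
    right inverse. *)
Let q_gt0 k : (n < k)%N -> (0 < q k)%R.
Proof.
move=> nk; rewrite lt_neqAle q_ge0 andbT; apply/eqP => q0.
have Qk0 m : Q k m = 0%R.
  have [->|mk] := eqVneq m k; first by apply/eqP; rewrite -oppr_eq0 -/(q k) -q0.
  have := sum_rates k; rewrite -/(q k) -q0 => h.
  have := @nneseries_ge_term _ (fun m => (if m != k then Q k m else 0%R)%:E) m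
    (fun m => offd_ge0 k m).
  rewrite h mk lee_fin => Qle; apply/eqP; rewrite eq_le Qle Q0//.
  by rewrite eq_sym.
have [/(_ k k nk nk)[_ + _] _] := hX.
rewrite eseries0; first by rewrite eqxx => -[] /esym /eqP; rewrite oner_eq0.
by move=> m _ _; rewrite Qk0 oppr0 mul0r.
Qed.

Let Fixpoint pw (r : nat) (k l : nat) : \bar R :=
  if r is r'.+1 then \sum_(m <oo) (J k m)%:E * pw r' m l else (k == l)%:R%:E.

Let pw_ge0 r k l : 0 <= pw r k l.
Proof.
elim: r k => [|r IH] k /=; first by rewrite lee_fin ler0n.
by apply: nneseries_ge0 => m _ _; rewrite mule_ge0// lee_fin.
Qed.

Let pwSr r k l : pw r.+1 k l = \sum_(m <oo) pw r k m * (J m l)%:E.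
Proof.
elim: r k l => [|r IH] k l.
  rewrite /= (@nneseriesD1 _ _ l xpredT)//; last first.
    by move=> m _; rewrite mule_ge0// lee_fin// ler0n.
  rewrite eqxx mule1 eseries0 ?adde0; last by move=> m _ /= /negPf ->; rewrite mule0.
  rewrite (@nneseriesD1 _ _ k xpredT)//; last first.
    by move=> m _; rewrite mule_ge0// lee_fin// ler0n.
  rewrite eqxx mul1e eseries0 ?adde0// => m _ /=.
  by rewrite eq_sym => /negPf ->; rewrite mul0e.
transitivity (\sum_(m <oo) \sum_(m' <oo) (J k m)%:E * (pw r m m' * (J m' l)%:E)).
  apply: eq_eseriesr => m _; rewrite nneseriesZl_ge0 ?lee_fin//; last first.
    by move=> m'; rewrite mule_ge0// lee_fin.
  by rewrite -IH.
rewrite nneseries_interchange; last by move=> m m'; rewrite !mule_ge0// lee_fin.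
apply: eq_eseriesr => m' _; rewrite [RHS]muleC -nneseriesZl_ge0 ?lee_fin//; last first.
  by move=> m; rewrite mule_ge0// lee_fin.
by apply: eq_eseriesr => m _; rewrite muleA [RHS]muleC.
Qed.

(** The sum of the powers of [J], times the mean holding times: the expected time
    spent in [l] before hitting [{0, ..., n}]. *)
Let neumann k l := \sum_(r <oo) pw r k l * (q l)^-1%:E.

Let qV_ge0 l : 0 <= (q l)^-1%:E :> \bar R.
Proof. by rewrite lee_fin invr_ge0. Qed.

Let neumann_ge0 k l : 0 <= neumann k l.
Proof. by apply: nneseries_ge0 => r _ _; rewrite mule_ge0. Qed.

Let neumann_step (u : nat -> \bar R) : (forall r, 0 <= u r) ->
  \sum_(r <oo) u r = u 0%N + \sum_(r <oo) u r.+1.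
Proof.
move=> u0; rewrite nneseries_recl//; congr (_ + _).
by rewrite -nneseries_addn//; apply: eq_eseriesr => r _; rewrite addn1.
Qed.

Let neumann_backward k l :
  neumann k l = (k == l)%:R%:E * (q l)^-1%:E + \sum_(m <oo) (J k m)%:E * neumann m l.
Proof.
rewrite /neumann neumann_step; last by move=> r; rewrite mule_ge0.
congr (_ + _).
transitivity (\sum_(m <oo) \sum_(r <oo) (J k m)%:E * (pw r m l * (q l)^-1%:E)).
  rewrite nneseries_interchange; last by move=> m r; rewrite !mule_ge0// lee_fin.
  apply: eq_eseriesr => r _ /=; rewrite muleC -nneseriesZl_ge0//; last first.
    by move=> m; rewrite mule_ge0// lee_fin.
  by apply: eq_eseriesr => m _; rewrite muleC muleA.
apply: eq_eseriesr => m _; rewrite nneseriesZl_ge0 ?lee_fin// => r.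
by rewrite mule_ge0.
Qed.

Let neumann_forward k l : (n < l)%N ->
  neumann k l * (q l)%:E =
  (k == l)%:R%:E + \sum_(m <oo) neumann k m * (q m)%:E * (J m l)%:E.
Proof.
move=> nl.
have qq m : (n < m)%N -> (q m)^-1%:E * (q m)%:E = 1.
  by move=> nm; rewrite -EFinM mulVf// gt_eqF// q_gt0.
have nq m : (n < m)%N -> neumann k m * (q m)%:E = \sum_(r <oo) pw r k m.
  move=> nm; rewrite muleC -nneseriesZl_ge0 ?lee_fin//; last first.
    by move=> r; rewrite mule_ge0.
  by apply: eq_eseriesr => r _; rewrite muleC -muleA qq// mule1.
rewrite nq// neumann_step//; congr (_ + _).
transitivity (\sum_(m <oo) \sum_(r <oo) pw r k m * (J m l)%:E).
  rewrite [RHS]nneseries_interchange; last by move=> m r; rewrite mule_ge0// lee_fin.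
  by apply: eq_eseriesr => r _; exact: pwSr.
apply: eq_eseriesr => m _.
have [nm|mn] := ltnP n m.
  rewrite nq// muleC -nneseriesZl_ge0 ?lee_fin//.
  by apply: eq_eseriesr => r _; rewrite muleC.
rewrite /J ltnNge mn/= mule0 eseries0// => r _ _.
by rewrite mule0.
Qed.

Let X_backward k l : (n < k)%N -> (n < l)%N ->
  (X k l)%:E = (k == l)%:R%:E * (q l)^-1%:E +
    \sum_(m <oo) (J k m)%:E * (if (n < m)%N then X m l else 0%R)%:E.
Proof.
move=> nk nl; have [/(_ k l nk nl)[_ + _] _] := hX.
rewrite inverse_backward//; last by move=> m nm; exact: X_ge0.
set S := \sum_(m <oo) _ => h.
have qk : (q k)%:E != 0 by rewrite eqe gt_eqF// q_gt0.
have -> : \sum_(m <oo) (J k m)%:E * (if (n < m)%N then X m l else 0%R)%:E =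
    (q k)^-1%:E * S.
  rewrite -nneseriesZl_ge0//; last first.
    move=> m; rewrite lee_fin; case: ifP => // /and3P[_ nm mk].
    by rewrite mulr_ge0 ?X_ge0// Q0// eq_sym.
  apply: eq_eseriesr => m _; rewrite /J -!EFinM; congr EFin.
  case: ifP => [/and3P[_ -> _]|_]; last by rewrite mul0r mulr0.
  by ring.
move: h; case: S => [s| |]//= [] h; rewrite -!EFinM -EFinD; congr EFin.
have qk0 : q k != 0%R by rewrite gt_eqF// q_gt0.
have -> : ((k == l)%:R * (q l)^-1 = (k == l)%:R * (q k)^-1)%R.
  by case: eqVneq => [->//|_]; rewrite !mul0r.
by rewrite -h; field.
Qed.

(** The partial sums stay below any nonnegative right inverse, by induction. *)
Let neumann_le k l : (n < k)%N -> (n < l)%N -> neumann k l <= (X k l)%:E.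
Proof.
move=> nk nl.
suff h M k' : (n < k')%N -> \sum_(0 <= r < M) pw r k' l * (q l)^-1%:E <= (X k' l)%:E.
  apply: lime_le; last by apply: nearW => M; exact: h.
  by apply: is_cvg_nneseries => r _ _; rewrite mule_ge0.
elim: M k' => [|M IH] k' nk'; first by rewrite big_geq// lee_fin X_ge0.
rewrite big_nat_recl// X_backward// leeD2l//.
apply: (@le_trans _ _ (\sum_(m <oo) (J k' m)%:E *
    \sum_(0 <= r < M) pw r m l * (q l)^-1%:E)).
  apply: (@le_trans _ _ (\sum_(m <oo) \sum_(0 <= r < M)
      (J k' m)%:E * (pw r m l * (q l)^-1%:E))).
    rewrite nneseries_sum_nat; last by move=> m r; rewrite !mule_ge0// lee_fin.
    apply: lee_sum => r _ /=; rewrite muleC -nneseriesZl_ge0//; last first.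
      by move=> m; rewrite mule_ge0// lee_fin.
    rewrite le_eqVlt; apply/orP; left; apply/eqP.
    by apply: eq_eseriesr => m _; rewrite muleC muleA.
  rewrite le_eqVlt; apply/orP; left; apply/eqP.
  by apply: eq_eseriesr => m _; rewrite ge0_sume_distrr// => r _; rewrite mule_ge0.
apply: lee_nneseries => [m _ _|m _].
  by rewrite mule_ge0 ?lee_fin// sume_ge0// => r _; rewrite mule_ge0.
have [nm|mn] := ltnP n m; first by rewrite lee_wpmul2l ?lee_fin// IH.
by rewrite /J (ltnNge n m) mn andbF mul0e mul0e.
Qed.

Let neumann_fin k l : (n < k)%N -> (n < l)%N -> neumann k l \is a fin_num.
Proof.
move=> nk nl; rewrite ge0_fin_numE//.
by rewrite (le_lt_trans (neumann_le nk nl))// ltry.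
Qed.

(** The Neumann series is finite, being below [X], and is itself a nonnegative
    two-sided inverse, so that minimality gives the other inequality. *)
Lemma inverse_neumann k l : (n < k)%N -> (n < l)%N -> (X k l)%:E = neumann k l.
Proof.
move=> nk nl; apply/eqP; rewrite eq_le neumann_le// andbT.
rewrite -[leRHS]fineK ?neumann_fin// lee_fin.
have [_ hmin] := hX; apply: (hmin (fun k l => fine (neumann k l))) => // {nk nl l k}.
move=> k l nk nl; have Y0 m m' : (0 <= fine (neumann m m'))%R by rewrite fine_ge0.
split=> //.
- rewrite (@inverse_backward (fun k l => fine (neumann k l)) k l)//=.
  have h := neumann_backward k l.
  set S := \sum_(m <oo) _.
  have -> : S = (q k)%:E * \sum_(m <oo) (J k m)%:E * neumann m l.
    rewrite -nneseriesZl_ge0 ?lee_fin//; last by move=> m; rewrite mule_ge0// lee_fin.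
    apply: eq_eseriesr => m _; rewrite /J; case: ifP => [/and3P[_ nm _]|_]; last first.
      by rewrite mul0e mule0.
    rewrite muleA -EFinM (mulrC (q k)) divfK ?gt_eqF ?q_gt0// EFinM fineK//.
    exact: neumann_fin.
  have fS : \sum_(m <oo) (J k m)%:E * neumann m l \is a fin_num.
    rewrite ge0_fin_numE; last first.
      by apply: nneseries_ge0 => m _ _; rewrite mule_ge0// lee_fin.
    apply: (@le_lt_trans _ _ (neumann k l)); last by rewrite -ge0_fin_numE// neumann_fin.
    by rewrite h leeDr// mule_ge0// lee_fin ler0n.
  rewrite EFinM fineK ?neumann_fin// h -(fineK fS).
  set f := fine _; rewrite -!(EFinM, EFinD, EFinN).
  congr EFin.
  have qk0 : q k != 0%R by rewrite gt_eqF// q_gt0.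
  have -> : ((k == l)%:R * (q l)^-1 = (k == l)%:R * (q k)^-1)%R.
    by case: eqVneq => [->//|_]; rewrite !mul0r.
  by field.
- rewrite (@inverse_forward (fun k l => fine (neumann k l)) k l)//=.
  have h := neumann_forward k nl.
  set S := \sum_(m <oo) _.
  have SE : S = \sum_(m <oo) neumann k m * (q m)%:E * (J m l)%:E.
    apply: eq_eseriesr => m _; rewrite /J; case: ifP => [/and3P[nm _ _]|_]; last first.
      by rewrite mule0.
    rewrite -muleA -EFinM (mulrC (q m)) divfK ?gt_eqF ?q_gt0// EFinM fineK//.
    exact: neumann_fin.
  rewrite EFinM fineK ?neumann_fin// h SE.
  rewrite addeK// ge0_fin_numE; last first.
    by apply: nneseries_ge0 => m _ _; rewrite !mule_ge0// lee_fin.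
  apply: (@le_lt_trans _ _ (neumann k l * (q l)%:E)).
    by rewrite h leeDr// lee_fin ler0n.
  by rewrite -(fineK (neumann_fin nk nl)) -EFinM ltry.
Qed.

(** [b m / q m] is the probability that the jump chain enters [{0, ..., n}] from
    [m] at its next step; the sum of these over a path of the killed chain is at
    most [1], which is the content of [sum_z_le1]. *)
Let b m : R := if (n < m)%N then (\sum_(k < n.+1) Q m k)%R else 0%R.

Let Qout_ge0 m (k : 'I_n.+1) : (n < m)%N -> (0 <= Q m k)%R.
Proof. by move=> nm; rewrite Q0// gtn_eqF// (leq_trans (ltn_ord k)). Qed.

Let b_ge0 m : (0 <= b m)%R.
Proof. by rewrite /b; case: ifP => // nm; apply: sumr_ge0 => k _; exact: Qout_ge0. Qed.

Let exit_or_stay m : (b m / q m)%:E + \sum_(k <oo) (J m k)%:E <= 1.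
Proof.
have [nm|mn] := ltnP n m; last first.
  rewrite /b ltnNge mn mul0r add0e eseries0 => [|k _ _]; first exact: lee01.
  by rewrite /J ltnNge mn.
have qm0 : q m != 0%R by rewrite gt_eqF// q_gt0.
have -> : \sum_(k <oo) (J m k)%:E =
    (q m)^-1%:E * \sum_(n.+1 <= k <oo) (if k != m then Q m k else 0%R)%:E.
  rewrite [in RHS]eseries_cond -nneseriesZl; last by move=> k _; exact: offd_ge0.
  rewrite [RHS]eseries_mkcond; apply: eq_eseriesr => k _; rewrite /J nm /=.
  by case: (ltnP n k) => //= _; case: eqVneq => //= _; rewrite -?EFinM ?mulr0// mulrC.
have := sum_rates m; rewrite (@nneseries_split _ _ 0%N n.+1)//; last first.
  by move=> k _; exact: offd_ge0.
rewrite add0n -/(q m).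
have -> : \sum_(0 <= k < n.+1) (if k != m then Q m k else 0%R)%:E = (b m)%:E.
  rewrite /b nm big_mkord sumEFin; congr EFin; apply: eq_bigr => k _.
  by rewrite ltn_eqF// (leq_trans (ltn_ord k)).
move=> h; rewrite mulrC EFinM -muleDr//.
  by rewrite h -EFinM mulVf.
Qed.

Let z r k := \sum_(m <oo) pw r k m * (b m / q m)%:E.

Let c_ge0 m : 0 <= (b m / q m)%:E :> \bar R.
Proof. by rewrite lee_fin divr_ge0. Qed.

Let z_ge0 r k : 0 <= z r k.
Proof. by apply: nneseries_ge0 => m _ _; rewrite mule_ge0. Qed.

Let z0 k : z 0 k = (b k / q k)%:E.
Proof.
rewrite /z (@nneseriesD1 _ _ k xpredT)//; last by move=> m _; rewrite mule_ge0.
rewrite /= eqxx mul1e eseries0 ?adde0// => m _ /=.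
by rewrite eq_sym => /negPf ->; rewrite mul0e.
Qed.

Let zS r k : z r.+1 k = \sum_(m <oo) (J k m)%:E * z r m.
Proof.
transitivity (\sum_(m <oo) \sum_(m' <oo) (J k m)%:E * (pw r m m' * (b m' / q m')%:E)).
  rewrite [RHS]nneseries_interchange; last first.
    by move=> m m'; rewrite !mule_ge0// lee_fin.
  apply: eq_eseriesr => m' _ /=; rewrite muleC -nneseriesZl_ge0//; last first.
    by move=> m; rewrite mule_ge0// lee_fin.
  by apply: eq_eseriesr => m _; rewrite muleC muleA.
apply: eq_eseriesr => m _; rewrite nneseriesZl_ge0 ?lee_fin// => m'.
by rewrite mule_ge0.
Qed.

Let sum_z_le1 M k : \sum_(0 <= r < M) z r k <= 1.
Proof.
elim: M k => [|M IH] k; first by rewrite big_geq// lee01.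
rewrite big_nat_recl// z0; apply: le_trans (exit_or_stay k); rewrite leeD2l//.
apply: (@le_trans _ _ (\sum_(m <oo) (J k m)%:E * \sum_(0 <= r < M) z r m)).
  rewrite le_eqVlt; apply/orP; left; apply/eqP.
  under eq_bigr do rewrite zS.
  rewrite -nneseries_sum_nat; last by move=> m r; rewrite mule_ge0// lee_fin.
  by apply: eq_eseriesr => m _; rewrite ge0_sume_distrr.
apply: lee_nneseries => m *; first by rewrite mule_ge0 ?lee_fin// sume_ge0.
by rewrite -[leRHS]mule1 lee_wpmul2l// lee_fin.
Qed.

(** [W l i] is the probability of entering [{0, ..., n}] through [i] from [l]. *)
Let W l i := \sum_(m <oo) (if (n < m)%N then (X l m * Q m i)%R else 0%R)%:E.

Let XQ_ge0 l (i : 'I_n.+1) m : (n < l)%N ->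
  (0 <= if (n < m)%N then X l m * Q m i else 0)%R.
Proof. by move=> nl; case: ifP => // nm; rewrite mulr_ge0 ?X_ge0 ?Qout_ge0. Qed.

Let W_ge0 l (i : 'I_n.+1) : (n < l)%N -> 0 <= W l i.
Proof. by move=> nl; apply: nneseries_ge0 => m _ _; rewrite lee_fin; exact: XQ_ge0. Qed.

Let sum_W l : (n < l)%N -> \sum_(i < n.+1) W l i <= 1.
Proof.
move=> nl; rewrite -nneseries_sum; last by move=> i m _; rewrite lee_fin; exact: XQ_ge0.
have -> : \sum_(m <oo) \sum_(i < n.+1) (if (n < m)%N then (X l m * Q m i)%R else 0%R)%:E =
    \sum_(r <oo) z r l.
  rewrite nneseries_interchange; last by move=> r m; rewrite mule_ge0.
  apply: eq_eseriesr => m _; have [nm|mn] := ltnP n m; last first.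
    rewrite big1 ?eseries0// => r _ _.
    by rewrite /b ltnNge mn mul0r mule0.
  rewrite sumEFin -mulr_sumr.
  transitivity ((b m)%:E * (X l m)%:E); first by rewrite -EFinM mulrC /b nm.
  rewrite inverse_neumann// -nneseriesZl_ge0 ?lee_fin//; last first.
    by move=> r; rewrite mule_ge0.
  by apply: eq_eseriesr => r _; rewrite muleCA -EFinM.
apply: lime_le; last by apply: nearW => M; exact: sum_z_le1.
exact: is_cvg_nneseries.
Qed.

Let W_le1 l (i : 'I_n.+1) : (n < l)%N -> W l i <= 1.
Proof.
move=> nl; apply: le_trans (sum_W nl); rewrite (bigD1 i)//= leeDl// sume_ge0// => k _.
exact: W_ge0.
Qed.

Let W_fin l (i : 'I_n.+1) : (n < l)%N -> W l i \is a fin_num.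
Proof.
by move=> nl; rewrite ge0_fin_numE ?W_ge0// (le_lt_trans (W_le1 i nl))// ltry.
Qed.

Let W_eq l (i : 'I_n.+1) : (n < l)%N ->
  W l i = (Q l i / q l)%:E + \sum_(k <oo) (J l k)%:E * (if (n < k)%N then W k i else 0).
Proof.
move=> nl.
pose V k m := (if (n < k)%N && (n < m)%N then (X k m * Q m i)%R else 0%R)%:E.
have V0 k m : 0 <= V k m.
  rewrite lee_fin; case: ifP => // /andP[nk nm].
  by rewrite mulr_ge0 ?X_ge0 ?Qout_ge0.
transitivity (\sum_(m <oo) (((if m == l then (Q l i / q l)%R else 0%R)%:E +
    \sum_(k <oo) (J l k)%:E * V k m))).
  apply: eq_eseriesr => m _; have [nm|mn] := ltnP n m; last first.
    rewrite (_ : (m == l) = false) ?ltn_eqF//; last exact: leq_ltn_trans mn nl.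
    by rewrite eseries0 ?adde0// => k _ _; rewrite /V (ltnNge n m) mn andbF mule0.
  rewrite EFinM X_backward// muleC muleDr; last first.
    rewrite ge0_adde_def// inE; first by rewrite mule_ge0// lee_fin ler0n.
    apply: nneseries_ge0 => k _ _; rewrite mule_ge0 ?lee_fin//.
    by case: ifP => // nk; exact: X_ge0.
  - by [].
  congr (_ + _).
    rewrite (eq_sym l); have [->|_] := eqVneq m l; last by rewrite mul0e mule0.
    by rewrite mul1e -EFinM.
  rewrite -nneseriesZl_ge0 ?lee_fin ?Qout_ge0//; last first.
    move=> k; rewrite mule_ge0 ?lee_fin//.
    by case: ifP => // nk; exact: X_ge0.
  apply: eq_eseriesr => k _; rewrite /V nm andbT muleCA; congr (_ * _).
  by case: ifP => _; rewrite -EFinM ?mulr0// mulrC.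
rewrite nneseriesD; first last.
- by move=> m _ _; apply: nneseries_ge0 => k _ _; rewrite mule_ge0// lee_fin.
- by move=> m _ _; case: ifP => // _; rewrite lee_fin divr_ge0// Qout_ge0.
congr (_ + _).
  rewrite (@nneseriesD1 _ _ l xpredT)//; last first.
    by move=> m _; case: ifP => // _; rewrite lee_fin divr_ge0// Qout_ge0.
  by rewrite eqxx eseries0 ?adde0// => m _ /= /negPf ->.
rewrite nneseries_interchange; last by move=> m k; rewrite mule_ge0// lee_fin.
apply: eq_eseriesr => k _; rewrite nneseriesZl_ge0 ?lee_fin//; congr (_ * _).
rewrite /V; case: ifP => nk; last by rewrite eseries0.
by apply: eq_eseriesr => m _.
Qed.

Let w i l : R := if (l <= n)%N then (l == i)%:R%R else fine (W l i).

Let w_ge0 (i : 'I_n.+1) l : (0 <= w i l)%R.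
Proof. by rewrite /w; case: leqP => [_|nl]; [exact: ler0n|rewrite fine_ge0// W_ge0]. Qed.

Let fineW (i : 'I_n.+1) l : (n < l)%N -> (w i l)%:E = W l i.
Proof. by move=> nl; rewrite /w leqNgt nl/= fineK// W_fin. Qed.

(** [w i] extends the indicator of [i] beyond [n] by the probabilities of entering
    [{0, ..., n}] through [i].  It is killed by [Q] beyond [n], and the row [k] of
    [Q] applied to it is the entry [(k, i)] of the censored generator, whose excursion
    term is [sum_l Q k l * W l i]. *)
Lemma harmonic_extension : exists w : 'I_n.+1 -> nat -> R,
  [/\ forall i l, (0 <= w i l)%R,
      forall l, (n < l)%N -> (\sum_i w i l <= 1)%R,
      forall i l, (l <= n)%N -> w i l = (l == i)%:R%R &
      forall i k, (\sum_(0 <= l < M) Q k l * w i l)%R @[M --> \oo] -->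
        (if (k <= n)%N then censored_generator n Q X (inord k) i else 0%R)].
Proof.
exists (fun i : 'I_n.+1 => w i); split=> //.
- move=> l nl; rewrite -lee_fin -sumEFin.
  by under eq_bigr do rewrite fineW//; exact: sum_W.
- by move=> i l ln; rewrite /w ln.
move=> i k; have [kn|nk] := leqP k n; last first.
  pose c : R := (q k * w i k)%R.
  rewrite [X in _ --> X](_ : _ = Q k k * w i k + c)%R; last by rewrite /c /q; ring.
  apply: (@cvg_signed_sum _ (fun l => Q k l * w i l)%R).
    by move=> l lk; rewrite mulr_ge0// Q0// eq_sym.
  rewrite /c EFinM fineW// W_eq// muleDr//.
  have qk0 : q k != 0%R by rewrite gt_eqF// q_gt0.
  rewrite -EFinM (mulrC (q k)) divfK//.
  rewrite (@nneseries_split _ _ 0%N n.+1); last first.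
    move=> l _; rewrite lee_fin; case: eqVneq => //= lk.
    by rewrite mulr_ge0// Q0// eq_sym.
  rewrite add0n; congr (_ + _).
    rewrite sumEFin big_mkord (bigD1 i)//= big1 => [|l /negPf li].
      by rewrite /w -ltnS ltn_ord eqxx mulr1 addr0 ltn_eqF// (leq_trans (ltn_ord i)).
    by rewrite /w -ltnS ltn_ord (_ : (l == i :> nat) = false)// mulr0; case: ifP.
  rewrite eseries_cond eseries_mkcond -nneseriesZl_ge0 ?lee_fin//; last first.
    move=> l; rewrite mule_ge0 ?lee_fin//.
    by case: ifP => // nl; exact: W_ge0.
  apply: eq_eseriesr => l _; rewrite /J nk /= muleA -EFinM.
  case: (ltnP n l) => //= nl; last by rewrite mulr0 mul0e.
  case: eqVneq => //= lk; first by rewrite mulr0 mul0e.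
  by rewrite (mulrC (q k)) divfK// EFinM fineW.
set S := \sum_(n.+1 <= l <oo) (Q k l * w i l)%:E.
have QW0 l : (n < l)%N -> (0 <= Q k l * w i l)%R.
  by move=> nl; rewrite mulr_ge0// Q0// ltn_eqF// (leq_ltn_trans kn).
have S0 : 0 <= S.
  by apply: nneseries_ge0 => l nl _; rewrite lee_fin QW0.
have Sfin : S \is a fin_num.
  rewrite ge0_fin_numE//; apply: (@le_lt_trans _ _ (q k)%:E); last exact: ltry.
  rewrite -sum_rates /S eseries_cond eseries_mkcond; apply: lee_nneseries => [l _ _|l _].
    by rewrite /=; case: ifP => // nl; rewrite lee_fin QW0.
  rewrite /=; case: ifP => nl; last exact: offd_ge0.
  rewrite gtn_eqF/= ?lee_fin; last exact: leq_ltn_trans kn nl.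
  rewrite -[leRHS]mulr1 ler_wpM2l//; first by rewrite Q0// ltn_eqF// (leq_ltn_trans kn).
  by rewrite -lee_fin fineW// W_le1.
have -> : censored_generator n Q X (inord k) i = (Q k i + fine S)%R.
  rewrite mxE inordK//; congr (_ + fine _)%R.
  rewrite /S eseries_cond [RHS]eseries_cond; apply: eq_eseriesr => l /= nl.
  rewrite EFinM fineW// /W -nneseriesZl_ge0//; last first.
  - by move=> m; rewrite lee_fin; exact: XQ_ge0.
  - by rewrite lee_fin Q0// ltn_eqF// (leq_ltn_trans kn).
  rewrite eseries_cond eseries_mkcond; apply: eq_eseriesr => m _ /=.
  by case: ifP => nm; rewrite -EFinM ?mulr0// mulrA.
have wi : w i i = 1%R by rewrite /w -ltnS ltn_ord eqxx.
have w0 l : (l <= n)%N -> l != i -> w i l = 0%R by rewrite /w => -> /negPf ->.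
rewrite -[Q k i]mulr1 -wi.
apply: (@cvg_signed_sum _ (fun l => Q k l * w i l)%R i).
  by move=> l li; have [ln|nl] := leqP l n; [rewrite w0// mulr0|exact: QW0].
rewrite fineK// (@nneseries_split _ _ 0%N n.+1); last first.
  move=> l _; rewrite lee_fin; case: eqVneq => //= li.
  by have [ln|nl] := leqP l n; [rewrite w0// mulr0|exact: QW0].
rewrite add0n sumEFin big_mkord big1 ?add0e => [|l _]; last first.
  by case: eqVneq => //= li; rewrite w0// ?mulr0// -ltnS.
rewrite /S eseries_cond [RHS]eseries_cond; apply: eq_eseriesr => l /= nl.
by rewrite gtn_eqF// (leq_trans (ltn_ord i)).
Qed.

End minimal_inverse.

(** * The inequality of Dynkin *)

Section bounded_range.
Context {R : realType}.
Implicit Type X : R -> nat.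

Lemma jump_time_ge0 X m : (0 <= jump_time X m)%E.
Proof.
elim: m => [//|m IH]; rewrite /jump_time iterS -/(jump_time X m).
case: (jump_time X m) IH => [r| |]//=; rewrite lee_fin => r0.
by apply: le_ereal_inf_tmp => _ [t /= [rt _] <-]; rewrite lee_fin (le_trans r0).
Qed.

(** The path is constant between two jump times, so it takes at most [m] values
    before the [m]-th one. *)
Lemma bounded_before_jump X m : exists K, forall s : R, 0 <= s ->
  (s%:E < jump_time X m)%E -> (X s <= K)%N.
Proof.
elim: m => [|m [K hK]]; first by exists 0%N => s s0; rewrite /jump_time/= lte_fin ltNge s0.
rewrite /jump_time iterS -/(jump_time X m).
have := jump_time_ge0 X m; case: (jump_time X m) hK => [r| |]//= hK r0; last first.
  by exists K => s s0 _; apply: hK => //; exact: ltry.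
exists (maxn K (X r)) => s s0 sJ; have [sr|rs] := ltP s r.
  by rewrite leq_max hK// lte_fin.
suff -> : X s = X r by rewrite leq_maxr.
apply: contrapT => Xs; move: sJ; rewrite ltNge => /negP; apply.
by apply: ereal_inf_lbound; exists s.
Qed.

Lemma bounded_range X t : jump_time X m @[m --> \oo] --> +oo%E ->
  exists K, forall s, 0 <= s -> s <= t -> (X s <= K)%N.
Proof.
move=> /cvgey_gt /(_ t) [m _ hm]; have [K hK] := bounded_before_jump X m.
exists K => s s0 st; apply: hK => //.
by apply: le_lt_trans (hm m _); rewrite ?lee_fin//=.
Qed.

End bounded_range.

Section dynkin.
Context {R : realType} d (T : measurableType d).
Variables (P : nat -> probability T R) (Phi : R -> T -> nat) (Q : nat -> nat -> R).
Hypothesis hPhi : markov_chain P Phi Q.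
Hypothesis hexpl : non_explosive P Phi.
Local Notation at_state := (at_state Phi).

Definition tprob t i k : R := fine (P i (at_state t k)).

Lemma tprobE t i k : 0 <= t -> (tprob t i k)%:E = P i (at_state t k).
Proof. by move=> t0; rewrite fineK//; apply: fin_num_measure; exact: (measurable_at_state hPhi). Qed.

Lemma tprob_ge0 t i k : 0 <= tprob t i k.
Proof. by rewrite fine_ge0. Qed.

(** Only the times commensurable with [t] matter: they contain all the grids of
    mesh [t / N.+1], and there are countably many of them. *)
Definition exits (t : R) (M : nat) := [set w | exists N r : nat,
  (r <= N.+1)%N /\ (M < Phi (r%:R * (t / N.+1%:R)) w)%N].

Lemma measurable_exits t M : 0 <= t -> measurable (exits t M).
Proof.
move=> t0; rewrite (_ : exits t M = \bigcup_N \bigcup_(r in [set r | (r <= N.+1)%N])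
   [set w | (M < Phi (r%:R * (t / N.+1%:R)) w)%N]).
  apply: bigcup_measurable => N _; apply: bigcup_measurable => r _.
  by apply: (@measurable_at_pred _ _ _ _ _ _ hPhi _ (fun k => M < k)%N);
    rewrite mulr_ge0// divr_ge0.
apply/seteqP; split=> w /=.
  by move=> [N [r [rN Mr]]]; exists N => //; exists r.
by move=> [N _ [r rN Mr]]; exists N, r.
Qed.

(** On a path with finitely many jumps before [t], the states visited before [t]
    are bounded; this is where non-explosion enters. *)
Lemma exits_cvg0 i t : 0 <= t -> P i (exits t M) @[M --> \oo] --> 0%E.
Proof.
move=> t0.
have mE M := measurable_exits M t0.
have mcap : measurable (\bigcap_M exits t M) by exact: bigcap_measurable.
have <- : P i (\bigcap_M exits t M) = 0%E.
  have [N [mN N0 hN]] := hexpl i.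
  apply/eqP; rewrite eq_le measure_ge0 andbT -N0; apply: le_measure; rewrite ?inE//.
  move=> w /= hw; apply: hN => /= hjump.
  have [K hK] := bounded_range t hjump.
  have [N' [r [rN]]] := hw K I; rewrite ltnNge => /negP; apply.
  apply: hK; first by rewrite mulr_ge0// divr_ge0.
  by rewrite mulrA ler_pdivrMr// mulrC ler_wpM2l// ler_nat.
apply: (@nonincreasing_cvg_mu _ _ _ (P i) (exits t)) => //.
- by rewrite (le_lt_trans (probability_le1 _ _))// ltry.
- move=> m m' mm'; apply/subsetPset => w [N [r [rN h]]]; exists N, r; split=> //.
  exact: leq_ltn_trans mm' h.
Qed.

Section grid.
Variables (i M N : nat) (t : R).
Hypothesis t0 : 0 <= t.
Let e := t / N.+1%:R.
Let e0 : 0 <= e. Proof. by rewrite divr_ge0. Qed.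

Let stays r := [set w | forall r', (r' <= r)%N -> (Phi (r'%:R * e) w <= M)%N].

Let past_stays r : past_event P Phi (r%:R * e) (stays r).
Proof.
pose c := [seq (k%:R * e, (fun l => l <= M)%N : pred nat) | k <- iota 0 r.+1].
have -> : stays r = cylinder Phi c.
  apply/seteqP; split=> w /=.
    move=> h; rewrite /cylinder /= all_map; apply/andP; split.
      by have := h 0%N isT; rewrite mul0r.
    by apply/allP => k; rewrite mem_iota /= add1n => /andP[_ ?]; exact: h.
  rewrite /cylinder /= all_map => /andP[h1 /allP h] [|k] hk; first by rewrite mul0r; move: h1; rewrite mul0r.
  by apply: h; rewrite mem_iota add1n.
apply: (past_cylinder hPhi); first exact: mulr_ge0.
rewrite /times_in all_map; apply/allP => k; rewrite mem_iota add0n /= => hk.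
by rewrite mulr_ge0//= ler_wpM2r// ler_nat -ltnS.
Qed.

Let mstays r : measurable (stays r). Proof. by have [] := past_stays r. Qed.

(** The probability of being in [k] at the [r]-th point of the grid without having
    exceeded [M] at any earlier one: a power of the truncated transition matrix. *)
Definition stay_prob r k : R := fine (P i (stays r `&` at_state (r%:R * e) k)).

Let mat r k : measurable (at_state (r%:R * e) k).
Proof. by apply: (measurable_at_state hPhi); exact: mulr_ge0. Qed.

Let stay_probE r k : (stay_prob r k)%:E = P i (stays r `&` at_state (r%:R * e) k).
Proof. by rewrite fineK//; apply: fin_num_measure; exact: measurableI. Qed.

Lemma stay_prob_ge0 r k : 0 <= stay_prob r k.
Proof. by rewrite fine_ge0. Qed.

Lemma stay_prob_le r k : stay_prob r k <= tprob (r%:R * e) i k.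
Proof.
rewrite -lee_fin stay_probE tprobE ?mulr_ge0//.
by apply: le_measure; rewrite ?inE//; exact: measurableI.
Qed.

(** Truncation loses at most the probability of exceeding [M]. *)
Lemma stay_prob_ge r k : (r <= N.+1)%N ->
  tprob (r%:R * e) i k - fine (P i (exits t M)) <= stay_prob r k.
Proof.
move=> rN; have mE := measurable_exits M t0.
rewrite lerBlDr -lee_fin EFinD tprobE ?mulr_ge0// stay_probE fineK; last exact: fin_num_measure.
apply: (@le_trans _ _ (P i ((stays r `&` at_state (r%:R * e) k) `|` exits t M))); last first.
  by apply: measureU2 => //; exact: measurableI.
apply: le_measure; rewrite ?inE//; first by apply: measurableU => //; exact: measurableI.
move=> w wk; have [ws|nws] := pselect (stays r w); [by left|right].
move: nws => /existsNP [r' /not_implyP[r'r /negP]]; rewrite -ltnNge => h.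
by exists N, r'; split => //; exact: leq_trans rN.
Qed.

Let stays_bounded r k : (M < k)%N -> stays r `&` at_state (r%:R * e) k = set0.
Proof.
move=> Mk; rewrite -subset0 => w [/(_ r (leqnn _))].
by rewrite leqNgt => + wk; rewrite wk Mk.
Qed.

Let series_below (f : nat -> \bar R) : (forall k, (0 <= f k)%E) ->
  (forall k, (M < k)%N -> f k = 0%E) -> (\sum_(k <oo) f k = \sum_(k < M.+1) f k)%E.
Proof.
move=> f0 fM; rewrite (@nneseries_split _ _ 0%N M.+1)//.
by rewrite add0n big_mkord [X in (_ + X)%E]eseries0 ?adde0// => k Mk _; exact: fM.
Qed.

Lemma sum_stay_prob r : \sum_(k < M.+1) stay_prob r k <= 1.
Proof.
rewrite -lee_fin -sumEFin; under eq_bigr do rewrite stay_probE.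
rewrite -(series_below (f := fun k => P i (stays r `&` at_state (r%:R * e) k)))//; last first.
  by move=> k Mk; rewrite stays_bounded.
rewrite -(measure_at_state hPhi)//; first exact: probability_le1.
exact: mulr_ge0.
Qed.

Lemma stay_prob0 k : stay_prob 0 k <= (k == i)%:R.
Proof.
rewrite -lee_fin stay_probE -(at_state0 hPhi) mul0r.
by apply: le_measure; rewrite ?inE//; do ?apply: measurableI => //;
  exact: (measurable_at_state hPhi).
Qed.

Lemma stay_probS r l : (l <= M)%N ->
  stay_prob r.+1 l = \sum_(k < M.+1) stay_prob r k * tprob e k l.
Proof.
move=> lM; apply: EFin_inj; rewrite stay_probE -sumEFin.
have [_ hpast] := past_stays r.
have re : r.+1%:R * e = r%:R * e + e by rewrite -natr1 mulrDl mul1r.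
have -> : stays r.+1 `&` at_state (r.+1%:R * e) l =
    stays r `&` at_state (r.+1%:R * e) l.
  apply/seteqP; split=> w [ws wl]; split=> //.
    by move=> r' r'r; apply: ws; exact: leqW.
  move=> r'; rewrite leq_eqVlt => /predU1P[->|]; first by rewrite wl.
  by rewrite ltnS; exact: ws.
rewrite (measure_at_state hPhi i (mulr_ge0 _ e0) (measurableI _ _ (mstays r) (mat r.+1 l)) (t := r%:R * e))//.
rewrite series_below//; last first.
  by move=> k Mk; rewrite classical_sets.setIAC stays_bounded// set0I.
apply: eq_bigr => k _; rewrite classical_sets.setIAC re hpast//.
by rewrite EFinM stay_probE tprobE.
Qed.

End grid.

End dynkin.

Section dynkin_inequality.
Context {R : realType} d (T : measurableType d).
Variables (P : nat -> probability T R) (Phi : R -> T -> nat) (Q : nat -> nat -> R).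
Hypothesis hPhi : markov_chain P Phi Q.
Hypothesis hexpl : non_explosive P Phi.
Local Notation tprob := (tprob P Phi).
Local Notation stay_prob := (stay_prob P Phi).

Lemma tprob_qmatrix_near M (t eta : R) : 0 < t -> 0 < eta ->
  \forall N \near \oo, forall k l : 'I_M.+1,
    `|(tprob (t / N.+1%:R) k l - (k == l :> nat)%:R) / (t / N.+1%:R) - Q k l| <= eta.
Proof.
move=> t0 eta0; apply: filter_forall => k; apply: filter_forall => l.
have /cvgrPdist_le /(_ _ eta0) [e /= e0 he] := @mc_qmatrix _ _ _ _ _ _ hPhi k l.
near=> N; rewrite distrC; apply: he.
  rewrite /= sub0r normrN gtr0_norm ?divr_gt0// ltr_pdivrMr// mulrC -ltr_pdivrMr//.
  apply: lt_trans (truncnS_gt _) _; rewrite ltr_nat ltnS.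
  by near: N; exact: nbhs_infty_gt.
by rewrite divr_gt0.
Unshelve. all: by end_near. Qed.

(** On the states at most [M], one step of the grid multiplies by
    [1 + (t / N.+1) Q], up to an error [eta] in each entry. *)
Lemma dynkin_step i M N t (phi B : nat -> R) (C eta : R) r : 0 < t -> 0 <= eta ->
  (forall k, 0 <= phi k <= C) ->
  (forall k, (k <= M)%N -> \sum_(l < M.+1) Q k l * phi l <= B k) ->
  (forall k l : 'I_M.+1,
    `|(tprob (t / N.+1%:R) k l - (k == l :> nat)%:R) / (t / N.+1%:R) - Q k l| <= eta) ->
  \sum_(k < M.+1) stay_prob i M N t r.+1 k * phi k <=
  \sum_(k < M.+1) stay_prob i M N t r k * phi k +
  t / N.+1%:R * (\sum_(k < M.+1) stay_prob i M N t r k * B k + eta * C * M.+1%:R).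
Proof.
move=> t0 eta0 hphi hB hQ; set e := t / N.+1%:R; set s := stay_prob i M N t r.
have e0 : 0 < e by rewrite divr_gt0.
have C0 : 0 <= C by have /andP[/le_trans h /h] := hphi 0%N.
have s0 k : 0 <= s k by exact: stay_prob_ge0.
rewrite (eq_bigr (fun l : 'I_M.+1 =>
    \sum_(k < M.+1) s k * (tprob e k l * phi l))); last first.
  move=> l _; rewrite (stay_probS hPhi) ?ltW//; last by rewrite -ltnS.
  by rewrite mulr_suml; apply: eq_bigr => k _; rewrite mulrA.
rewrite exchange_big /=.
have step (k : 'I_M.+1) : \sum_(l < M.+1) tprob e k l * phi l <=
    phi k + e * (B k + eta * C * M.+1%:R).
  apply: (@le_trans _ _ (\sum_(l < M.+1) ((k == l :> nat)%:R * phi l +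
      e * (Q k l * phi l) + e * (eta * C)))).
    apply: ler_sum => l _; have /andP[p0 pC] := hphi l.
    have := hQ k l; rewrite -/e ler_norml => /andP[_].
    rewrite lerBlDr ler_pdivrMr// => h.
    have : tprob e k l * phi l <= ((k == l :> nat)%:R + (eta + Q k l) * e) * phi l.
      by apply: ler_wpM2r => //; lra.
    move=> h2; apply: le_trans h2 _.
    have : e * eta * phi l <= e * eta * C by rewrite ler_wpM2l// mulr_ge0// ltW.
    by lra.
  rewrite !big_split /= sumr_const card_ord -[_ *+ M.+1]mulr_natr.
  rewrite (bigD1 k)//= eqxx big1 ?addr0; last first.
    by move=> l lk; rewrite (_ : (k == l :> nat) = false) ?mul0r// eq_sym; exact/negbTE.
  rewrite -mulr_sumr.
  have : e * (\sum_(l < M.+1) Q k l * phi l) <= e * B k.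
    by apply: ler_wpM2l; [exact: ltW|apply: hB; rewrite -ltnS].
  by rewrite [true%:R]mulr1n; lra.
apply: (@le_trans _ _ (\sum_(k < M.+1) s k * (phi k + e * (B k + eta * C * M.+1%:R)))).
  by apply: ler_sum => k _; rewrite -mulr_sumr ler_wpM2l.
have -> : \sum_(k < M.+1) s k * (phi k + e * (B k + eta * C * M.+1%:R)) =
   \sum_(k < M.+1) s k * phi k + e * (\sum_(k < M.+1) s k * B k) +
   (\sum_(k < M.+1) s k) * (e * (eta * C * M.+1%:R)).
  rewrite mulr_sumr mulr_suml -!big_split /=; apply: eq_bigr => k _; ring.
rewrite -addrA lerD2l mulrDr lerD2l.
rewrite -[leRHS]mul1r ler_wpM2r//; last exact: (sum_stay_prob hPhi i M N (ltW t0) r).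
by rewrite !mulr_ge0// ltW.
Qed.

(** If [phi] is bounded with [Q phi <= B], where [B] vanishes beyond [n], then
    [E_i phi (Phi_t) <= phi i + E_i int_0^t B (Phi_s) ds], with a Riemann sum
    in place of the integral and a finite part of the expectation. *)
Lemma dynkin_le n (phi B : nat -> R) (C : R) i K t eta : 0 < t -> 0 < eta ->
  (forall k, 0 <= phi k <= C) -> (forall k, (n < k)%N -> B k = 0) ->
  (forall M k, (n <= M)%N -> (k <= M)%N -> \sum_(l < M.+1) Q k l * phi l <= B k) ->
  \forall N \near \oo,
    \sum_(k < K) tprob t i k * phi k <=
    phi i + t / N.+1%:R * (\sum_(r < N.+1) \sum_(k < n.+1)
       tprob (r%:R * (t / N.+1%:R)) i k * B k) + eta.
Proof.
move=> t0 eta0 hphi hB0 hB.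
have C0 : 0 <= C by have /andP[/le_trans h /h] := hphi 0%N.
pose beta := \sum_(k < n.+1) `|B k|.
have beta0 : 0 <= beta by apply: sumr_ge0.
pose D := t * beta + K%:R * C + 1.
have D0 : 0 < D by rewrite ltr_wpDl// addr_ge0// mulr_ge0// ltW.
(* [M] is chosen so that leaving [{0, ..., M}] costs at most [eta / 2] in total;
   the number of grid points is chosen afterwards *)
have [M [nM KM] hM] : exists2 M, (n <= M)%N /\ (K <= M)%N &
    fine (P i (exits Phi t M)) * D <= eta / 2.
  have := exits_cvg0 hPhi hexpl i (ltW t0); move=> /fine_cvg /cvgrPdist_lt.
  move=> /(_ (eta / 2 / D)); rewrite !divr_gt0// => /(_ isT) [M0 _ hM0].
  exists (maxn M0 (maxn n K)); first by rewrite !leq_max !leqnn ?orbT.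
  have := hM0 (maxn M0 (maxn n K)) (leq_maxl _ _).
  by rewrite /= sub0r normrN => /ltW /(le_trans (ler_norm _)); rewrite ler_pdivlMr.
set eM := fine _ in hM.
have eM0 : 0 <= eM by rewrite fine_ge0.
pose eta' := eta / 2 / (t * C * M.+1%:R + 1).
have tCM : 0 < t * C * M.+1%:R + 1 by rewrite ltr_wpDl// !mulr_ge0// ltW.
have eta'0 : 0 < eta' by rewrite /eta' !divr_gt0.
have := tprob_qmatrix_near M t0 eta'0; apply: filterS => N hN.
set e := t / N.+1%:R in hN *; have e0 : 0 < e by rewrite divr_gt0.
pose s r := stay_prob i M N t r.
pose m r := \sum_(k < M.+1) s r k * phi k.
have trunc (F : nat -> R) : (forall k, (n < k)%N -> F k = 0) ->
    \sum_(k < M.+1) F k = \sum_(k < n.+1) F k.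
  move=> F0; rewrite -!(big_mkord xpredT F) (@big_cat_nat _ _ _ n.+1)//=.
  rewrite [X in _ + X]big_nat_cond [X in _ + X]big1 ?addr0//.
  by move=> k /andP[/andP[nk _] _]; exact: F0.
have sB r : (r <= N.+1)%N -> \sum_(k < M.+1) s r k * B k <=
    \sum_(k < n.+1) tprob (r%:R * e) i k * B k + eM * beta.
  move=> rN; rewrite (trunc (fun k => s r k * B k)); last by move=> k nk; rewrite hB0// mulr0.
  rewrite /beta mulr_sumr -big_split/=; apply: ler_sum => k _.
  have h1 := stay_prob_le hPhi i M N (ltW t0) r k.
  have h2 := stay_prob_ge hPhi i M (ltW t0) k rN.
  rewrite -/e -/eM -/(s r k) in h1 h2.
  have : (s r k - tprob (r%:R * e) i k) * B k <= `|s r k - tprob (r%:R * e) i k| * `|B k|.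
    by rewrite -normrM ler_norm.
  have : `|s r k - tprob (r%:R * e) i k| * `|B k| <= eM * `|B k|.
    by rewrite ler_wpM2r// ler_norml; apply/andP; split; lra.
  by lra.
have mstep r : (r <= N.+1)%N -> m r <= phi i + e * (\sum_(r' < r)
    (\sum_(k < n.+1) tprob (r'%:R * e) i k * B k)) +
    r%:R * (e * (eM * beta + eta' * C * M.+1%:R)).
  elim: r => [_|r IH rN].
    rewrite big_ord0 mulr0 mul0r !addr0 /m.
    have [iM|Mi] := ltnP i M.+1.
      rewrite (bigD1 (Ordinal iM))//= -[leRHS]addr0 lerD//.
        rewrite -[leRHS]mul1r ler_wpM2r//; first by have /andP[] := hphi i.
        by have := stay_prob0 hPhi i M N (ltW t0) i; rewrite eqxx.
      apply: sumr_le0 => k ki; have := stay_prob0 hPhi i M N (ltW t0) k.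
      rewrite (_ : (k == i :> nat) = false); last exact/negbTE.
      by move=> s0; rewrite mulr_le0_ge0//; have /andP[] := hphi k.
    apply: (@le_trans _ _ 0); last by have /andP[] := hphi i.
    apply: sumr_le0 => k _; have := stay_prob0 hPhi i M N (ltW t0) k.
    rewrite (_ : (k == i :> nat) = false); last by rewrite ltn_eqF// (leq_trans (ltn_ord k)).
    by move=> s0; rewrite mulr_le0_ge0//; have /andP[] := hphi k.
  have := dynkin_step i r t0 (ltW eta'0) hphi (fun k kM => hB M k nM kM) hN.
  rewrite -/e -/(s r) -/(s r.+1) -/(m r) -/(m r.+1).
  have := IH (ltnW rN); have := ler_wpM2l (ltW e0) (sB r (ltnW rN)).
  by rewrite [\sum_(_ < r.+1) _]big_ord_recr/= -[r.+1%:R]natr1; lra.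
have mlow : \sum_(k < K) tprob t i k * phi k - eM * (K%:R * C) <= m N.+1.
  apply: (@le_trans _ _ (\sum_(k < K) s N.+1 k * phi k)).
    have -> : eM * (K%:R * C) = \sum_(k < K) eM * C.
      by rewrite sumr_const card_ord -mulr_natr; ring.
    rewrite -sumrB; apply: ler_sum => k _.
    have := stay_prob_ge hPhi i M (ltW t0) k (leqnn N.+1).
    rewrite -/eM -/(s _ _) mulrC divfK ?pnatr_eq0// => h.
    have /andP[p0 pC] := hphi k.
    have := ler_wpM2r p0 h; have := ler_wpM2l eM0 pC; lra.
  rewrite /m -(big_mkord xpredT (fun k => s N.+1 k * phi k)).
  rewrite -(big_mkord xpredT (fun k => s N.+1 k * phi k)).
  rewrite [leRHS](@big_cat_nat _ _ _ K)//=; last exact: leqW.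
  rewrite lerDl sumr_ge0// => k _; rewrite mulr_ge0//; first exact: stay_prob_ge0.
  by have /andP[] := hphi k.
have := mstep N.+1 (leqnn _).
have -> : N.+1%:R * (e * (eM * beta + eta' * C * M.+1%:R)) =
   t * (eM * beta + eta' * C * M.+1%:R).
  by rewrite /e mulrA (mulrC N.+1%:R) divfK ?pnatr_eq0.
have : eta' * (t * C * M.+1%:R + 1) = eta / 2 by rewrite /eta' divfK// gt_eqF.
move: hM mlow; rewrite /D.
lra.
Qed.

End dynkin_inequality.

Lemma cvg_finsum {R : realType} (I : finType) (f : I -> nat -> R) (l : I -> R) :
  (forall i, f i @ \oo --> l i) -> \sum_i f i M @[M --> \oo] --> \sum_i l i.
Proof.
move=> fl; elim: (index_enum I) => [|i r IH].
  by rewrite big_nil; under eq_fun do rewrite big_nil; exact: cvg_cst.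
by rewrite big_cons; under eq_fun do rewrite big_cons; exact: cvgD.
Qed.

(** * The invariant vector of the censored generator *)

Section censored_invariant.
Context {R : realType} d (T : measurableType d).
Variables (P : nat -> probability T R) (Phi : R -> T -> nat) (Q : nat -> nat -> R).
Variable pi : nat -> R.
Hypothesis hPhi : markov_chain P Phi Q.
Hypothesis hcons : conservative Q.
Hypothesis hexpl : non_explosive P Phi.
Hypothesis hirr : irreducible P Phi.
Hypothesis hpi : invariant_probability P Phi pi.
Local Notation tprob := (tprob P Phi).
Variables (n : nat) (X : nat -> nat -> R).
Hypothesis hX : minimal_nonneg_inverse n Q X.

Let Q0 i k : i != k -> 0 <= Q i k. Proof. exact: (qmatrix_ge0 hPhi). Qed.
Let A := censored_generator n Q X.
Let pi0 k : 0 <= pi k. Proof. by case: hpi. Qed.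

(** Beyond the diagonal, the terms of the row are nonnegative. *)
Let partial_le (phi : nat -> R) k b : (forall l, 0 <= phi l) ->
  (\sum_(0 <= l < M) Q k l * phi l) @[M --> \oo] --> b ->
  forall M, (k <= M)%N -> \sum_(l < M.+1) Q k l * phi l <= b.
Proof.
move=> phi0 hb M kM; rewrite -(big_mkord xpredT (fun l => Q k l * phi l)).
apply: (cvgr_to_ge hb); near=> M'.
have MM' : (M.+1 <= M')%N by near: M'; exact: nbhs_infty_ge.
rewrite [leRHS](@big_cat_nat _ _ _ M.+1)//= lerDl big_nat_cond sumr_ge0// => l.
by move=> /andP[/andP[Ml _] _]; rewrite mulr_ge0// Q0// ltn_eqF// (leq_ltn_trans kM).
Unshelve. all: by end_near. Qed.

Let rate_sum_cvg k : (\sum_(0 <= l < M) Q k l) @[M --> \oo] --> 0.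
Proof.
rewrite [X in _ --> X](_ : _ = Q k k + (- Q k k)); last by rewrite subrr.
apply: (@cvg_signed_sum _ (Q k) k (- Q k k)).
  by move=> l lk; rewrite Q0// eq_sym.
by apply: (sum_rates Q0 hcons).
Qed.

Let tail I := 1 - \sum_(k < I) pi k.

Let sum_pi_cvg : (\sum_(0 <= k < M) pi k) @[M --> \oo] --> (1 : R).
Proof. by apply: cvg_partial_sum => //; case: hpi. Qed.

Let tail_ge0 I : 0 <= tail I.
Proof.
rewrite subr_ge0 -(big_mkord xpredT pi).
apply: (cvgr_to_ge sum_pi_cvg); near=> M.
have IM : (I <= M)%N by near: M; exact: nbhs_infty_ge.
by rewrite [leRHS](@big_cat_nat _ _ _ I)//= lerDl sumr_ge0.
Unshelve. all: by end_near. Qed.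

Let tail_small e : 0 < e -> exists I0, forall I, (I0 <= I)%N -> tail I <= e.
Proof.
move=> e0; have /cvgrPdist_le /(_ _ e0) [I0 _ hI0] := sum_pi_cvg.
exists I0 => I II0; have := hI0 I II0; rewrite /tail -(big_mkord xpredT pi).
by apply: le_trans; exact: ler_norm.
Qed.

(** Invariance of [pi], restricted to the initial states below [I]. *)
Let flow I t k : 0 <= t ->
  pi k - tail I <= \sum_(i < I) pi i * tprob t i k <= pi k.
Proof.
move=> t0; have [_ pi1 /(_ t k t0) hk] := hpi.
have e i : ((pi i)%:E * P i [set w | Phi t w = k])%E = (pi i * tprob t i k)%:E.
  by rewrite EFinM (tprobE hPhi).
move: hk; rewrite (eq_eseriesr (fun i _ => e i)).
have pt0 i : 0 <= pi i * tprob t i k by rewrite mulr_ge0// tprob_ge0.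
move=> hk; have := @cvg_partial_sum _ _ 0%N _ (fun i _ => pt0 i) hk => hcvg.
rewrite -(big_mkord xpredT (fun i => pi i * tprob t i k)); apply/andP; split.
  rewrite lerBlDr; apply: (cvgr_to_le hcvg); near=> M.
  have IM : (I <= M)%N by near: M; exact: nbhs_infty_ge.
  rewrite (@big_cat_nat _ _ _ I)//= lerD2l.
  apply: (@le_trans _ _ (\sum_(I <= i < M) pi i)).
    apply: ler_sum => i _; rewrite -[leRHS]mulr1 ler_wpM2l//.
    by rewrite -lee_fin (tprobE hPhi)// probability_le1//; exact: (measurable_at_state hPhi).
  have := tail_ge0 M; rewrite /tail -!(big_mkord xpredT pi).
  by rewrite (@big_cat_nat _ _ _ I 0 M)//=; lra.
apply: (cvgr_to_ge hcvg); near=> M.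
have IM : (I <= M)%N by near: M; exact: nbhs_infty_ge.
by rewrite [leRHS](@big_cat_nat _ _ _ I)//= lerDl sumr_ge0.
Unshelve. all: by end_near. Qed.

(** The means of [phi] at times [0] and [1] under [pi] agree, so the inequality of
    Dynkin leaves [0 <= pi B].  [K] bounds the states counted at time [1], and [I]
    the initial states. *)
Let mean_generator_ge0 (phi B : nat -> R) : (forall k, 0 <= phi k <= 1) ->
  (forall k, (n < k)%N -> B k = 0) ->
  (forall k, (\sum_(0 <= l < M) Q k l * phi l) @[M --> \oo] --> B k) ->
  0 <= \sum_(k < n.+1) pi k * B k.
Proof.
move=> hphi hB0 hB.
have hB' M k : (n <= M)%N -> (k <= M)%N -> \sum_(l < M.+1) Q k l * phi l <= B k.
  by move=> _; apply: partial_le => // l; have /andP[] := hphi l.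
set piB := \sum_(_ < _) _; apply/ler_addgt0Pr => delta delta0.
pose beta := \sum_(k < n.+1) `|B k|.
have beta0 : 0 <= beta by apply: sumr_ge0.
have d3 : 0 < delta / 3 by rewrite divr_gt0.
have [K hK] := tail_small d3.
have D0 : 0 < K%:R + beta + 1 by rewrite ltr_wpDl// addr_ge0.
have [I0 hI0] := tail_small (divr_gt0 d3 D0).
pose I := maxn K I0.
have tK := hK K (leqnn _).
have tI : tail I * (K%:R + beta + 1) <= delta / 3.
  by rewrite -ler_pdivlMr//; apply: hI0; exact: leq_maxr.
have tI0 := tail_ge0 I.
have near_all : \forall N \near \oo, forall i : 'I_I,
    \sum_(k < K) tprob 1 i k * phi k <= phi i + 1 / N.+1%:R * (\sum_(r < N.+1)
      \sum_(k < n.+1) tprob (r%:R * (1 / N.+1%:R)) i k * B k) + delta / 3.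
  apply: filter_forall => i.
  exact: (dynkin_le hPhi hexpl i K ltr01 d3 hphi hB0 hB').
have [N _ /(_ N (leqnn _))/= hN] := near_all.
have e0 : 0 <= 1 / N.+1%:R :> R by rewrite divr_ge0.
have lhs : \sum_(k < K) pi k * phi k - tail I * K%:R <=
    \sum_(i < I) pi i * (\sum_(k < K) tprob 1 i k * phi k).
  rewrite (eq_bigr (fun i : 'I_I => \sum_(k < K) pi i * tprob 1 i k * phi k)); last first.
    by move=> i _; rewrite mulr_sumr; apply: eq_bigr => k _; rewrite mulrA.
  rewrite exchange_big/= -[K%:R]mulr1.
  have -> : tail I * (K%:R * 1) = \sum_(k < K) tail I.
    by rewrite sumr_const card_ord -[RHS]mulr_natr mulr1.
  rewrite -sumrB; apply: ler_sum => k _; rewrite -mulr_suml.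
  have /andP[p0 p1] := hphi k; have /andP[f1 _] := flow I k ler01.
  have := ler_wpM2r p0 f1; have := ler_wpM2l tI0 p1; lra.
have rhs r : \sum_(i < I) pi i * (\sum_(k < n.+1) tprob (r%:R * (1 / N.+1%:R)) i k * B k) <=
    piB + tail I * beta.
  rewrite (eq_bigr (fun i : 'I_I =>
      \sum_(k < n.+1) pi i * tprob (r%:R * (1 / N.+1%:R)) i k * B k)); last first.
    by move=> i _; rewrite mulr_sumr; apply: eq_bigr => k _; rewrite mulrA.
  rewrite exchange_big/= /piB /beta mulr_sumr -big_split/=; apply: ler_sum => k _.
  rewrite -mulr_suml.
  have /andP[f1 f2] := flow I k (mulr_ge0 (ler0n R r) e0).
  set F := \sum_(_ < _) _ in f1 f2 *.
  have : (F - pi k) * B k <= `|F - pi k| * `|B k| by rewrite -normrM ler_norm.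
  have : `|F - pi k| * `|B k| <= tail I * `|B k|.
    by rewrite ler_wpM2r// ler_norml; apply/andP; split; lra.
  by lra.
have total : \sum_(i < I) pi i * (\sum_(k < K) tprob 1 i k * phi k) <=
    \sum_(i < I) pi i * phi i + (piB + tail I * beta) + delta / 3.
  apply: (@le_trans _ _ (\sum_(i < I) (pi i * phi i +
    1 / N.+1%:R * (\sum_(r < N.+1) pi i *
      (\sum_(k < n.+1) tprob (r%:R * (1 / N.+1%:R)) i k * B k)) + pi i * (delta / 3)))).
    apply: ler_sum => i _; rewrite -mulr_sumr.
    have := ler_wpM2l (pi0 i) (hN i); set S1 := \sum_(k < K) _.
    set S2 := \sum_(r < N.+1) _; set u := 1 / _; lra.
  rewrite !big_split/= -mulr_sumr exchange_big/=.
  have hs : \sum_(i < I) pi i * (delta / 3) <= delta / 3.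
    rewrite -mulr_suml -[leRHS]mul1r ler_wpM2r//; first exact: ltW.
    by rewrite -subr_ge0.
  have hr : \sum_(r < N.+1) \sum_(i < I) pi i *
      (\sum_(k < n.+1) tprob (r%:R * (1 / N.+1%:R)) i k * B k) <=
      N.+1%:R * (piB + tail I * beta).
    apply: (@le_trans _ _ (\sum_(r < N.+1) (piB + tail I * beta))).
      by apply: ler_sum => r _; exact: rhs.
    by rewrite sumr_const card_ord mulr_natl.
  have := ler_wpM2l e0 hr; set S3 := \sum_(r < N.+1) _.
  rewrite [X in _ <= X -> _]mulrA [X in _ <= X * _ -> _]divfK ?pnatr_eq0// mul1r.
  move: hs; set S4 := \sum_(i < I) pi i * (delta / 3).
  set S5 := \sum_(i < I) pi i * phi i; rewrite mul1r => ? ?.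
  by rewrite lerD// lerD2l.
have phiI : \sum_(i < I) pi i * phi i <= \sum_(k < K) pi k * phi k + delta / 3.
  rewrite -!(big_mkord xpredT (fun k => pi k * phi k)).
  rewrite (@big_cat_nat _ _ _ K)//=; last exact: leq_maxl.
  rewrite lerD2l; apply: (@le_trans _ _ (\sum_(K <= i < I) pi i)).
    apply: ler_sum => i _; rewrite -[leRHS]mulr1 ler_wpM2l//.
    by have /andP[] := hphi i.
  apply: le_trans tK; have := tI0; rewrite /tail -!(big_mkord xpredT pi).
  by rewrite (@big_cat_nat _ _ _ K 0 I)//=; [lra|exact: leq_maxl].
lra.
Qed.

Let Qd i : Q i i <= 0. Proof. exact: (qmatrix_le0 hPhi). Qed.

Let w_le1 (w : 'I_n.+1 -> nat -> R) : (forall i l, 0 <= w i l) ->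
  (forall l, (n < l)%N -> \sum_i w i l <= 1) ->
  (forall i l, (l <= n)%N -> w i l = (l == i)%:R) -> forall i l, 0 <= w i l <= 1.
Proof.
move=> w0 w1 wn i l; rewrite w0/=; have [ln|nl] := leqP l n.
  by rewrite wn//; case: (_ == _).
by apply: le_trans (w1 l nl); rewrite (bigD1 i)//= lerDl sumr_ge0.
Qed.

Let sum_delta (x : 'I_n.+1 -> R) (k : 'I_n.+1) :
  \sum_(i < n.+1) (k == i :> nat)%:R * x i = x k.
Proof.
rewrite (bigD1 k)//= eqxx mul1r big1 ?addr0// => i ik.
by rewrite (_ : (k == i :> nat) = false) ?mul0r// eq_sym; exact/negbTE.
Qed.

(** The entries of [pi A] are nonnegative by [mean_generator_ge0], and their sum is
    nonpositive because the rows of [A] have nonpositive sums. *)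
Lemma pi_censored_generator : (\row_(k < n.+1) pi k) *m A = 0.
Proof.
have [w [w0 w1 wn wQ]] := harmonic_extension Q0 Qd hcons hX.
have w01 := w_le1 w0 w1 wn.
have piA_ge0 i : 0 <= \sum_(k < n.+1) pi k * A k i.
  pose B k := if (k <= n)%N then A (inord k) i else 0.
  rewrite (eq_bigr (fun k : 'I_n.+1 => pi k * B k)); last first.
    by move=> k _; rewrite /B -ltnS ltn_ord inord_val.
  apply: (mean_generator_ge0 (w01 i)); last exact: wQ.
  by move=> k nk; rewrite /B leqNgt nk.
have row_le0 (k : 'I_n.+1) : \sum_i A k i <= 0.
  have kn : (k <= n)%N by rewrite -ltnS.
  have h : (\sum_i \sum_(0 <= l < M) Q k l * w i l) @[M --> \oo] --> \sum_i A k i.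
    apply: cvg_finsum => i; have := wQ i k.
    by rewrite kn inord_val.
  apply: (ler_cvg_to h (rate_sum_cvg k)); near=> M.
  have nM : (n.+1 <= M)%N by near: M; exact: nbhs_infty_ge.
  rewrite exchange_big/= big_nat_cond [leRHS]big_nat_cond; apply: ler_sum => l _.
  rewrite -mulr_sumr; have [ln|nl] := leqP l n.
    rewrite (eq_bigr (fun i : 'I_n.+1 => (l == i)%:R * 1)) => [|i _]; last by rewrite wn// mulr1.
    by rewrite (sum_delta (fun=> 1) (Ordinal (ln : (l < n.+1)%N))) mulr1.
  by rewrite -[leRHS]mulr1 ler_wpM2l ?w1// Q0// ltn_eqF// (leq_ltn_trans kn).
have sum0 : \sum_i \sum_(k < n.+1) pi k * A k i <= 0.
  rewrite exchange_big/=; apply: sumr_le0 => k _.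
  by rewrite -mulr_sumr mulr_ge0_le0.
apply/rowP => i; rewrite !mxE.
rewrite (eq_bigr (fun k : 'I_n.+1 => pi k * A k i)) => [|k _]; last by rewrite mxE.
have s0 : \sum_i \sum_(k < n.+1) pi k * A k i = 0.
  by apply/eqP; rewrite eq_le sum0 sumr_ge0.
exact: (psumr_eq0P (fun i _ => piA_ge0 i) s0).
Unshelve. all: by end_near. Qed.

(** The harmonic extension [phi] of [x] is at most [c], so that [theta = c - phi] is
    a nonnegative function with [Q theta = 0] that vanishes at [i0]; by Dynkin its
    mean at any time under the chain started in [i0] is zero, and the chain
    reaches every state. *)
Let kernel_max (x : 'cV[R]_n.+1) i0 : A *m x = 0 -> (forall i, x i 0 <= x i0 0) ->
  0 <= x i0 0 -> forall i, x i 0 = x i0 0.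
Proof.
move=> Ax xmax c0; set c := x i0 0.
have [w [w0 w1 wn wQ]] := harmonic_extension Q0 Qd hcons hX.
have w01 := w_le1 w0 w1 wn.
pose phi l := \sum_i w i l * x i 0; pose theta l := c - phi l.
have phin (k : 'I_n.+1) : phi k = x k 0.
  rewrite /phi (eq_bigr (fun i : 'I_n.+1 => (k == i :> nat)%:R * x i 0)) ?sum_delta// => i _.
  by rewrite wn// -ltnS.
have theta0 l : 0 <= theta l.
  rewrite subr_ge0; have [ln|nl] := leqP l n.
    by rewrite -[l]/(val (Ordinal (ln : (l < n.+1)%N))) phin.
  apply: (@le_trans _ _ (\sum_i w i l * c)).
    by apply: ler_sum => i _; rewrite ler_wpM2l.
  by rewrite -mulr_suml -[leRHS]mul1r ler_wpM2r// w1.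
pose C := c + \sum_i `|x i 0|.
have thetaC l : 0 <= theta l <= C.
  rewrite theta0 lerD2l -sumrN; apply: ler_sum => i _.
  apply: le_trans (ler_norm _) _; rewrite normrN normrM -[leRHS]mul1r ler_wpM2r//.
  by have /andP[? ?] := w01 i l; rewrite ger0_norm.
have Qtheta k : (\sum_(0 <= l < M) Q k l * theta l) @[M --> \oo] --> 0.
  have h : (\sum_i \sum_(0 <= l < M) Q k l * w i l * x i 0) @[M --> \oo] -->
      \sum_i (if (k <= n)%N then A (inord k) i else 0) * x i 0.
    apply: cvg_finsum => i; apply: cvg_trans (@cvgMr_tmp _ _ _ _ _ _ (x i 0) (wQ i k)).
    by apply: near_eq_cvg; near=> M; rewrite -mulr_suml.
  have h0 : \sum_i (if (k <= n)%N then A (inord k) i else 0) * x i 0 = 0.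
    case: (k <= n)%N; last by rewrite big1// => i _; rewrite mul0r.
    by have /matrixP/(_ (inord k) 0) := Ax; rewrite !mxE.
  rewrite h0 in h.
  rewrite [X in _ --> X](_ : 0 = 0 * c - 0 :> R); last by rewrite mul0r subr0.
  apply: cvg_trans (cvgB (@cvgMr_tmp _ _ _ _ _ _ c (rate_sum_cvg k)) h).
  apply: near_eq_cvg; near=> M.
  transitivity ((\sum_(0 <= l < M) Q k l) * c - \sum_i \sum_(0 <= l < M) Q k l * w i l * x i 0).
    by [].
  rewrite exchange_big/= mulr_suml -sumrB; apply: eq_bigr => l _.
  rewrite /theta /phi mulrBr; congr (_ - _); rewrite mulr_sumr.
  by apply: eq_bigr => i _; rewrite mulrA.
have C0 : 0 <= C by rewrite addr_ge0// sumr_ge0.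
have thetaK k : theta k = 0.
  apply/eqP; rewrite eq_le theta0 andbT.
  have [t t0 pt] := hirr i0 k.
  have pt0 : 0 < tprob t i0 k by rewrite -lte_fin (tprobE hPhi)// ltW.
  rewrite -(pmulr_rle0 _ pt0); apply/ler_addgt0Pr => eta eta0; rewrite add0r.
  have hQ M k' : (n <= M)%N -> (k' <= M)%N -> \sum_(l < M.+1) Q k' l * theta l <= 0.
    by move=> _; exact: partial_le.
  have [N _ /(_ N (leqnn _))] :=
    dynkin_le hPhi hexpl i0 k.+1 t0 eta0 thetaC (fun k _ => erefl (0 : R)) hQ.
  rewrite [X in _ <= X + _ + _](_ : _ = 0); last by rewrite /theta phin subrr.
  rewrite [X in _ <= 0 + _ * X + _ -> _]big1; last first.
    by move=> r _; rewrite big1// => l _; rewrite mulr0.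
  rewrite mulr0 !add0r; apply: le_trans.
  rewrite big_ord_recr/= lerDr sumr_ge0// => l _.
  by rewrite mulr_ge0// tprob_ge0.
by move=> i; have := thetaK i; rewrite /theta phin => /subr0_eq.
Unshelve. all: by end_near. Qed.

(** [kernel_max] requires a nonnegative maximum, which [x] or [- x] has. *)
Let kernel_const (x : 'cV[R]_n.+1) : A *m x = 0 -> forall i k, x i 0 = x k 0.
Proof.
move=> Ax.
have [i0 _ max0] := @arg_maxP _ _ _ ord0 xpredT (fun i => x i 0) isT.
have {}max0 i : x i 0 <= x i0 0 by exact: max0.
have [c0|c0] := leP 0 (x i0 0).
  by move=> i k; rewrite !(kernel_max Ax max0 c0).
have [i1 _ max1] := @arg_maxP _ _ _ ord0 xpredT (fun i => (- x) i 0) isT.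
have {}max1 i : (- x) i 0 <= (- x) i1 0 by exact: max1.
have c1 : 0 <= (- x) i1 0.
  by rewrite mxE oppr_ge0 (le_trans (max0 i1))// ltW.
have ANx : A *m - x = 0 by rewrite mulmxN Ax oppr0.
move=> i k; have := kernel_max ANx max1 c1 i; have := kernel_max ANx max1 c1 k.
by rewrite !mxE => /oppr_inj -> /oppr_inj ->.
Qed.

Lemma censored_invariant_eq (v : 'rV[R]_n.+1) : generator_invariant A v ->
  forall k, v 0 k = pi k / \sum_(l < n.+1) pi l.
Proof.
move=> [_ v1 vA]; set s := \sum_(l < n.+1) pi l.
have s0 : 0 < s.
  rewrite /s big_ord_recl; apply: ltr_pwDl; first exact: (pi_gt0 hirr hpi).
  exact: sumr_ge0.
pose J : 'M[R]_n.+1 := const_mx 1.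
pose p : 'rV[R]_n.+1 := \row_(k < n.+1) pi k.
have pA : p *m A = 0 by exact: pi_censored_generator.
have rowJ (u : 'rV[R]_n.+1) : u *m J = const_mx (\sum_k u 0 k).
  by apply/rowP => k; rewrite !mxE; apply: eq_bigr => l _; rewrite mxE mulr1.
have const_mx0 m : const_mx 0 = 0 :> 'M[R]_(m.1, m.2) by apply/matrixP => ? ?; rewrite !mxE.
have colJ (x : 'cV[R]_n.+1) : J *m x = const_mx (\sum_k x k 0).
  by apply/colP => k; rewrite !mxE; apply: eq_bigr => l _; rewrite mxE mul1r.
(* adding the rank-one matrix [J] makes the generator invertible *)
have unitC : A + J \in unitmx.
  rewrite -unitmx_tr -row_free_unit; apply: inj_row_free => u uC.
  have Cx : (A + J) *m u^T = 0 by rewrite -[LHS]trmxK trmx_mul trmxK uC trmx0.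
  have sum0 : \sum_k u^T k 0 = 0.
    have : p *m ((A + J) *m u^T) = 0 by rewrite Cx mulmx0.
    rewrite mulmxA mulmxDr pA add0r rowJ => /matrixP/(_ 0 0).
    rewrite !mxE (eq_bigr (fun k => s * u^T k 0)); last first.
      by move=> k _; rewrite mxE; congr (_ * _); apply: eq_bigr => l _; rewrite mxE.
    by rewrite -mulr_sumr => /eqP; rewrite mulf_eq0 gt_eqF//= => /eqP.
  have Ax : A *m u^T = 0 by move: Cx; rewrite mulmxDl colJ sum0 (const_mx0 (_, _)) addr0.
  have uc := kernel_const Ax.
  have u0 : u^T 0 0 = 0.
    move: sum0; rewrite (eq_bigr (fun=> u^T 0 0)) => [|k _]; last exact: uc.
    rewrite sumr_const card_ord => /eqP; rewrite mulrn_eq0/= => /eqP //.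
  apply/rowP => k; have := uc k 0; rewrite u0 !mxE => ->//.
pose z := v - s^-1 *: p.
have zC : z *m (A + J) = 0.
  rewrite mulmxDr mulmxBl vA -scalemxAl pA scaler0 subrr add0r rowJ.
  rewrite (eq_bigr (fun k => v 0 k - s^-1 * pi k)) => [|k _]; last by rewrite !mxE.
  by rewrite sumrB v1 -mulr_sumr mulVf ?gt_eqF// subrr (const_mx0 (_, _)).
have z0 : z = 0 by rewrite -[z](mulmxK unitC) zC mul0mx.
move=> k; have /rowP/(_ k) := z0; rewrite !mxE => /subr0_eq ->.
by rewrite mulrC.
Qed.

End censored_invariant.

Section censored_mean.
Context {R : realType} d (T : measurableType d).
Variables (P : nat -> probability T R) (Phi : R -> T -> nat) (Q : nat -> nat -> R).
Variables (pi g : nat -> R) (G : nat -> nat -> nat -> R) (npi : forall n, 'rV[R]_n.+1).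

Lemma censored_mean_cvg : markov_chain P Phi Q -> conservative Q ->
  non_explosive P Phi -> irreducible P Phi -> invariant_probability P Phi pi ->
  (\sum_(0 <= k <oo) (pi k * `|g k|)%:E < +oo)%E ->
  (forall n, minimal_nonneg_inverse n Q (G n)) ->
  (forall n, generator_invariant (censored_generator n Q (G n)) (npi n)) ->
  \sum_(l < n.+1) npi n 0 l * g l @[n --> \oo] --> limn (series (fun l => pi l * g l)).
Proof.
move=> hPhi hcons hexpl hirr hpi hg hG hnpi.
have [pi0 pi1 _] := hpi.
have e n : \sum_(l < n.+1) npi n 0 l * g l =
    series (fun l => pi l * g l) n.+1 / series pi n.+1.
  rewrite /series/= !big_mkord mulr_suml; apply: eq_bigr => l _.
  by rewrite (censored_invariant_eq hPhi hcons hexpl hirr hpi (hG n) (hnpi n)) mulrAC.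
rewrite (funext e).
have c1 : series pi n @[n --> \oo] --> (1 : R) by exact: cvg_partial_sum.
have pg0 k : 0 <= pi k * `|g k| by rewrite mulr_ge0.
have [c hc] : exists c : R, (\sum_(0 <= k <oo) (pi k * `|g k|)%:E)%E = c%:E.
  exists (fine (\sum_(0 <= k <oo) (pi k * `|g k|)%:E)%E).
  by rewrite fineK// ge0_fin_numE// nneseries_ge0// => k _ _; rewrite lee_fin.
have cg : cvgn (series (fun l => pi l * g l)).
  apply: normed_cvg; rewrite /normed_series_of/=.
  apply/cvg_ex; exists c.
  rewrite (_ : (fun n => `|pi n * g n|) = (fun n => pi n * `|g n|)); last first.
    by apply/funext => n; rewrite normrM ger0_norm.
  exact: (@cvg_partial_sum _ (fun k => pi k * `|g k|) 0%N c (fun k _ => pg0 k) hc).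
rewrite -[X in _ --> X]divr1; apply: cvgM.
  by rewrite cvg_shiftS.
by apply: cvgV; [exact: oner_neq0|rewrite (cvg_shiftS (series pi))].
Qed.

End censored_mean.

(** * Limits along a path *)

Section integral_off_null.
Local Open Scope ereal_scope.
Context d (T : measurableType d) (R : realType).
Variable mu : {measure set T -> \bar R}.
Import HBNNSimple.

(** No measurability is assumed of [f] and [g]: the integral is a supremum over
    simple functions, and these can be cut off on a null set. *)
Let le_integral_off_null (N : set T) (f g : T -> \bar R) :
  measurable N -> mu N = 0 -> (forall x, 0 <= f x) -> (forall x, 0 <= g x) ->
  (forall x, ~ N x -> f x <= g x) -> \int[mu]_x f x <= \int[mu]_x g x.
Proof.
move=> mN N0 f0 g0 fg; rewrite [leLHS]ge0_integralTE// [leRHS]ge0_integralTE//.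
apply: ge_ereal_sup => _ [h /= hf <-]; have mNC := measurableC mN.
apply: ereal_sup_ge; exists (sintegral mu (proj_nnsfun h mNC)).
  exists (proj_nnsfun h mNC) => //= x; rewrite mindicE.
  case: (boolP (x \in ~` N)) => [|_]; last by rewrite mulr0.
  by rewrite inE => xN; rewrite mulr1 (le_trans (hf x))// fg.
have mh (k : {nnsfun T >-> R}) : measurable_fun setT (fun x => (k x)%:E).
  by apply/measurable_EFinP.
rewrite -!integralT_nnsfun.
rewrite (ge0_negligible_integral mN)//; last by move=> x _; rewrite lee_fin.
rewrite [leRHS](ge0_negligible_integral mN)//; last by move=> x _; rewrite lee_fin.
rewrite le_eqVlt; apply/orP; left; apply/eqP; apply: eq_integral => x.
by rewrite inE => -[_ xN]; rewrite /= mindicE mem_set// mulr1.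
Qed.

Lemma integral_off_null (N : set T) (f g : T -> \bar R) :
  measurable N -> mu N = 0 -> (forall x, ~ N x -> f x = g x) ->
  \int[mu]_x f x = \int[mu]_x g x.
Proof.
move=> mN N0 fg; rewrite integralE [RHS]integralE.
congr (_ - _); apply/eqP; rewrite eq_le; apply/andP; split;
  apply: (@le_integral_off_null N) => // x ?; rewrite ?funeposE ?funenegE fg//.
Qed.

End integral_off_null.

Section pathwise.
Context {R : realType}.
Implicit Types (X : R -> nat) (t s c : R).
Local Notation mu := (@lebesgue_measure R).
Local Notation below n := (fun k : nat => (k <= n)%N).

Lemma returns_below_sub X n j t : returns (below n) X j t -> returns predT X j t.
Proof. by move=> [t0 Xt [s [s0 st _ Xs]]]; split=> //; exists s. Qed.

Lemma clock_cvg X c : right_constant X -> 0 <= c ->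
  (clock n X c)%:E @[n --> \oo] --> c%:E.
Proof.
move=> hX c0; pose F n : set (measurableTypeR R) := [set s | 0 <= s <= c /\ (X s <= n)%N].
have FU : \bigcup_n F n = `[0, c]%classic.
  apply/seteqP; split=> [s [n _ [sc _]]|s /=]; first by rewrite /= in_itv.
  by rewrite in_itv/= => sc; exists (X s).
have mF n : measurable (F n) by exact: measurable_below_cc.
have -> : (fun n => (clock n X c)%:E) = mu \o F.
  by apply/funext => n; rewrite -local_clock_fin.
have -> : c%:E = mu (\bigcup_n F n).
  by rewrite FU lebesgue_measure_itv/= lte_fin; case: ltgtP c0 => // [_|<-] _; rewrite ?sube0.
apply: nondecreasing_cvg_mu => //; first exact: bigcupT_measurable.
move=> m n mn; apply/subsetPset => s [sc Xs]; split=> //; exact: leq_trans mn.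
Qed.

(** For [n >= max i j] the return of the censored path is determined by the first
    visit [rho] of the path to [j], which does not depend on [n]. *)
Lemma censored_limits X i j (g : nat -> R) : right_constant X -> X 0 = i -> i <> j ->
  returns predT X j !=set0 ->
  [/\ forall m n, (maxn i j <= m)%N -> (m <= n)%N ->
        (return_time (censored m X) j <= return_time (censored n X) j)%E,
      return_time (censored n X) j @[n --> \oo] --> return_time X j,
      forall m n, (maxn i j <= m)%N -> (m <= n)%N ->
        (return_integral (fun k => `|g k|%R) (censored m X) j <=
         return_integral (fun k => `|g k|%R) (censored n X) j)%E &
      return_integral (fun k => `|g k|%R) (censored n X) j @[n --> \oo] -->
        return_integral (fun k => `|g k|%R) X j].
Proof.
move=> hX X0 ij ne; have [rho Rrho rho_min] := returns_min hX ne.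
have rho0 : 0 <= rho by case: Rrho.
have timeE n : (maxn i j <= n)%N ->
    return_time (censored n X) j = (clock n X rho)%:E.
  rewrite geq_max => /andP[ni nj]; have e := returnsT_below X0 ij ni.
  by apply: return_time_censored => //; rewrite e.
have intE n : (maxn i j <= n)%N -> return_integral (fun k => `|g k|%R) (censored n X) j =
    (\int[mu]_(s in [set s | 0 <= s < rho /\ (X s <= n)%N]%R) `|g (X s)|%:E)%E.
  rewrite geq_max => /andP[ni nj]; have e := returnsT_below X0 ij ni.
  by apply: return_integral_censored => //; rewrite e.
split.
- move=> m n im mn; rewrite !timeE ?(leq_trans im)// lee_fin.
  rewrite -lee_fin -!local_clock_fin//; apply: le_measure; rewrite ?inE.
  + exact: measurable_below_cc.
  + exact: measurable_below_cc.
  + by move=> s [sc Xs]; split=> //; exact: leq_trans mn.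
- rewrite return_timeE// (ereal_inf_min Rrho rho_min).
  apply: cvg_trans (clock_cvg hX rho0); apply: near_eq_cvg; near=> n.
  by rewrite timeE//; near: n; exact: nbhs_infty_ge.
- move=> m n im mn; rewrite !intE ?(leq_trans im)//.
  apply: ge0_subset_integral.
  + exact: measurable_below_co.
  + exact: measurable_below_co.
  + apply: (measurable_funS measurable_nneg_times); last first.
      exact: (@measurable_fun_path _ X (fun k => `|g k|%:E)).
    by move=> s /= [/andP[]].
  + by move=> s _; rewrite lee_fin.
  + by move=> s [sc Xs]; split=> //; exact: leq_trans mn.
- rewrite (return_integralE _ hX Rrho rho_min).
  apply: cvg_trans (@integral_below_cvg _ X rho (fun k => `|g k|) hX _) => //.
  apply: near_eq_cvg; near=> n.
  by rewrite intE//; near: n; exact: nbhs_infty_ge.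
Unshelve. all: by end_near. Qed.

(** A visit lasts for some time, hence is seen at a rational time; only a visit to
    [j] at the time [t] itself may be missed. *)
Lemma returns_ratP (A : pred nat) X j t : right_constant X -> 0 <= t ->
  (exists2 u, u <= t & returns A X j u) <->
  (exists q : rat, [/\ 0 <= ratr q :> R, ratr q <= t, A (X (ratr q)), X (ratr q) <> j &
     X t = j \/ exists q' : rat, [/\ ratr q <= ratr q' :> R, ratr q' <= t & X (ratr q') = j]]).
Proof.
move=> hX t0; split; last first.
  move=> [q [q0 qt Aq Xq [Xt|[q' [qq' q't Xq']]]]].
    by exists t => //; split=> //; exists (ratr q).
  by exists (ratr q') => //; split=> //; [exact: le_trans qq'|exists (ratr q)].
move=> [u ut [u0 Xu [s [s0 su As Xs]]]].
have {}su : s < u by rewrite lt_neqAle su andbT; apply/eqP => e; apply: Xs; rewrite e.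
have [e e0 he] := hX _ s0.
have [q] : exists q : rat, ratr q \in `]s, Num.min (s + e) u[.
  by apply: rat_in_itvoo; rewrite lt_min ltrDl e0.
rewrite in_itv/= lt_min => /andP[sq /andP[qe qu]].
have Xq : X (ratr q) = X s by apply: he => //; exact: ltW.
exists q; rewrite Xq; split=> //.
- exact: le_trans s0 (ltW sq).
- exact: le_trans (ltW qu) ut.
move: ut; rewrite le_eqVlt => /predU1P[<-|ut]; [by left|right].
have [e' e'0 he'] := hX _ u0.
have [q'] : exists q' : rat, ratr q' \in `]u, Num.min (u + e') t[.
  by apply: rat_in_itvoo; rewrite lt_min ltrDl e'0.
rewrite in_itv/= lt_min => /andP[uq /andP[q'e q't]].
exists q'; split; [exact: ltW (lt_trans qu uq)|exact: ltW|].
by rewrite he'// ltW.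
Qed.

End pathwise.

(** * Expectations *)

Section expectations.
Context {R : realType} d (T : measurableType d).
Variables (P : nat -> probability T R) (Phi : R -> T -> nat) (Q : nat -> nat -> R).
Variables (pi g : nat -> R) (i j : nat).
Hypothesis hPhi : markov_chain P Phi Q.
Hypothesis hirr : irreducible P Phi.
Hypothesis hpi : invariant_probability P Phi pi.
Hypothesis hg : (\sum_(0 <= k <oo) (pi k * `|g k|)%:E < +oo)%E.
Local Notation mu := (@lebesgue_measure R).
Local Notation below n := (fun k : nat => (k <= n)%N).
Let a := j.+1.
Let aj : a != j. Proof. by rewrite /a gtn_eqF. Qed.
Local Notation good := (good Phi a j).

Definition before_return (A : pred nat) : set (T * measurableTypeR R) :=
  [set z | 0 <= z.2 /\ forall u, u <= z.2 -> ~ returns A (Phi ^~ z.1) j u].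

Lemma measurable_before_return A : measurable (before_return A).
Proof.
have rc := paths_right_constant hPhi.
pose instate : set (T * measurableTypeR R) := [set z | 0 <= z.2 /\ Phi z.2 z.1 = j].
have minstate : measurable instate.
  by apply: joint_measurable => // t k t0; exact: (measurable_at_state hPhi).
pose from (q : rat) : set (measurableTypeR R) := `[ratr q, +oo[%classic.
pose V := \bigcup_(q in [set: rat]) (if 0 <= ratr q :> R then
  (([set w | [pred k | A k && (k != j)] (Phi (ratr q) w)] `*` from q) `&`
   (instate `|` \bigcup_(q' in [set: rat]) (if ratr q <= ratr q' :> R then
      at_state Phi (ratr q') j `*` from q' else set0))) else set0).
have mV : measurable V.
  apply: bigcupT_measurable_rat => q; case: ifP => // q0; apply: measurableI.
    by apply: measurableX; [exact: (measurable_at_pred hPhi)|exact: measurable_itv].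
  apply: measurableU => //; apply: bigcupT_measurable_rat => q'; case: ifP => // qq'.
  apply: measurableX; last exact: measurable_itv.
  by apply: (measurable_at_state hPhi); exact: le_trans qq'.
rewrite (_ : before_return A = [set z : T * measurableTypeR R | 0 <= z.2] `\` V).
  by apply: measurableD => //; exact: measurable_nneg_products.
apply/seteqP; split=> -[w t] /= [t0 h]; split=> //.
  move=> [q _]; case: ifP => // q0 [[/= /andP[Aq /eqP qj] qt] hq].
  have qt' : ratr q <= t by move: qt; rewrite /from /= in_itv/= andbT.
  have [u ut Ru] : exists2 u, u <= t & returns A (Phi ^~ w) j u.
    apply/(returns_ratP _ _ (rc w) t0); exists q; split=> //.
    case: hq => [[_ tj]|[q' _]]; [by left|case: ifP => // qq' [/= q'j]].
    by rewrite /from /= in_itv/= andbT => q't; right; exists q'.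
  exact: (h u ut Ru).
move=> u ut Ru; apply: h.
have /(returns_ratP _ _ (rc w) t0) [q [q0 qt Aq qj hq]] :
  exists2 u, u <= t & returns A (Phi ^~ w) j u by exists u.
exists q => //; rewrite q0; split.
  by split => /=; [rewrite Aq; exact/eqP|rewrite /from /= in_itv/= andbT].
case: hq => [tj|[q' [qq' q't q'j]]]; [by left|right; exists q' => //].
by rewrite qq'; split=> //=; rewrite /from /= in_itv/= andbT.
Qed.

(** The integrand of [return_integral].  It is set to zero on the paths that are not
    good, where the return may not occur. *)
Definition cost (A B : pred nat) (h : nat -> R) (z : T * measurableTypeR R) : \bar R :=
  ((fun z => (if B (Phi z.2 z.1) then h (Phi z.2 z.1) else 0)%:E) \_
     (before_return A `&` good `*` setT)) z.

Let measurable_dom A : measurable (before_return A `&` good `*` setT).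
Proof.
apply: measurableI; first exact: measurable_before_return.
by apply: measurableX => //; exact: (measurable_good hPhi).
Qed.

Lemma measurable_cost A B h : measurable_fun setT (cost A B h).
Proof.
have [+ _] := measurable_restrictT
  (fun z : T * measurableTypeR R => (if B (Phi z.2 z.1) then h (Phi z.2 z.1) else 0)%:E)
  (measurable_dom A).
apply.
have mk := @measurable_fun_joint _ _ _ _ _ _ hPhi (fun k => (if B k then h k else 0)%:E).
apply: (measurable_funS _ _ mk); first exact: measurable_nneg_products.
by move=> z [[]].
Qed.

Let good_returns w n : good w -> (a <= n)%N -> returns (below n) (Phi ^~ w) j !=set0.
Proof.
move=> [M [r [q [_ rq _ ra qj]]]] an; exists q%:R; split=> //.
exists r%:R; split; [by []|by rewrite ler_nat|by rewrite ra|by rewrite ra; exact/eqP].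
Qed.

Let before_returnE A w rho : returns A (Phi ^~ w) j rho ->
  (forall t, returns A (Phi ^~ w) j t -> rho <= t) ->
  forall t, before_return A (w, t) <-> 0 <= t < rho.
Proof.
move=> Rrho rho_min t; split=> [[/= t0 h]|/andP[t0 trho]].
  by rewrite t0 ltNge; apply/negP => rt; exact: (h rho).
split=> //= u ut /rho_min ru; have := le_trans ru ut.
by rewrite leNgt trho.
Qed.

Let integral_cost w A B h rho : good w -> returns A (Phi ^~ w) j rho ->
  (forall t, returns A (Phi ^~ w) j t -> rho <= t) ->
  (\int[mu]_t cost A B h (w, t) =
   \int[mu]_(s in [set s | (0 <= s < rho) /\ B (Phi s w)]%R) (h (Phi s w))%:E)%E.
Proof.
move=> gw Rrho rho_min; rewrite [RHS]integral_mkcond; apply: eq_integral => t _.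
rewrite /cost !patchE.
have [/(before_returnE Rrho rho_min t) br|nbr] := pselect (0 <= t < rho); last first.
  rewrite !memNset//=; first by move=> [].
  by move=> [/(before_returnE Rrho rho_min t)].
rewrite mem_set; last by split.
have tr : 0 <= t < rho by apply/(before_returnE Rrho rho_min t).
case: (boolP (B (Phi t w))) => Bt; first by rewrite mem_set.
by rewrite memNset//= => -[_]; exact/negP.
Qed.

Lemma integral_cost_censored w n h : good w -> (a <= n)%N ->
  (\int[mu]_t cost (below n) (below n) h (w, t) =
   return_integral h (censored n (Phi ^~ w)) j)%E.
Proof.
move=> gw an; have rc := paths_right_constant hPhi w.
have [rho Rrho rho_min] := returns_min rc (good_returns gw an).
rewrite (integral_cost _ _ gw Rrho rho_min) (return_integral_censored _ _ _ Rrho rho_min)//.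
exact: ltnW.
Qed.

Lemma integral_cost_full w h : good w ->
  (\int[mu]_t cost predT predT h (w, t) = return_integral h (Phi ^~ w) j)%E.
Proof.
move=> gw; have rc := paths_right_constant hPhi w.
have [t /returns_below_sub Rt] := good_returns gw (leqnn a).
have [rho Rrho rho_min] := returns_min rc (ex_intro _ t Rt).
rewrite (integral_cost _ _ gw Rrho rho_min) (return_integralE _ rc Rrho rho_min).
by congr (integral _ _ _); apply/seteqP; split=> s //= [].
Qed.

Let h l : \bar R := (`|g l| + 1)%:E.

Let h1 l : (1 <= h l)%E.
Proof. by rewrite lee_fin lerDr. Qed.

Let meanh : (mean pi h < +oo)%E.
Proof.
have [pi0 pi1 _] := hpi.
rewrite /mean (eq_eseriesr (g := fun k => (pi k * `|g k|)%:E + (pi k)%:E)%E); last first.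
  by move=> k _; rewrite -EFinM mulrDr mulr1.
rewrite nneseriesD; last 2 first.
- by move=> k _ _; rewrite lee_fin mulr_ge0.
- by move=> k _ _; rewrite lee_fin.
by rewrite pi1 lte_add_pinfty// ltry.
Qed.

Local Notation dom := (dominating Phi a j h).

(** Before the return, no integer visit to [a] has been followed by an integer visit
    to [j], as soon as [a <= n]. *)
Let cost_bound n (c C : R) z : (a <= n)%N -> `|c| <= C ->
  (`|cost (below n) (below n) (fun k => (g k - c)%R) z| <= (1 + C)%:E * dom z)%E.
Proof.
move=> an cC; have C0 : 0 <= C by exact: le_trans cC.
have dom0 := @dominating_ge0 _ _ _ Phi a j h h1 z.
rewrite /cost patchE; case: ifPn => [|_]; last first.
  by rewrite abse0 mule_ge0// lee_fin addr_ge0.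
rewrite inE => -[[t0 hz] [gz _]].
have hd : (h (Phi z.2 z.1) <= dom z)%E.
  rewrite [z]surjective_pairing; apply: dominating_ge => //.
  move=> [r [q [r0 rq qt ra qj]]].
  have qz : q%:R <= z.2 by rewrite -truncn_ge_nat.
  apply: (hz q%:R qz); split=> //.
  exists r%:R; split; [by []|by rewrite ler_nat|by rewrite ra|by rewrite ra; exact/eqP].
apply: (@le_trans _ _ ((1 + C)%:E * h (Phi z.2 z.1))%E); last first.
  by rewrite lee_wpmul2l// lee_fin addr_ge0.
rewrite /h -EFinM lee_fin; case: ifP => _; last first.
  by rewrite normr0 mulr_ge0 ?addr_ge0.
have := ler_normB (g (Phi z.2 z.1)) c; have := normr_ge0 (g (Phi z.2 z.1)).
set G := `|g _| => G0 hG; have := mulr_ge0 C0 G0; lra.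
Qed.

(** A state other than [j] visited before the return is at most [n] for large [n],
    and then the path and its censored version return simultaneously. *)
Let cost_cvg (c : nat -> R) (c0 : R) z : c n @[n --> \oo] --> c0 ->
  cost (below n) (below n) (fun k => (g k - c n)%R) z @[n --> \oo] -->
  cost predT predT (fun k => (g k - c0)%R) z.
Proof.
move=> cc; case: z => w t; have rc := paths_right_constant hPhi w.
have [gw|ngw] := pselect (good w); last first.
  rewrite [X in _ --> X](_ : _ = 0%E); last first.
    by rewrite /cost patchE memNset// => -[_ []].
  apply: cvg_near_cst; apply: nearW => n.
  by rewrite /cost patchE memNset// => -[_ []].
have [t' /returns_below_sub Rt'] := good_returns gw (leqnn a).
have [rho Rrho rho_min] := returns_min rc (ex_intro _ t' Rt').
have [_ _ [s [s0 srho _ sj]]] := Rrho.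
have E n : (Phi s w <= n)%N -> before_return (below n) (w, t) <-> before_return predT (w, t).
  move=> sn; apply: iff_trans (iff_sym (before_returnE Rrho rho_min t)).
  apply: before_returnE; last by move=> u /returns_below_sub /rho_min.
  by have [? ? _] := Rrho; split=> //; exists s.
have [br|nbr] := pselect (before_return predT (w, t)); last first.
  rewrite [X in _ --> X](_ : _ = 0%E); last by rewrite /cost patchE memNset// => -[].
  apply: cvg_near_cst; near=> n.
  have sn : (Phi s w <= n)%N by near: n; exact: nbhs_infty_ge.
  by rewrite /cost patchE memNset// => -[/(E n sn)].
rewrite [X in _ --> X](_ : _ = (g (Phi t w) - c0)%:E); last first.
  by rewrite /cost patchE mem_set.
apply: (@cvg_trans _ ((fun n => (g (Phi t w) - c n)%:E) @ \oo)).
  apply: near_eq_cvg; near=> n.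
  have sn : (Phi s w <= n)%N by near: n; exact: nbhs_infty_ge.
  have tn : (Phi t w <= n)%N by near: n; exact: nbhs_infty_ge.
  rewrite /cost patchE mem_set/= ?tn//; split=> //; exact/(E n sn).
by apply: cvg_EFin; [exact: nearW|apply: cvgB => //; exact: cvg_cst].
Unshelve. all: by end_near. Qed.

(** The theorem of dominated convergence is applied on the product of the path space
    and the time axis, and the theorem of Fubini recovers the expectations of the
    return integrals; the bound holds from [n = a] on. *)
Lemma return_integral_cvg (c : nat -> R) (c0 : R) : c n @[n --> \oo] --> c0 ->
  (\int[P i]_w return_integral (fun k => g k - c n)%R (censored n (Phi ^~ w)) j)%E
    @[n --> \oo] -->
  (\int[P i]_w return_integral (fun k => g k - c0)%R (Phi ^~ w) j)%E.
Proof.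
move=> cc; rewrite -(cvg_shiftn a).
have [C [_ hC]] := cvg_seq_bounded (cvgP c0 cc).
pose C1 := `|C| + 1.
have cC n : `|c n| <= C1 by apply: hC => //; rewrite ltr_pwDr// ler_norm.
have C10 : 0 <= C1 by rewrite addr_ge0.
pose f_ n := cost (below (n + a)%N) (below (n + a)%N) (fun k => g k - c (n + a)%N).
pose f := cost predT predT (fun k => g k - c0).
have idom : (P i \x mu)%E.-integrable setT (fun z => (1 + C1)%:E * dom z)%E.
  apply: integrableZl => //; apply/integrableP; split.
    exact: (measurable_dominating hPhi a j h1).
  rewrite (eq_integral dom); last first.
    by move=> z _; rewrite gee0_abs// dominating_ge0.
  exact: (integral_dominating hPhi hirr hpi a j h1 meanh).
have bound n z : (`|f_ n z| <= (1 + C1)%:E * dom z)%E.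
  by apply: cost_bound; [exact: leq_addl|exact: cC].
have fcvg z : f_ n z @[n --> \oo] --> f z.
  have := @cost_cvg c c0 z cc; rewrite -(cvg_shiftn a); exact.
have [intf _ lim] := @dominated_convergence _ _ _ (P i \x mu)%E setT measurableT f_ f
  (fun z => (1 + C1)%:E * dom z)%E (fun n => measurable_cost _ _ _) (measurable_cost _ _ _)
  (aeW _ (fun z _ => fcvg z)) idom (aeW _ (fun z n _ => bound n z)).
have intf_ n : (P i \x mu)%E.-integrable setT (f_ n).
  apply: le_integrable idom => //; first exact: measurable_cost.
  move=> z _; rewrite [leRHS]gee0_abs; first exact: bound.
  by rewrite mule_ge0 ?lee_fin ?addr_ge0// dominating_ge0.
have mG : measurable (~` good) by apply: measurableC; exact: (measurable_good hPhi).
have PG : P i (~` good) = 0%E by exact: (good_ae hPhi hirr hpi a j h1 meanh).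
have E_n n : (\int[P i \x mu]_z f_ n z =
    \int[P i]_w return_integral (fun k => g k - c (n + a)%N)%R (censored (n + a) (Phi ^~ w)) j)%E.
  rewrite -integral12_prod_meas1//; apply: (integral_off_null mG PG) => w /contrapT gw.
  by rewrite /fubini_F integral_cost_censored// leq_addl.
have E_oo : (\int[P i \x mu]_z f z =
    \int[P i]_w return_integral (fun k => g k - c0)%R (Phi ^~ w) j)%E.
  rewrite -integral12_prod_meas1//; apply: (integral_off_null mG PG) => w /contrapT gw.
  by rewrite /fubini_F integral_cost_full.
rewrite E_oo in lim; apply: cvg_trans lim; apply: near_eq_cvg.
by apply: nearW => n; exact: E_n.
Qed.

Lemma reaches_ae : {ae P i, forall w, Phi 0 w = i /\ returns predT (Phi ^~ w) j !=set0}.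
Proof.
have mG : measurable (~` good) by apply: measurableC; exact: (measurable_good hPhi).
have PG : P i (~` good) = 0%E by exact: (good_ae hPhi hirr hpi a j h1 meanh).
have mi : measurable (~` at_state Phi 0 i).
  by apply: measurableC; exact: (measurable_at_state hPhi).
have Pi : P i (~` at_state Phi 0 i) = 0%E.
  by rewrite probability_setC ?(mc_initial hPhi i) ?subee//; exact: (measurable_at_state hPhi).
exists (~` good `|` ~` at_state Phi 0 i); split.
- exact: measurableU.
- by rewrite measureU0.
- move=> w /= hw; apply: contrapT => /not_orP[/contrapT gw /contrapT wi]; apply: hw.
  split=> //; have [t /returns_below_sub Rt] := good_returns gw (leqnn a).
  by exists t.
Qed.

End expectations.

Theorem theorem4p1 (R : realType) (d : measure_display) (T : measurableType d)
    (P : nat -> probability T R) (Phi : R -> T -> nat) (Q : nat -> nat -> R)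
    (pi g : nat -> R) (G : nat -> nat -> nat -> R)
    (npi : forall n : nat, 'rV[R]_n.+1) (j : nat)
    (hPhi : markov_chain P Phi Q)
    (hcons : conservative Q) (hexpl : non_explosive P Phi)
    (hirr : irreducible P Phi) (hrec : positive_recurrent P Phi)
    (hpi : invariant_probability P Phi pi)
    (hg : (\sum_(0 <= k <oo) (pi k * `|g k|)%:E < +oo)%E)
    (hG : forall n, minimal_nonneg_inverse n Q (G n))
    (hnpi : forall n,
      generator_invariant (censored_generator n Q (G n)) (npi n)) :
  (forall i : nat, i <> j ->
    {ae P i, forall w,
      [/\ forall m n, (maxn i j <= m)%N -> (m <= n)%N ->
            (return_time (censored m (fun t => Phi t w)) j <=
             return_time (censored n (fun t => Phi t w)) j)%E,
          return_time (censored n (fun t => Phi t w)) j @[n --> \oo]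
            --> return_time (fun t => Phi t w) j,
          forall m n, (maxn i j <= m)%N -> (m <= n)%N ->
            (return_integral (fun k => `|g k|%R)
               (censored m (fun t => Phi t w)) j <=
             return_integral (fun k => `|g k|%R)
               (censored n (fun t => Phi t w)) j)%E &
          return_integral (fun k => `|g k|%R)
            (censored n (fun t => Phi t w)) j @[n --> \oo]
            --> return_integral (fun k => `|g k|%R) (fun t => Phi t w) j]})
  /\
  (forall i : nat,
    (\int[P i]_w return_integral (censored_centered (npi n) g)
                   (censored n (fun t => Phi t w)) j)%E @[n --> \oo]
      --> (\int[P i]_w return_integral (centered pi g)
                   (fun t => Phi t w) j)%E).
Proof.
split=> i.
  move=> ij; have := reaches_ae i j hPhi hirr hpi hg; apply: filterS => w [w0 ne].
  exact: (censored_limits g (paths_right_constant hPhi w) w0 ij ne).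
have mean_cvg := censored_mean_cvg hPhi hcons hexpl hirr hpi hg hG hnpi.
exact: (return_integral_cvg hPhi hirr hpi hg mean_cvg).
Qed.
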